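(* Let $(t_n)_{n \in \mathbb{Z}}\subset \mathbb{R}$ be a sequence (with $t_n \neq 0$ for $n \neq 0$) such that $(f_n)_{n\in\mathbb{Z}} = \big(\frac{1}{\sqrt{2\pi}} e^{i t_n (\cdot)} \big)_{n\in\mathbb{Z}}$ is a Riesz basis for $L_2[-\pi,\pi]$, and let $(e_n)_{n\in\mathbb{Z}}$, $e_n(x) = \frac{1}{\sqrt{2\pi}}e^{inx}$, be the standard exponential orthonormal basis for $L_2[-\pi,\pi]$. If the map $L$ given by $L e_n = f_n$ satisfies $\| I-L \|<1$, then the biorthogonals $(G_n)_{n\in\mathbb{Z}}$ in $PW_{[-\pi,\pi]}$ of the functions $\frac{1}{\sqrt{2\pi}}\mathcal{F}(f_n)(\cdot) = \mathrm{sinc}(\pi(\cdot-t_n))$ are $$G_n (t) = \frac{H(t)}{(t-t_n)H'(t_n)}, \qquad n \in \mathbb{Z},$$ where $$H(t) = (t-t_0) \prod_{n=1}^{\infty} \Big(1-\frac{t}{t_n} \Big) \Big(1-\frac{t}{t_{-n}} \Big).$$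
   Context: Fourier transform on $L_2(\mathbb{R})$: $\mathcal{F}(f)(\cdot) = \int_{\mathbb{R}} f(\xi)e^{-i \xi\,\cdot}\, d\xi$, with inverse $\mathcal{F}^{-1}(f)(\cdot) = \frac{1}{2\pi}\int_{\mathbb{R}} f(\xi)e^{i \xi\,\cdot}\, d\xi$; functions in $L_2[-\pi,\pi]$ are extended by zero to $\mathbb{R}$. $PW_{[-\pi,\pi]} = \{f \in L_2(\mathbb{R}) : \mathrm{supp}(\mathcal{F}^{-1}(f)) \subset [-\pi,\pi]\}$, a Hilbert space with the $L_2(\mathbb{R})$ inner product, whose elements are identified with their continuous representatives. $\mathrm{sinc}(x) = \frac{\sin x}{x}$, with $\mathrm{sinc}(0)=1$. Given an orthonormal basis $(e_n)_n$ of a Hilbert space $H$, a sequence $(f_n)_n\subset H$ is a Riesz basis for $H$ if the map $Le_n = f_n$ is (extends to) an onto isomorphism $H\to H$. The biorthogonals of a Riesz basis $(f_n)_n$ are the unique sequence $(f_n^* )_n\subset H$ with $\langle f_n , f_m^* \rangle = \delta_{nm}$. *)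

(* Defs.v *)
From HB Require Import structures.
From mathcomp Require Export all_boot all_order all_algebra.
From mathcomp Require Export complex.
From mathcomp Require Export all_classical all_reals all_analysis.

Set Implicit Arguments.
Unset Strict Implicit.
Unset Printing Implicit Defensive.

Import Order.TTheory GRing.Theory Num.Theory.
Import numFieldNormedType.Exports.

Local Open Scope classical_set_scope.
Local Open Scope ring_scope.
Local Open Scope complex_scope.

(** Elements of [L_2(R)] are handled through representatives [R -> R[i]];
    equality in [L_2(R)] is equality almost everywhere.  The space
    [L_2[-pi, pi]] and the Paley-Wiener space are the sets [L2pi] and [PW] of
    representatives, both with the inner product of [L_2(R)]. *)

Section ComplexL2.
Variable R : realType.
Notation mu := (@lebesgue_measure R).

Definition cis (x : R) : R[i] := cos x +i* sin x.

Definition sinc (x : R) : R := if x == 0 then 1 else sin x / x.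

Definition Cintegral (D : set R) (f : R -> R[i]) : R[i] :=
  (\int[mu]_(x in D) complex.Re (f x)) +i* (\int[mu]_(x in D) complex.Im (f x)).

Definition L2norm (f : R -> R[i]) : \bar R :=
  Lnorm mu 2%:E (fun x => (ComplexField.Normc.normc (f x))%:E).

Definition inner (f g : R -> R[i]) : R[i] :=
  Cintegral setT (fun x => f x * conjc (g x)).

Definition eqL2 (f g : R -> R[i]) : Prop := ae_eq mu setT f g.

Definition L2 : set (R -> R[i]) :=
  [set f | [/\ measurable_fun setT (fun x => complex.Re (f x)),
               measurable_fun setT (fun x => complex.Im (f x))
             & (L2norm f < +oo)%E]].

(** Functions on [[-pi, pi]], extended by zero to the whole line. *)
Definition L2pi : set (R -> R[i]) :=
  [set f | L2 f /\ forall x, x \notin `[- pi, pi] -> f x = 0].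

(** [F(f) = g] and [F^-1(f) = g].  As [f] need not be integrable, the defining
    integrals are limits in the mean of the integrals over [[-N, N]]. *)
Definition is_fourier (f g : R -> R[i]) : Prop :=
  L2 g /\
  (fun N : nat => L2norm (fun x =>
     Cintegral `[- N%:R, N%:R] (fun xi => f xi * cis (- (xi * x))) - g x))
    @ \oo --> 0%E.

Definition is_inv_fourier (f g : R -> R[i]) : Prop :=
  L2 g /\
  (fun N : nat => L2norm (fun x =>
     ((2 * pi)^-1)%:C *
       Cintegral `[- N%:R, N%:R] (fun xi => f xi * cis (xi * x)) - g x))
    @ \oo --> 0%E.

(** Support of an element of [L_2(R)]: complement of the union of the open
    sets on which it vanishes almost everywhere. *)
Definition supp (f : R -> R[i]) : set R :=
  ~` \bigcup_(U in [set U : set R | open U /\ ae_eq mu U f (cst 0)]) U.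

(** The continuity requirement selects the continuous representative, so
    elements of [PW] may be compared pointwise. *)
Definition PW : set (R -> R[i]) :=
  [set f | [/\ L2 f, continuous (f : R -> R[i]^o)
    & exists2 g, is_inv_fourier f g & supp g `<=` `[- pi, pi]]].

(** Bounded linear maps [V -> V], for a subspace [V] of [L_2(R)]. *)
Definition bounded_operator (V : set (R -> R[i]))
    (T : (R -> R[i]) -> (R -> R[i])) : Prop :=
  [/\ forall f, V f -> V (T f),
      forall f g, V f -> V g -> eqL2 f g -> eqL2 (T f) (T g),
      forall (a : R[i]) f g, V f -> V g ->
        eqL2 (T (fun x => a * f x + g x)) (fun x => a * T f x + T g x)
    & exists M : R, forall f, V f -> (L2norm (T f) <= M%:E * L2norm f)%E].

Definition onto_isomorphism (V : set (R -> R[i]))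
    (T : (R -> R[i]) -> (R -> R[i])) : Prop :=
  bounded_operator V T /\
  exists2 S, bounded_operator V S &
    forall f, V f -> eqL2 (S (T f)) f /\ eqL2 (T (S f)) f.

Definition opnorm (V : set (R -> R[i]))
    (T : (R -> R[i]) -> (R -> R[i])) : \bar R :=
  ereal_sup [set L2norm (T f) | f in [set f | V f /\ (L2norm f <= 1)%E]].

(** [e] is meant to be an orthonormal basis of [V]. *)
Definition riesz_basis (V : set (R -> R[i])) (e f : int -> R -> R[i]) : Prop :=
  (forall n, V (f n)) /\
  exists2 T, onto_isomorphism V T & forall n, eqL2 (T (e n)) (f n).

Definition biorthogonal (V : set (R -> R[i])) (f g : int -> R -> R[i]) : Prop :=
  (forall n, V (g n)) /\ forall n m, inner (f n) (g m) = (n == m)%:R.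

(** [x |-> (2 pi)^(-1/2) e^(i s x)] on [[-pi, pi]], extended by zero. *)
Definition expo (s : R) : R -> R[i] := fun x =>
  if x \in `[- pi, pi] then ((Num.sqrt (2 * pi))^-1)%:C * cis (s * x) else 0.

Definition std_basis (n : int) : R -> R[i] := expo n%:~R.

Definition Hprod (t : int -> R) (x : R) (N : nat) : R :=
  \prod_(1 <= n < N.+1) ((1 - x / t n%:Z) * (1 - x / t (- n%:Z))).

Definition Hfun (t : int -> R) (x : R) : R :=
  (x - t 0) * limn (Hprod t x).

(** At [x = t n] the quotient is read as its limit, which is [1] by definition
    of the derivative since [Hfun t (t n) = 0]. *)
Definition Gfun (t : int -> R) (n : int) (x : R) : R[i] :=
  (if x == t n then 1
   else Hfun t x / ((x - t n) * derive1 (Hfun t) (t n)))%:C.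

End ComplexL2.

(* Main.v *)
(** The estimate [||I - L|| < 1] dualises to [sum_n |<f, e_n - f_n>|^2 <= q^2 ||f||^2] with [q < 1].

    Uniqueness: a function orthogonal to every [f_n] has
    [||f||^2 = sum_n |<f, e_n>|^2 = sum_n |<f, e_n - f_n>|^2 <= q^2 ||f||^2], so it is zero.

    Product formula: applied to combinations of the [e_k], the dual estimate says that the matrix
    [(sinc (pi (t_n - k)))_(n,k)], as well as each of its finite sections [|n|, |k| <= N], is within
    [q] of the identity.  Since [sin (pi x) = pi x prod_k (1 - x^2/k^2)], Lagrange interpolation at
    the integers shows that [prod_(N < k) (1 - x^2/k^2) prod_(|m| <= N, m <> n) (x - t_m)] is a linear
    combination of the functions [sinc (pi (x - k))], [|k| <= N].  Up to a scalar its coefficients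
    therefore solve the N-th finite section with right-hand side [delta_n].  These solutions are
    bounded in l^2 and converge strongly, while [prod_(N < k) (1 - x^2/k^2)] tends to 1; so
    [prod_(|m| <= N, m <> n) (x - t_m) / (t_n - t_m)] converges to the biorthogonal function [G_n].
    The estimate persists when [t_0] is replaced by 0, which gives the convergence of the product
    defining [H], and comparing the two products gives [H x = c (x - t_n) G_n x] with
    [c = H'(t_n) <> 0]. *)

(* All matrix entries of the argument are real numbers [sinc (pi * (t n - k))]. The Hilbert space is
   therefore treated over the reals, and complex information enters by listing every exponential
   together with its multiple by ['i]. The polynomial with zeros at the perturbed nodes is not
   square-integrable. The tail of the sine product supplies the zeros at the integers beyond N and
   brings it into the Paley-Wiener space. The tail has to make sense where [sin (pi * x)] vanishes,
   so it is built as a quotient of Wallis-type integrals and not by division. Distinctness of the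
   nodes and nonvanishing of the normalising constants are not assumed: both come out of the
   injectivity of the finite sections. On the Fourier side Plancherel is proved for functions of
   compact support only. General elements of the Paley-Wiener space are reached by truncation, and
   inversion is a computation of norms, without pointwise inversion. *)
Require Import Defs.
From mathcomp Require Import all_boot all_order all_algebra complex.
From mathcomp Require Import all_classical all_reals all_analysis.
From mathcomp Require Import measurable_realfun qpoly.
From mathcomp Require Import ring lra.
Set Implicit Arguments.
Unset Strict Implicit.
Unset Printing Implicit Defensive.
Import Order.TTheory GRing.Theory Num.Theory.
Import numFieldNormedType.Exports.
Local Open Scope classical_set_scope.
Local Open Scope ring_scope.

(** * Square-integrable functions *)

Section SquareIntegrable.
Context d (T : measurableType d) (R : realType) (mu : {measure set T -> \bar R}).
Implicit Types u v : T -> R.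

Definition sqint u :=
  measurable_fun setT u /\ mu.-integrable setT (fun x => (u x ^+ 2)%:E).

Lemma sqintP u : measurable_fun setT u ->
  (\int[mu]_x (u x ^+ 2)%:E < +oo)%E -> sqint u.
Proof.
move=> mu_ fu; split => //; apply/integrableP; split.
  exact/measurable_EFinP/measurable_funX.
by under eq_integral do rewrite abse_EFin ger0_norm ?sqr_ge0//.
Qed.

Lemma sqint_dom u v : measurable_fun setT u -> sqint v ->
  (forall x, u x ^+ 2 <= v x ^+ 2) -> sqint u.
Proof.
move=> mu_ [mv iv] uv; split => //.
apply: (le_integrable measurableT _ _ iv) => //.
  exact/measurable_EFinP/measurable_funX.
by move=> x _ /=; rewrite lee_fin !ger0_norm ?sqr_ge0.
Qed.

Lemma sqint_mul u v : sqint u -> sqint v ->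
  mu.-integrable setT (fun x => (u x * v x)%:E).
Proof.
move=> [mu_ iu] [mv iv].
have := integrableD measurableT iu iv.
apply: (le_integrable measurableT) => //.
  exact/measurable_EFinP/measurable_funM.
move=> x _ /=; rewrite lee_fin.
rewrite normrM (ger0_norm (addr_ge0 (sqr_ge0 _) (sqr_ge0 _))).
have := sqr_ge0 (`|u x| - `|v x|).
rewrite -(real_normK (num_real (u x))) -(real_normK (num_real (v x))).
have := normr_ge0 (u x); have := normr_ge0 (v x); nra.
Qed.

Lemma sqintD u v : sqint u -> sqint v -> sqint (fun x => u x + v x).
Proof.
move=> su sv; have [mu_ iu] := su; have [mv iv] := sv; split.
  exact: measurable_funD.
have iuv := sqint_mul su sv.
have -> : (fun x => ((u x + v x) ^+ 2)%:E) =
  (fun x => (u x ^+ 2)%:E + ((v x ^+ 2)%:E + (2%:E * (u x * v x)%:E)))%E.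
  by apply/funext => x; rewrite -EFinM -!EFinD; congr EFin; ring.
apply: integrableD => //; apply: integrableD => //.
exact: integrableZl.
Qed.

Lemma sqintZ (c : R) u : sqint u -> sqint (fun x => c * u x).
Proof.
move=> [mu_ iu]; split; first exact: measurable_funM.
have -> : (fun x => ((c * u x) ^+ 2)%:E) = (fun x => (c ^+ 2)%:E * (u x ^+ 2)%:E)%E.
  by apply/funext => x; rewrite -EFinM exprMn.
exact: integrableZl.
Qed.

Lemma sqintN u : sqint u -> sqint (fun x => - u x).
Proof.
move=> /(sqintZ (-1)); have -> // : (fun x => -1 * u x) = (fun x => - u x).
by apply/funext => x; rewrite mulN1r.
Qed.

Lemma sqintB u v : sqint u -> sqint v -> sqint (fun x => u x - v x).
Proof. by move=> su /sqintN sv; exact: sqintD. Qed.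

Lemma sqint0 : sqint (fun=> 0).
Proof.
split; first exact: measurable_cst.
under eq_fun do rewrite expr0n/=.
exact: integrable0.
Qed.

Lemma sqint_bM u (b : T -> R) : sqint u -> measurable_fun setT b ->
  (forall x, `|b x| <= 1 :> R) -> sqint (fun x => u x * b x).
Proof.
move=> su mb b1; apply: (sqint_dom _ su).
  by apply: measurable_funM => //; case: su.
move=> x; rewrite exprMn ler_piMr ?sqr_ge0//.
by rewrite -real_normK ?num_real// expr_le1.
Qed.

(** Fatou's lemma with a fixed comparison function: an L2 distance bound survives pointwise
    convergence, which is how the a.e. limit of a subsequence becomes an L2 limit. *)
Lemma fatou_sqint_le (u_ : (T -> R)^nat) (u w : T -> R) (e : \bar R) :
    (forall n, measurable_fun setT (u_ n)) -> measurable_fun setT w ->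
    (forall x, u_ ^~ x @ \oo --> u x) ->
    (forall n, \int[mu]_x ((u_ n x - w x) ^+ 2)%:E <= e)%E ->
  (\int[mu]_x ((u x - w x) ^+ 2)%:E <= e)%E.
Proof.
move=> mu_ mw uu ue.
pose f n x := ((u_ n x - w x) ^+ 2)%:E.
have mf n : measurable_fun setT (f n).
  by apply/measurable_EFinP/measurable_funX/measurable_funB.
have f0 n x : setT x -> (0 <= f n x)%E by move=> _; rewrite lee_fin sqr_ge0.
have := fatou mu measurableT mf f0.
have -> : (\int[mu]_x limn_einf (f^~ x))%E = (\int[mu]_x ((u x - w x) ^+ 2)%:E)%E.
  apply: eq_integral => x _; apply: (cvg_limn_einf_sup _).1.
  apply: cvg_EFin; first exact: nearW.
  have h : u_ n x - w x @[n --> \oo] --> u x - w x.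
    by apply: cvgB; [exact: uu|exact: cvg_cst].
  rewrite expr2; under eq_fun do rewrite /f /= expr2.
  exact: cvgM.
move=> /le_trans; apply.
rewrite limn_einf_lim; apply: lime_le.
  exact: is_cvg_einfs.
apply: nearW => n; apply: le_trans (ue n).
by apply: ereal_inf_lbound; exists n => /=.
Qed.

(* The increments along a fast subsequence have an a.e. finite weighted square sum, so they are
   a.e. dominated by a geometric sequence. *)
Lemma sqint_fast_cvg_ae (u_ : (T -> R)^nat) :
    (forall n, sqint (u_ n)) ->
    (forall n, \int[mu]_x ((u_ n.+1 x - u_ n x) ^+ 2)%:E <= ((8^-1 : R) ^+ n.+1)%:E)%E ->
  {ae mu, forall x, cvgn (fun n => u_ n x)}.
Proof.
move=> su hu.
(* The weight [4 ^ k] leaves the summable bound 2^-(k+1) for the integrals, and finiteness of the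
   sum still forces the increments below a multiple of 2^-k. *)
pose g k x := ((4 ^+ k)%:E * ((u_ k.+1 x - u_ k x) ^+ 2)%:E)%E.
have mg k : measurable_fun setT (fun x => ((u_ k.+1 x - u_ k x) ^+ 2)%:E).
  by apply/measurable_EFinP/measurable_funX/measurable_funB; [exact: (su _).1|exact: (su _).1].
have g0 k x : setT x -> (0 <= g k x)%E.
  by move=> _; rewrite /g -EFinM lee_fin mulr_ge0// ?sqr_ge0// exprn_ge0.
have mg' k : measurable_fun setT (g k) by exact: emeasurable_funM.
have mW : measurable_fun setT (fun x => \sum_(0 <= k <oo) g k x)%E.
  by apply: ge0_emeasurable_sum => // k x _ _; exact: g0.
have iW : mu.-integrable setT (fun x => \sum_(0 <= k <oo) g k x)%E.
  apply/integrableP; split => //.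
  rewrite (eq_integral (fun x => \sum_(0 <= k <oo) g k x)%E); last first.
    by move=> x _; rewrite gee0_abs// nneseries_ge0// => k _ _; exact: g0.
  rewrite integral_nneseries//.
  apply: (@le_lt_trans _ _ (\sum_(0 <= k <oo) ((1 / (2 ^ k.+1)%:R)%:E)%E)%E); last first.
    by apply: le_lt_trans (epsilon_trick0 xpredT _) _; rewrite ?ltry.
  apply: lee_nneseries => k _.
    by move=> *; apply: integral_ge0 => x _; exact: g0.
  rewrite /g ge0_integralZl//; last by move=> x _; rewrite lee_fin sqr_ge0.
  apply: (@le_trans _ _ ((4 ^+ k)%:E * ((8^-1 : R) ^+ k.+1)%:E)%E).
    by rewrite lee_pmul2l// ?lte_fin ?exprn_gt0.
  rewrite -EFinM lee_fin natrX div1r -exprVn.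
  apply: (@le_trans _ _ (4 ^+ k.+1 * 8^-1 ^+ k.+1)).
    by rewrite ler_wpM2r ?exprn_ge0// exprS ler_peMl ?exprn_ge0 ?ler1n.
  rewrite -exprMn; suff -> : 4 * 8^-1 = 2^-1 :> R by [].
  by field.
have := integrable_ae measurableT iW.
apply: filterS => x /(_ I) fW.
set W := (\sum_(0 <= k <oo) g k x)%E in fW.
have gW k : (g k x <= W)%E.
  rewrite /W (@nneseriesD1 _ _ k)//; last by move=> *; exact: g0.
  by rewrite leeDl// nneseries_ge0// => *; exact: g0.
pose M := fine W.
have M0 : 0 <= M by rewrite fine_ge0// (le_trans (g0 0%N x I)).
have wk k : `|u_ k.+1 x - u_ k x| <= geometric (M + 1) 2^-1 k.
  rewrite /geometric /=; have := gW k.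
  rewrite -(fineK fW) -/M /g -EFinM lee_fin => h.
  rewrite exprVn ler_pdivlMr ?exprn_gt0//.
  rewrite -ler_sqr ?nnegrE ?mulr_ge0 ?exprn_ge0 ?addr_ge0//.
  rewrite exprMn real_normK ?num_real// -exprM mulnC exprM mulrC.
  have -> : 2 ^+ 2 = 4 :> R by rewrite expr2; ring.
  by apply: le_trans h _; nra.
have : cvgn (series (fun k => u_ k.+1 x - u_ k x)).
  apply: normed_cvg; apply: series_le_cvg wk _.
  - by move=> n; exact: normr_ge0.
  - by move=> n; rewrite /geometric/= mulr_ge0 ?addr_ge0// exprn_ge0.
  - apply: is_cvg_geometric_series; rewrite ger0_norm ?invr_ge0// invf_lt1//; lra.
have -> : series (fun k => u_ k.+1 x - u_ k x) = (fun n => u_ n x - u_ 0%N x).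
  by apply/funext => n; rewrite seriesEnat/= telescope_sumr.
move=> h; have -> : (fun n => u_ n x) = (fun n => u_ n x - u_ 0%N x) \+ cst (u_ 0%N x).
  by apply/funext => n /=; rewrite subrK.
exact: (is_cvgD h (is_cvg_cst _)).
Qed.

Lemma sqint_complete (u_ : (T -> R)^nat) :
    (forall n, sqint (u_ n)) ->
    (forall e : R, 0 < e -> exists N, forall m n, (N <= m)%N -> (N <= n)%N ->
      (\int[mu]_x ((u_ m x - u_ n x) ^+ 2)%:E <= e%:E)%E) ->
  exists u, sqint u /\ forall e : R, 0 < e -> exists N, forall n, (N <= n)%N ->
      (\int[mu]_x ((u x - u_ n x) ^+ 2)%:E <= e%:E)%E.
Proof.
move=> su cu.
have e0 n : 0 < (8^-1 : R) ^+ n.+1 by rewrite exprn_gt0.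
have /choice[N hN] : forall k, exists N, forall m n, (N <= m)%N -> (N <= n)%N ->
    (\int[mu]_x ((u_ m x - u_ n x) ^+ 2)%:E <= ((8^-1 : R) ^+ k.+1)%:E)%E.
  by move=> k; exact: cu.
(* The partial sums make [phi] nondecreasing and at least [N k], so consecutive terms satisfy the
   bound of index [k]; adding [k] makes the subsequence cofinal. *)
pose phi k := (\sum_(0 <= j < k.+1) N j + k)%N.
have Nphi k : (N k <= phi k)%N by rewrite /phi big_nat_recr//= -addnA addnCA leq_addr.
have phiS k : (phi k <= phi k.+1)%N.
  by rewrite /phi [in leqRHS]big_nat_recr//= -addnA leq_add2l (leq_trans (leqnSn k))// leq_addl.
have kphi k : (k <= phi k)%N by rewrite /phi leq_addl.
have : {ae mu, forall x, cvgn (fun n => u_ (phi n) x)}.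
  apply: sqint_fast_cvg_ae => n; first exact: su.
  by apply: hN; [exact: leq_trans (Nphi n) (phiS n)|exact: Nphi].
move=> -[Z [mZ Z0 nZ]].
have cZ x : ~ Z x -> cvgn (fun n => u_ (phi n) x).
  by move=> nZx; apply: contrapT => ncv; exact/nZx/nZ.
(* Cutting to 0 on the exceptional null set makes the sequence converge everywhere, so that its
   limit is measurable; the integrals do not change. *)
pose v n x := u_ (phi n) x * \1_(~` Z) x.
have mv n : measurable_fun setT (v n).
  apply: measurable_funM; first exact: (su _).1.
  by apply: measurable_indic; exact: measurableC.
have cv x : cvgn (v ^~ x).
  rewrite /v; have [Zx|nZx] := pselect (Z x).
    rewrite indicE memNset; last by move=> /(_ Zx).
    under eq_fun do rewrite mulr0; exact: is_cvg_cst.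
  rewrite indicE mem_set//; under eq_fun do rewrite mulr1.
  exact: cZ.
pose u x := limn (v ^~ x).
have vu x : v ^~ x @ \oo --> u x by exact: cv.
have mu_ : measurable_fun setT u.
  by apply: (measurable_fun_cvg mv) => x _; exact: vu.
have vE n m : (\int[mu]_x ((v n x - u_ m x) ^+ 2)%:E =
    \int[mu]_x ((u_ (phi n) x - u_ m x) ^+ 2)%:E)%E.
  apply: ae_eq_integral => //.
  - by apply/measurable_EFinP/measurable_funX/measurable_funB => //; exact: (su _).1.
  - by apply/measurable_EFinP/measurable_funX/measurable_funB; exact: (su _).1.
  - exists Z; split => // x /= h; apply: contrapT => nZx; apply: h => _.
    by rewrite /v indicE mem_set// mulr1.
have key e : 0 < e -> exists N, forall n, (N <= n)%N ->
    (\int[mu]_x ((u x - u_ n x) ^+ 2)%:E <= e%:E)%E.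
  move=> /cu[K hK]; exists K => n Kn.
  apply: (@fatou_sqint_le (fun k => v (k + K)%N)) => //.
  - exact: (su _).1.
  - move=> x; have := vu x; rewrite -(cvg_shiftn K) //.
  - move=> k; rewrite vE; apply: hK => //.
    by rewrite (leq_trans _ (kphi _))// leq_addl.
exists u; split => //.
have [K hK] := key 1 ltr01.
have sd : sqint (fun x => u x - u_ K x).
  apply: sqintP; first by apply: measurable_funB => //; exact: (su _).1.
  by apply: le_lt_trans (hK _ (leqnn K)) _; rewrite ltry.
have -> : u = (fun x => (u x - u_ K x) + u_ K x) by apply/funext => x; rewrite subrK.
exact: sqintD.
Qed.

End SquareIntegrable.

Section ComplexParts.
Local Open Scope complex_scope.
Variable R : rcfType.
Implicit Types (a : R) (x y : R[i]).

Lemma cReD x y : complex.Re (x + y) = complex.Re x + complex.Re y.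
Proof. by case: x y => [? ?] [? ?]. Qed.
Lemma cImD x y : complex.Im (x + y) = complex.Im x + complex.Im y.
Proof. by case: x y => [? ?] [? ?]. Qed.
Lemma cReN x : complex.Re (- x) = - complex.Re x.
Proof. by case: x => [? ?]. Qed.
Lemma cImN x : complex.Im (- x) = - complex.Im x.
Proof. by case: x => [? ?]. Qed.
Lemma cReM x y :
  complex.Re (x * y) = complex.Re x * complex.Re y - complex.Im x * complex.Im y.
Proof. by case: x y => [? ?] [? ?]. Qed.
Lemma cImM x y :
  complex.Im (x * y) = complex.Re x * complex.Im y + complex.Im x * complex.Re y.
Proof. by case: x y => [? ?] [? ?]. Qed.
Lemma cReZ a x : complex.Re (a%:C * x) = a * complex.Re x.
Proof. by rewrite cReM /= mul0r subr0. Qed.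
Lemma cImZ a x : complex.Im (a%:C * x) = a * complex.Im x.
Proof. by rewrite cImM /= mul0r addr0. Qed.
Lemma cReJ x : complex.Re (conjc x) = complex.Re x.
Proof. by case: x. Qed.
Lemma cImJ x : complex.Im (conjc x) = - complex.Im x.
Proof. by case: x. Qed.
Definition complex_partsE := (cReD, cImD, cReN, cImN, cReZ, cImZ, cReM, cImM, cReJ, cImJ).

Lemma complex_eq x y :
  complex.Re x = complex.Re y -> complex.Im x = complex.Im y -> x = y.
Proof. by case: x y => [? ?] [? ?] /= -> ->. Qed.

(** The squared modulus as an element of [R]: the norm of [R[i]] takes its values in [R[i]]. *)
Definition sqn x : R := complex.Re x ^+ 2 + complex.Im x ^+ 2.

Lemma sqn_ge0 x : 0 <= sqn x.
Proof. by rewrite addr_ge0 ?sqr_ge0. Qed.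

Lemma sqn_eq0 x : sqn x = 0 -> x = 0.
Proof.
move=> /eqP; rewrite paddr_eq0 ?sqr_ge0// !sqrf_eq0 => /andP[/eqP re /eqP im].
exact: complex_eq.
Qed.

Lemma sqnM x y : sqn (x * y) = sqn x * sqn y.
Proof. by rewrite /sqn !complex_partsE; ring. Qed.

End ComplexParts.

(** * Complex square-integrable functions as a real Hilbert space *)

Section ComplexDot.
Local Open Scope complex_scope.
Context d (T : measurableType d) (R : realType) (mu : {measure set T -> \bar R}).
Implicit Types f g h : T -> R[i].

Definition cL2 f := sqint mu (fun x => complex.Re (f x)) /\
                    sqint mu (fun x => complex.Im (f x)).

(* The real part of the Hermitian product: complex functions are treated as a real Hilbert space,
   and [inner f g = dot f g +i* dot f ('i * g)]. *)
Definition dot f g : R :=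
  \int[mu]_x (complex.Re (f x) * complex.Re (g x) + complex.Im (f x) * complex.Im (g x)).

Lemma cL2D f g : cL2 f -> cL2 g -> cL2 (fun x => f x + g x).
Proof.
move=> [rf imf] [rg img]; split.
  by under eq_fun do rewrite cReD; exact: sqintD.
by under eq_fun do rewrite cImD; exact: sqintD.
Qed.

Lemma cL2N f : cL2 f -> cL2 (fun x => - f x).
Proof.
move=> [rf imf]; split.
  by under eq_fun do rewrite cReN; exact: sqintN.
by under eq_fun do rewrite cImN; exact: sqintN.
Qed.

Lemma cL2B f g : cL2 f -> cL2 g -> cL2 (fun x => f x - g x).
Proof. by move=> cf /cL2N cg; exact: cL2D. Qed.

Lemma cL20 : cL2 (fun=> 0).
Proof. by split; exact: sqint0. Qed.

Lemma cL2J f : cL2 f -> cL2 (fun x => conjc (f x)).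
Proof.
move=> [rf imf]; split.
  by under eq_fun do rewrite cReJ; exact: rf.
by under eq_fun do rewrite cImJ; exact: sqintN.
Qed.

Lemma cL2M f (c : R[i]) : cL2 f -> cL2 (fun x => c * f x).
Proof.
move=> [rf imf]; split.
  by under eq_fun do rewrite cReM; apply: sqintB; exact: sqintZ.
by under eq_fun do rewrite cImM; apply: sqintD; exact: sqintZ.
Qed.

Lemma cL2bM f (b : T -> R[i]) : cL2 f ->
  measurable_fun setT (fun x => complex.Re (b x)) ->
  measurable_fun setT (fun x => complex.Im (b x)) ->
  (forall x, sqn (b x) <= 1) -> cL2 (fun x => f x * b x).
Proof.
move=> [rf imf] mr mi b1.
have b1r x : `|complex.Re (b x)| <= 1.
  rewrite -(expr_le1 (n := 2))// real_normK ?num_real//.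
  by apply: le_trans (b1 x); rewrite lerDl sqr_ge0.
have b1i x : `|complex.Im (b x)| <= 1.
  rewrite -(expr_le1 (n := 2))// real_normK ?num_real//.
  by apply: le_trans (b1 x); rewrite lerDr sqr_ge0.
split.
  by under eq_fun do rewrite cReM; apply: sqintB; exact: sqint_bM.
by under eq_fun do rewrite cImM; apply: sqintD; exact: sqint_bM.
Qed.

Lemma cL2_sum n (F : 'I_n -> T -> R[i]) :
  (forall i, cL2 (F i)) -> cL2 (fun x => \sum_(i < n) F i x).
Proof.
elim: n F => [|n IH] F hF.
  by under eq_fun do rewrite big_ord0; exact: cL20.
by under eq_fun do rewrite big_ord_recr /=; apply: cL2D => //; exact: IH.
Qed.

Lemma dot_integrable f g : cL2 f -> cL2 g ->
  mu.-integrable setT (EFin \o (fun x => complex.Re (f x) * complex.Re (g x) +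
                         complex.Im (f x) * complex.Im (g x))).
Proof.
move=> [rf imf] [rg img].
have -> : EFin \o (fun x => complex.Re (f x) * complex.Re (g x) +
      complex.Im (f x) * complex.Im (g x)) =
    (fun x => (complex.Re (f x) * complex.Re (g x))%:E +
      (complex.Im (f x) * complex.Im (g x))%:E)%E.
  by apply/funext => x /=; rewrite EFinD.
by apply: integrableD => //; exact: sqint_mul.
Qed.

Lemma dotC f g : dot f g = dot g f.
Proof.
by apply: eq_Rintegral => x _; rewrite mulrC [X in _ + X = _]mulrC.
Qed.

Lemma dotDl f g h : cL2 f -> cL2 g -> cL2 h ->
  dot (fun x => f x + g x) h = dot f h + dot g h.
Proof.
move=> cf cg ch; rewrite /dot -RintegralD//; [|exact: dot_integrable..].
by apply: eq_Rintegral => x _; rewrite !complex_partsE; ring.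
Qed.

Lemma dotZl (c : R) f g : cL2 f -> cL2 g ->
  dot (fun x => c%:C * f x) g = c * dot f g.
Proof.
move=> cf cg; rewrite /dot -RintegralZl//; last exact: dot_integrable.
by apply: eq_Rintegral => x _; rewrite !complex_partsE; ring.
Qed.

Lemma dotNl f g : cL2 f -> cL2 g -> dot (fun x => - f x) g = - dot f g.
Proof.
move=> cf cg; rewrite -mulN1r -dotZl//; congr dot; apply/funext => x.
by apply: complex_eq; rewrite !complex_partsE mulN1r.
Qed.

Lemma dotBl f g h : cL2 f -> cL2 g -> cL2 h ->
  dot (fun x => f x - g x) h = dot f h - dot g h.
Proof. by move=> cf cg ch; rewrite dotDl ?dotNl//; exact: cL2N. Qed.

Lemma dotDr f g h : cL2 f -> cL2 g -> cL2 h ->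
  dot h (fun x => f x + g x) = dot h f + dot h g.
Proof. by move=> cf cg ch; rewrite dotC dotDl// !(dotC h). Qed.

Lemma dotBr f g h : cL2 f -> cL2 g -> cL2 h ->
  dot h (fun x => f x - g x) = dot h f - dot h g.
Proof. by move=> cf cg ch; rewrite dotC dotBl// !(dotC h). Qed.

Lemma dotZr (c : R) f g : cL2 f -> cL2 g ->
  dot g (fun x => c%:C * f x) = c * dot g f.
Proof. by move=> cf cg; rewrite dotC dotZl// dotC. Qed.

Lemma dot_suml n (c : nat -> R) (F : nat -> T -> R[i]) g :
  (forall i, cL2 (F i)) -> cL2 g ->
  dot (fun x => \sum_(i < n) (c i)%:C * F i x) g = \sum_(i < n) c i * dot (F i) g.
Proof.
move=> cF cg; elim: n => [|n IH].
  rewrite big_ord0 /dot; under eq_Rintegral do rewrite big_ord0 /= !mul0r addr0.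
  by rewrite Rintegral_cst// mul0r.
rewrite big_ord_recr -IH /= -dotZl// -dotDl//.
- by congr dot; apply/funext => x; rewrite big_ord_recr.
- by apply: cL2_sum => i; exact: cL2M.
- exact: cL2M.
Qed.

Lemma dotE f : cL2 f -> (dot f f)%:E = (\int[mu]_x (sqn (f x))%:E)%E.
Proof.
move=> cf; rewrite /dot /Rintegral fineK; last exact: integrable_fin_num (dot_integrable cf cf).
by apply: eq_integral.
Qed.

Lemma dot_ge0 f : 0 <= dot f f.
Proof. by apply: Rintegral_ge0 => x _; exact: sqn_ge0. Qed.

Lemma dot_le f g : cL2 f -> cL2 g -> (forall x, sqn (f x) <= sqn (g x)) ->
  dot f f <= dot g g.
Proof.
move=> cf cg fg; apply: le_Rintegral => //.
- exact: (dot_integrable cf cf).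
- exact: (dot_integrable cg cg).
- by move=> x _; rewrite -!expr2; exact: fg.
Qed.

Lemma dotD2 f g : cL2 f -> cL2 g ->
  dot (fun x => f x + g x) (fun x => f x + g x) <= 2 * dot f f + 2 * dot g g.
Proof.
move=> cf cg; have cfg := cL2D cf cg.
rewrite dotDl// !dotDr// (dotC g f).
suff : 0 <= dot (fun x => f x - g x) (fun x => f x - g x).
  rewrite dotBl ?dotBr// ?(dotC g f); [lra|exact: cL2B].
exact: dot_ge0.
Qed.

Lemma dot_CS f g : cL2 f -> cL2 g -> dot f g ^+ 2 <= dot f f * dot g g.
Proof.
move=> cf cg.
have pos (s : R) : 0 <= dot f f - 2 * s * dot f g + s ^+ 2 * dot g g.
  have csg := cL2M s%:C cg.
  have := dot_ge0 (fun x => f x - s%:C * g x).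
  rewrite dotBl//; last exact: cL2B.
  rewrite !dotBr// !dotZl// !dotZr// (dotC g f); lra.
have [g0|gn0] := eqVneq (dot g g) 0.
  rewrite g0 mulr0; have [->|n0] := eqVneq (dot f g) 0; first by rewrite expr0n.
  (* For [dot g g = 0] the polynomial is affine in [s]; this value of [s] would make it -1. *)
  have := pos ((dot f f + 1) / (2 * dot f g)).
  rewrite g0 mulr0 addr0.
  suff -> : 2 * ((dot f f + 1) / (2 * dot f g)) * dot f g = dot f f + 1 by lra.
  by field.
have gp : 0 < dot g g by rewrite lt_neqAle eq_sym gn0 dot_ge0.
have := pos (dot f g / dot g g).
have -> : dot f f - 2 * (dot f g / dot g g) * dot f g + (dot f g / dot g g) ^+ 2 * dot g g =
  (dot f f * dot g g - dot f g ^+ 2) / dot g g by field.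
by rewrite pmulr_lge0 ?invr_gt0// subr_ge0.
Qed.

End ComplexDot.

Lemma sum_nat_sub (V : zmodType) (F : nat -> V) m n : (m <= n)%N ->
  \sum_(i < n) F i - \sum_(i < m) F i = \sum_(m <= i < n) F i.
Proof.
move=> mn; rewrite -!(big_mkord xpredT F) (big_cat_nat _ mn)//=.
by rewrite addrAC subrr add0r.
Qed.

Arguments sum_nat_sub {V} F {m n}.

(** * Orthonormal sequences: Bessel, Riesz-Fischer, Parseval *)

Section Orthonormal.
Local Open Scope complex_scope.
Context d (T : measurableType d) (R : realType) (mu : {measure set T -> \bar R}).
Implicit Types f g h : T -> R[i].
Notation dot := (dot mu).
Notation cL2 := (cL2 mu).

Definition lincomb (c : nat -> R) (b : nat -> T -> R[i]) n : T -> R[i] :=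
  fun x => \sum_(i < n) (c i)%:C * b i x.

Lemma dot_eq0_ae f : cL2 f -> dot f f = 0 -> {ae mu, forall x, f x = 0}.
Proof.
move=> cf f0.
have i0 : (\int[mu]_x `|(sqn (f x))%:E| = 0)%E.
  under eq_integral do rewrite abse_EFin ger0_norm ?sqn_ge0//.
  by rewrite -dotE// f0.
have m : measurable_fun setT (fun x => (sqn (f x))%:E).
  have [[mr _] [mi _]] := cf.
  by apply/measurable_EFinP/measurable_funD; exact: measurable_funX.
have := (ae_eq_integral_abs mu measurableT m).1 i0.
apply: filterS => x /(_ I) [fx]; exact: sqn_eq0.
Qed.

Lemma ae_eq_dotl f g :
  {ae mu, forall x, f x = g x} -> forall h, cL2 f -> cL2 g -> cL2 h -> dot f h = dot g h.
Proof.
move=> fg h cf cg ch; congr fine.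
apply: ae_eq_integral => //.
- exact: measurable_int (dot_integrable cf ch).
- exact: measurable_int (dot_integrable cg ch).
- by apply: filterS fg => x -> _.
Qed.

Variable b : nat -> T -> R[i].
Hypothesis cb : forall i, cL2 (b i).
Hypothesis bON : forall i j, dot (b i) (b j) = (i == j)%:R.

Lemma cL2_lincomb c n : cL2 (lincomb c b n).
Proof. by apply: cL2_sum => i; exact: cL2M. Qed.

Lemma dot_lincomb c n g : cL2 g -> dot (lincomb c b n) g = \sum_(i < n) c i * dot (b i) g.
Proof. by move=> cg; exact: dot_suml. Qed.

Lemma dot_lincomb_basis c n i : dot (lincomb c b n) (b i) = if (i < n)%N then c i else 0.
Proof.
rewrite dot_lincomb//; under eq_bigr do rewrite bON.
case: ltnP => [ltin|leni].
  rewrite (bigD1 (Ordinal ltin))//= eqxx mulr1 big1 ?addr0// => j /negPf.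
  by rewrite -val_eqE/= => ->; rewrite mulr0.
rewrite big1// => j _; case: eqVneq => [ji|]; last by rewrite mulr0.
by have := ltn_ord j; rewrite ji ltnNge leni.
Qed.

Lemma dot_lincomb_lincomb c c' n : dot (lincomb c b n) (lincomb c' b n) = \sum_(i < n) c i * c' i.
Proof.
rewrite dot_lincomb; last exact: cL2_lincomb.
by apply: eq_bigr => i _; rewrite dotC dot_lincomb_basis ltn_ord.
Qed.

Lemma dot_lincomb2 c n : dot (lincomb c b n) (lincomb c b n) = \sum_(i < n) c i ^+ 2.
Proof. by rewrite dot_lincomb_lincomb; apply: eq_bigr => i _; rewrite expr2. Qed.

Lemma lincombB c m n : (m <= n)%N ->
  dot (fun x => lincomb c b n x - lincomb c b m x) (fun x => lincomb c b n x - lincomb c b m x) =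
  \sum_(m <= i < n) c i ^+ 2.
Proof.
move=> mn.
have -> : (fun x => lincomb c b n x - lincomb c b m x) =
    lincomb (fun i => if (m <= i)%N then c i else 0) b n.
  apply/funext => x; rewrite /lincomb (sum_nat_sub (fun i => (c i)%:C * b i x))//.
  rewrite big_geq_mkord/= big_mkcond; apply: eq_bigr => i _.
  by case: ifP => // _; rewrite mul0r.
rewrite dot_lincomb2 -(big_mkord xpredT (fun i => (if (m <= i)%N then c i else 0) ^+ 2)).
rewrite (big_cat_nat _ mn)//= big_nat_cond big1 ?add0r; last first.
  by move=> i; rewrite leq0n/= andbT => im; rewrite leqNgt im/= expr0n.
by apply: eq_big_nat => i /andP[-> _].
Qed.

Lemma dot_residual g n : cL2 g ->
  let r := fun x => g x - lincomb (fun i => dot g (b i)) b n x in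
  dot r r = dot g g - \sum_(i < n) dot g (b i) ^+ 2.
Proof.
move=> cg r; set c := fun i => dot g (b i).
have cl := cL2_lincomb c n.
rewrite /r dotBl ?dotBr//; last exact: cL2B.
rewrite dot_lincomb2 (dotC _ _ (lincomb _ _ _)) !dot_lincomb//.
rewrite (_ : \sum_(i < n) c i * dot (b i) g = \sum_(i < n) c i ^+ 2).
  by rewrite subrr subr0.
by apply: eq_bigr => i _; rewrite dotC expr2.
Qed.

Lemma bessel g n : cL2 g -> \sum_(i < n) dot g (b i) ^+ 2 <= dot g g.
Proof.
by move=> cg; rewrite -subr_ge0 -dot_residual//; exact: dot_ge0.
Qed.

Lemma series_sqr_cvg (c : nat -> R) (B : R) : (forall n, \sum_(i < n) c i ^+ 2 <= B) ->
  cvgn (fun n => \sum_(i < n) c i ^+ 2).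
Proof.
move=> cB; apply: nondecreasing_is_cvgn.
  move=> m n mn; rewrite -!(big_mkord xpredT (fun i => c i ^+ 2)).
  by rewrite (big_cat_nat _ mn)//= lerDl sumr_ge0// => i _; exact: sqr_ge0.
by exists B => _ [n _ <-].
Qed.

Lemma series_sqr_tail (c : nat -> R) (B e : R) : 0 < e ->
    (forall n, \sum_(i < n) c i ^+ 2 <= B) ->
  exists N, forall m n, (N <= m)%N -> \sum_(m <= i < n) c i ^+ 2 <= e.
Proof.
move=> e0 cB; have := series_sqr_cvg cB.
set S := (fun n => _) => cS.
have ndS : nondecreasing_seq S.
  move=> m n mn; rewrite -subr_ge0 /S (sum_nat_sub (fun i => c i ^+ 2))// sumr_ge0// => i _; exact: sqr_ge0.
move/cvgrPdist_le : (cS) => /(_ _ e0)[N _ hN]; exists N => m n Nm.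
have [nm|/ltnW mn] := leqP n m; first by rewrite big_geq ?ltW.
rewrite -(sum_nat_sub (fun i => c i ^+ 2))//; have := hN m Nm; rewrite ler_norml => /andP[_].
by have := nondecreasing_cvgn_le ndS cS n; rewrite /S; lra.
Qed.

Variables (D : set T) (mD : measurable D).
Hypothesis bD : forall i x, ~ D x -> b i x = 0.

(** The partial sums are Cauchy by orthonormality, and completeness is applied to real and imaginary
    parts separately. *)
Lemma riesz_fischer (c : nat -> R) (B : R) : (forall n, \sum_(i < n) c i ^+ 2 <= B) ->
  exists g, [/\ cL2 g, forall x, ~ D x -> g x = 0 &
    (fun n => dot (fun x => g x - lincomb c b n x) (fun x => g x - lincomb c b n x)) @ \oo --> 0].
Proof.
move=> cB.
have cauchy (e : R) : 0 < e -> exists N, forall m n, (N <= m)%N -> (N <= n)%N ->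
    dot (fun x => lincomb c b m x - lincomb c b n x) (fun x => lincomb c b m x - lincomb c b n x) <= e.
  move=> /series_sqr_tail/(_ cB)[N hN]; exists N => m n Nm Nn.
  have [mn|/ltnW nm] := leqP m n; last by rewrite lincombB// hN.
  rewrite (_ : dot _ _ = dot (fun x => lincomb c b n x - lincomb c b m x)
     (fun x => lincomb c b n x - lincomb c b m x)); first by rewrite lincombB// hN.
  by apply: eq_Rintegral => x _; rewrite !complex_partsE; ring.
have cBn m n : cL2 (fun x => lincomb c b m x - lincomb c b n x).
  by apply: cL2B; exact: cL2_lincomb.
pose ur n x := complex.Re (lincomb c b n x).
pose ui n x := complex.Im (lincomb c b n x).
have [gr [sgr hgr]] : exists u, sqint mu u /\ forall e : R, 0 < e -> exists N, forall n, (N <= n)%N ->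
      (\int[mu]_x ((u x - ur n x) ^+ 2)%:E <= e%:E)%E.
  apply: sqint_complete; first by move=> n; exact: (cL2_lincomb c n).1.
  move=> e /cauchy[N hN]; exists N => m n Nm Nn.
  apply: le_trans (_ : ((dot _ _)%:E <= _)%E); last by rewrite lee_fin; exact: hN Nm Nn.
  rewrite dotE//; apply: ge0_le_integral => //.
  - by move=> x _; rewrite lee_fin sqr_ge0.
  - apply/measurable_EFinP/measurable_funX/measurable_funB.
      exact: (cL2_lincomb c m).1.1. exact: (cL2_lincomb c n).1.1.
  - by apply/measurable_EFinP/measurable_funD; apply: measurable_funX; [exact: (cBn m n).1.1|exact: (cBn m n).2.1].
  - by move=> x _; rewrite lee_fin /ur -cReN -cReD lerDl sqr_ge0.
have [gi [sgi hgi]] : exists u, sqint mu u /\ forall e : R, 0 < e -> exists N, forall n, (N <= n)%N ->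
      (\int[mu]_x ((u x - ui n x) ^+ 2)%:E <= e%:E)%E.
  apply: sqint_complete; first by move=> n; exact: (cL2_lincomb c n).2.
  move=> e /cauchy[N hN]; exists N => m n Nm Nn.
  apply: le_trans (_ : ((dot _ _)%:E <= _)%E); last by rewrite lee_fin; exact: hN Nm Nn.
  rewrite dotE//; apply: ge0_le_integral => //.
  - by move=> x _; rewrite lee_fin sqr_ge0.
  - apply/measurable_EFinP/measurable_funX/measurable_funB.
      exact: (cL2_lincomb c m).2.1. exact: (cL2_lincomb c n).2.1.
  - by apply/measurable_EFinP/measurable_funD; apply: measurable_funX; [exact: (cBn m n).1.1|exact: (cBn m n).2.1].
  - by move=> x _; rewrite lee_fin /ui -cImN -cImD lerDr sqr_ge0.
(* A limit in mean is determined only almost everywhere. Multiplying by the indicator gives exact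
   vanishing off [D] and does not increase the distance to the partial sums, which vanish there. *)
pose g x := (gr x +i* gi x) * (\1_D x)%:C.
have cg0 : cL2 (fun x => gr x +i* gi x) by [].
have cg : cL2 g.
  apply: cL2bM => //=.
  - exact: measurable_indic.
  - by move=> x; rewrite /sqn/= expr0n addr0 indicE; case: (_ \in _); rewrite ?expr1n ?expr0n ?ler01.
have gD x : ~ D x -> g x = 0.
  by move=> nDx; rewrite /g indicE memNset// mulr0.
have lD n x : ~ D x -> lincomb c b n x = 0.
  by move=> nDx; rewrite /lincomb big1// => i _; rewrite bD// mulr0.
exists g; split => //.
have cgl n : cL2 (fun x => g x - lincomb c b n x) by apply: cL2B => //; exact: cL2_lincomb.
have cgl0 n : cL2 (fun x => gr x +i* gi x - lincomb c b n x) by apply: cL2B => //; exact: cL2_lincomb.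
apply/cvgrPdist_le => e e0.
have e20 : 0 < e / 2 by rewrite divr_gt0.
have [N1 hN1] := hgr _ e20; have [N2 hN2] := hgi _ e20.
exists (N1 + N2)%N => // n /= Nn.
rewrite sub0r normrN ger0_norm ?dot_ge0//.
apply: (@le_trans _ _ (dot (fun x => gr x +i* gi x - lincomb c b n x) (fun x => gr x +i* gi x - lincomb c b n x))).
  apply: dot_le => // x; have [Dx|nDx] := pselect (D x).
    by rewrite /g indicE mem_set// mulr1.
  by rewrite gD// lD// subrr /sqn/= expr0n addr0 addr_ge0 ?sqr_ge0.
rewrite -lee_fin dotE// [X in (_ <= X%:E)%E]splitr.
under eq_integral do rewrite /sqn EFinD.
have mr : measurable_fun setT (fun x => gr x - ur n x).
  by apply: measurable_funB; [exact: sgr.1|exact: (cL2_lincomb c n).1.1].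
have mi : measurable_fun setT (fun x => gi x - ui n x).
  by apply: measurable_funB; [exact: sgi.1|exact: (cL2_lincomb c n).2.1].
rewrite ge0_integralD//.
- rewrite EFinD; apply: leeD.
    apply: le_trans (hN1 n _); last by rewrite (leq_trans _ Nn)// leq_addr.
    by under eq_integral do rewrite cReD cReN/=.
  apply: le_trans (hN2 n _); last by rewrite (leq_trans _ Nn)// leq_addl.
  by under eq_integral do rewrite cImD cImN/=.
- by move=> x _; rewrite lee_fin sqr_ge0.
- by apply/measurable_EFinP/measurable_funX; exact: (cgl0 n).1.1.
- by move=> x _; rewrite lee_fin sqr_ge0.
- by apply/measurable_EFinP/measurable_funX; exact: (cgl0 n).2.1.
Qed.

Lemma dot_cvg (s : nat -> T -> R[i]) g h : (forall n, cL2 (s n)) -> cL2 g -> cL2 h ->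
    (fun n => dot (fun x => g x - s n x) (fun x => g x - s n x)) @ \oo --> 0 ->
  (fun n => dot (s n) h) @ \oo --> dot g h.
Proof.
move=> cs cg ch gs; apply/cvgrPdist_le => e e0.
have hp : 0 < dot h h + 1 by rewrite ltr_wpDl// dot_ge0.
move/cvgrPdist_le : gs => /(_ (e ^+ 2 / (dot h h + 1))) gs.
have := gs (divr_gt0 (exprn_gt0 _ e0) hp).
apply: filterS => n; rewrite sub0r normrN ger0_norm ?dot_ge0// => h1.
rewrite -dotBl//.
rewrite -ler_sqr ?nnegrE ?(ltW e0)// real_normK ?num_real//.
apply: le_trans (dot_CS _ ch) _; first exact: cL2B.
apply: le_trans (_ : _ <= (e ^+ 2 / (dot h h + 1)) * (dot h h + 1)) _; last by rewrite divfK ?gt_eqF.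
by apply: ler_pM => //; rewrite ?dot_ge0// lerDl.
Qed.

Hypothesis complete : forall g, cL2 g -> (forall x, ~ D x -> g x = 0) ->
  (forall i, dot g (b i) = 0) -> dot g g = 0.

(** Riesz-Fischer yields [s] with the same coefficients as [g]; completeness makes [g - s] null, so
    the residual of [g] tends to 0 with that of [s]. *)
Lemma parseval g : cL2 g -> (forall x, ~ D x -> g x = 0) ->
  (fun n => \sum_(i < n) dot g (b i) ^+ 2) @ \oo --> dot g g.
Proof.
move=> cg gD; set c := fun i => dot g (b i).
have [s [cs sD sc]] := riesz_fischer (c := c) (fun n => bessel n cg).
have cgs : cL2 (fun x => g x - s x) by exact: cL2B.
have si i : dot s (b i) = c i.
  have := dot_cvg (cL2_lincomb c) cs (cb i) sc.
  move=> /cvg_lim <- //; apply: cvg_lim => //.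
  apply: cvg_near_cst; exists i.+1 => // n /= ni.
  by rewrite dot_lincomb_basis ni.
have gs0 : dot (fun x => g x - s x) (fun x => g x - s x) = 0.
  apply: complete => //.
    by move=> x nDx; rewrite gD// sD// subrr.
  by move=> i; rewrite dotBl// si subrr.
apply/cvgrPdist_le => e e0.
have e20 : 0 < e / 2 by rewrite divr_gt0.
move/cvgrPdist_le : sc => /(_ _ e20).
apply: filterS => n; rewrite sub0r normrN ger0_norm ?dot_ge0// => h1.
have rp := dot_residual n cg; cbv zeta in rp; rewrite -rp.
rewrite ger0_norm ?dot_ge0//.
have -> : (fun x => g x - lincomb (fun i => dot g (b i)) b n x) =
    (fun x => (g x - s x) + (s x - lincomb c b n x)).
  by apply/funext => x; rewrite addrA subrK.
apply: le_trans (dotD2 cgs _) _; first by apply: cL2B => //; exact: cL2_lincomb.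
rewrite gs0; lra.
Qed.

End Orthonormal.

(** * Completeness of the exponentials *)

Section RealIntegrable.
Context d (T : measurableType d) (R : realType) (mu : {measure set T -> \bar R}).
Variables (D : set T) (mD : measurable D).
Implicit Types f g : T -> R.

Lemma intgZ (s : R) f : mu.-integrable D (EFin \o f) ->
  mu.-integrable D (EFin \o (fun x => s * f x)).
Proof.
move=> i1; have := integrableZl mD s i1.
by have -> : (fun x => s%:E * (EFin \o f) x)%E = EFin \o (fun x => s * f x).
Qed.

Lemma intgD f g : mu.-integrable D (EFin \o f) -> mu.-integrable D (EFin \o g) ->
  mu.-integrable D (EFin \o (fun x => f x + g x)).
Proof.
move=> i1 i2; have := integrableD mD i1 i2.
by have -> : ((EFin \o f) \+ (EFin \o g))%E = EFin \o (fun x => f x + g x).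
Qed.

Lemma intgB f g : mu.-integrable D (EFin \o f) -> mu.-integrable D (EFin \o g) ->
  mu.-integrable D (EFin \o (fun x => f x - g x)).
Proof.
move=> i1 i2; have := integrableB mD i1 i2.
by have -> : ((EFin \o f) \- (EFin \o g))%E = EFin \o (fun x => f x - g x).
Qed.

Lemma intg_norm f : mu.-integrable D (EFin \o f) ->
  mu.-integrable D (EFin \o (fun x => `|f x|)).
Proof.
move=> i1; have := integrable_abse i1.
by have -> : abse \o (EFin \o f) = EFin \o (fun x => `|f x|).
Qed.

End RealIntegrable.

Lemma sin_intpi (R : realType) (k : int) : sin (k%:~R * pi) = 0 :> R.
Proof.
have hn (n : nat) : sin (n%:R * pi) = 0 :> R.
  elim: n => [|n IH]; first by rewrite mul0r sin0.
  by rewrite -natr1 mulrDl mul1r sinDpi IH oppr0.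
case: k => n; first exact: hn.
by rewrite NegzE mulrNz mulNr sinN hn oppr0.
Qed.

Section OneVariable.
Variable R : realType.
Notation mu := (@lebesgue_measure R).
Implicit Types (f g u : R -> R) (a b c : R).

Lemma continuous_itv_integrable f a b : {within `[a, b], continuous f} ->
  mu.-integrable `[a, b] (EFin \o f).
Proof. by move=> cf; apply: continuous_compact_integrable => //; exact: segment_compact. Qed.

Lemma cont_itv_integrable f a b : continuous f -> mu.-integrable `[a, b] (EFin \o f).
Proof. by move=> cf; apply: continuous_itv_integrable; exact: continuous_subspaceT. Qed.

Lemma Rintegral_derive (f F : R -> R) a b : a < b -> continuous f ->
  (forall x : R, is_derive x 1 F (f x)) -> \int[mu]_(x in `[a, b]) f x = F b - F a.
Proof.
move=> ab cf dF; rewrite /Rintegral (@continuous_FTC2 _ f F)//.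
- exact: continuous_subspaceT.
- have cF : continuous F.
    by move=> x; have [dx _] := dF x; exact/differentiable_continuous/derivable1_diffP.
  split; first by move=> x _; have [] := dF x.
    by apply: cvg_at_right_filter; exact: cF.
  by apply: cvg_at_left_filter; exact: cF.
- by move=> x _; rewrite derive1E; have [_] := dF x.
Qed.

Lemma is_derive_pow (f : R -> R) n (x df : R) : is_derive x 1 f df ->
  is_derive x 1 (fun y => f y ^+ n.+1) (n.+1%:R * f x ^+ n * df).
Proof.
move=> d1; have -> : (fun y => f y ^+ n.+1) = f ^+ n.+1.
  by apply/funext => y; rewrite exprfctE.
by apply: is_derive_eq; rewrite /GRing.scale/=.
Qed.

Lemma is_derive_mul (f g : R -> R) (x df dg : R) : is_derive x 1 f df -> is_derive x 1 g dg ->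
  is_derive x 1 (fun y => f y * g y) (df * g x + f x * dg).
Proof.
by move=> d1 d2; apply: is_derive_eq; rewrite /GRing.scale/= addrC mulrC.
Qed.

Lemma is_derive_affine c d (x : R) : is_derive x 1 (fun y : R => c * y + d) c.
Proof. by apply: is_derive_eq; rewrite /GRing.scale/= mulr1 addr0. Qed.

Lemma is_derive_sin_affine c d (x : R) :
  is_derive x 1 (fun y : R => sin (c * y + d)) (c * cos (c * x + d)).
Proof.
have h := is_derive_affine c d x.
by apply: is_derive_eq; rewrite /GRing.scale/= mulrC.
Qed.

Lemma is_derive_cos_affine c d (x : R) :
  is_derive x 1 (fun y : R => cos (c * y + d)) (- (c * sin (c * x + d))).
Proof.
have h := is_derive_affine c d x.
by apply: is_derive_eq; rewrite /GRing.scale/= mulNr mulrC.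
Qed.

Lemma continuous_cos_affine c d : continuous (fun y => cos (c * y + d)).
Proof.
move=> x; apply: (@continuous_comp _ _ _ (fun y => c * y + d) cos); last exact: continuous_cos.
by apply: cvgD; [apply: cvgM; [exact: cvg_cst|exact: cvg_id]|exact: cvg_cst].
Qed.

Lemma continuous_sin_affine c d : continuous (fun y => sin (c * y + d)).
Proof.
move=> x; apply: (@continuous_comp _ _ _ (fun y => c * y + d) sin); last exact: continuous_sin.
by apply: cvgD; [apply: cvgM; [exact: cvg_cst|exact: cvg_id]|exact: cvg_cst].
Qed.

Lemma Rintegral_cos_affine c d a b : a < b -> c != 0 ->
  \int[mu]_(x in `[a, b]) cos (c * x + d) = (sin (c * b + d) - sin (c * a + d)) / c.
Proof.
move=> ab c0; have h (x : R) : is_derive x 1 (fun x => sin (c * x + d) / c) (cos (c * x + d)).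
  have := is_derive_sin_affine c d x => ?.
  by apply: is_derive_eq; rewrite /GRing.scale/= mulr0 add0r mulrA mulVf// mul1r.
rewrite (Rintegral_derive ab _ h) ?mulrBl//; exact: continuous_cos_affine.
Qed.

(** A bounded kernel times [f x * g y] is integrable on the plane. The same statement serves the
    indicator of [z.2 <= z.1], where it replaces integration by parts, and the kernels cos and sin,
    where it moves a transform from one factor to the other. *)
Lemma Fubini_kernel (f g : R -> R) (k : R * R -> R) :
    mu.-integrable setT (EFin \o f) -> mu.-integrable setT (EFin \o g) ->
    measurable_fun setT k -> (forall z, `|k z| <= 1) ->
  \int[mu]_x (f x * \int[mu]_y (g y * k (x, y))) =
  \int[mu]_y (g y * \int[mu]_x (f x * k (x, y))).
Proof.
move=> intf intg mk k1.
have mf : measurable_fun setT f by apply/measurable_EFinP; exact: measurable_int intf.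
have mg : measurable_fun setT g by apply/measurable_EFinP; exact: measurable_int intg.
pose F (z : R * R) := (f z.1 * g z.2 * k z)%:E.
have mF : measurable_fun setT F.
  apply/measurable_EFinP; apply: measurable_funM => //; apply: measurable_funM.
    exact: (measurableT_comp mf measurable_fst).
  exact: (measurableT_comp mg measurable_snd).
have igk x : mu.-integrable setT (fun y => (g y * k (x, y))%:E).
  apply: (le_integrable measurableT _ _ intg).
    apply/measurable_EFinP; apply: measurable_funM => //.
    exact: (measurableT_comp mk (pair1_measurable x)).
  by move=> y _ /=; rewrite lee_fin normrM ler_piMr.
have ifk y : mu.-integrable setT (fun x => (f x * k (x, y))%:E).
  apply: (le_integrable measurableT _ _ intf).
    apply/measurable_EFinP; apply: measurable_funM => //.
    exact: (measurableT_comp mk (pair2_measurable y)).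
  by move=> x _ /=; rewrite lee_fin normrM ler_piMr.
have iF : (mu \x mu)%E.-integrable setT F.
  apply/integrable12ltyP => //.
  pose G := (\int[mu]_y `|(g y)%:E|)%E.
  have Gfin : G \is a fin_num.
    by rewrite ge0_fin_numE ?integral_ge0//; case/integrableP : intg.
  apply: (@le_lt_trans _ _ (\int[mu]_x (`|(f x)%:E| * G))%E); last first.
    rewrite ge0_integralZr ?integral_ge0//; last by apply/measurable_EFinP; exact: measurableT_comp.
    rewrite lte_mul_pinfty ?integral_ge0//; first by rewrite ge0_fin_numE ?integral_ge0//; case/integrableP : intf.
    by case/integrableP : intg.
  have mag : measurable_fun setT (fun y => `|(g y)%:E|)%E.
    by apply: measurableT_comp => //; exact/measurable_EFinP.
  have maf : measurable_fun setT (fun y => `|(f y)%:E|)%E.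
    by apply: measurableT_comp => //; exact/measurable_EFinP.
  apply: ge0_le_integral => //.
  - by move=> x _; exact: integral_ge0.
  - apply: (@measurable_fun_fubini_tonelli_F _ _ _ _ _ mu (abse \o F)).
      by apply: measurableT_comp => //; exact: abse_measurable.
    by move=> z; exact: abse_ge0.
  - exact: emeasurable_funM.
  - move=> x _; rewrite /G -ge0_integralZl//.
    apply: ge0_le_integral => //.
    + apply: measurableT_comp; first exact: abse_measurable.
      exact: (measurableT_comp mF (pair1_measurable x)).
    + exact: emeasurable_funM.
    + by move=> y _; rewrite /F /= lee_fin !normrM ler_piMr ?mulr_ge0.
have := Fubini iF.
rewrite /Rintegral => FE.
transitivity (fine (\int[mu]_x \int[mu]_y F (x, y)))%E.
  congr fine; apply: eq_integral => x _; rewrite EFinM fineK; last exact: integrable_fin_num (igk x).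
  rewrite -integralZl//; apply: eq_integral => y _.
  by rewrite -EFinM /F/= mulrA.
rewrite FE; congr fine; apply: eq_integral => y _; rewrite EFinM fineK; last exact: integrable_fin_num (ifk y).
rewrite -integralZl//; apply: eq_integral => x _.
by rewrite -EFinM /F/= mulrCA mulrA.
Qed.

End OneVariable.

Section TrigonometricCompleteness.
Variables (R : realType) (a : R).
Hypothesis a0 : 0 < a.
Notation mu := (@lebesgue_measure R).
Let h : R := pi / a.

Let h0 : 0 < h. Proof. by rewrite divr_gt0// pi_gt0. Qed.
Let ha : h * a = pi. Proof. by rewrite /h divfK ?gt_eqF. Qed.
Let aa : - a < a. Proof. by rewrite gtrN. Qed.

(* A continuous function orthogonal to all trigonometric polynomials vanishes at [x0]: the powers of
   [P] concentrate at [x0], and integration by parts gives [int S P^n = O(1/n) int P^n]. *)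
Section Peak.
Variables (Psi : R -> R) (x0 : R).
Hypothesis cPsi : {within `[- a, a], continuous Psi}.
Hypothesis Psi0 : forall (k : int) (d : R),
  \int[mu]_(x in `[- a, a]) (Psi x * cos (k%:~R * h * x + d)) = 0.
Hypothesis x0a : - a < x0 < a.

(** On [-a, a] the peak [P] reaches its maximum 1 only at the interior point [x0], and
    [S = 1 - P]. *)
Let e x := cos (h * x + - (h * x0)) : R.
Let P x := (1 + e x) / 2.
Let S x := (1 - e x) / 2.

Let ce : continuous e. Proof. exact: continuous_cos_affine. Qed.
Let cP : continuous P.
Proof.
move=> x; apply: cvgM; last exact: cvg_cst.
by apply: cvgD; [exact: cvg_cst|exact: ce].
Qed.
Let cS : continuous S.
Proof.
move=> x; apply: cvgM; last exact: cvg_cst.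
by apply: cvgB; [exact: cvg_cst|exact: ce].
Qed.
Let cPn n : continuous (fun x => P x ^+ n).
Proof.
elim: n => [|n IH]; first by under eq_fun do rewrite expr0; move=> x; exact: cvg_cst.
by under eq_fun do rewrite exprS; move=> x; apply: cvgM; [exact: cP|exact: IH].
Qed.

Let withinM (f g : R -> R) : {within `[- a, a], continuous f} -> continuous g ->
  {within `[- a, a], continuous (fun x => f x * g x)}.
Proof.
by move=> cf cg x; apply: cvgM; [exact: cf|exact: (continuous_subspaceT cg)].
Qed.

Let P_ge0 x : 0 <= P x.
Proof. by rewrite /P divr_ge0// -lerBlDl sub0r cos_geN1. Qed.
Let S_ge0 x : 0 <= S x.
Proof. by rewrite /S divr_ge0// subr_ge0 cos_le1. Qed.

(** Multiplication by [P] splits a cosine of frequency k into cosines of frequencies k - 1, k and k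
    + 1, so orthogonality propagates to all powers. *)
Let Psi_pow n (k : int) (d : R) :
  \int[mu]_(x in `[- a, a]) (Psi x * (cos (k%:~R * h * x + d) * P x ^+ n)) = 0.
Proof.
elim: n k d => [|n IH] k d.
  by under eq_Rintegral do rewrite expr0 mulr1; exact: Psi0.
have it (c b : R) : mu.-integrable `[- a, a] (EFin \o (fun x => Psi x * (cos (c * x + b) * P x ^+ n))).
  apply: continuous_itv_integrable; apply: withinM => //.
  by move=> x; apply: cvgM; [exact: continuous_cos_affine|exact: cPn].
have itZ (s c b : R) : mu.-integrable `[- a, a] (EFin \o (fun x => s * (Psi x * (cos (c * x + b) * P x ^+ n)))).
  exact: intgZ.
rewrite (@eq_Rintegral _ _ _ mu _ (fun x =>
   2^-1 * (Psi x * (cos (k%:~R * h * x + d) * P x ^+ n)) +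
  (4^-1 * (Psi x * (cos ((k + 1)%:~R * h * x + (d - h * x0)) * P x ^+ n)) +
   4^-1 * (Psi x * (cos ((k - 1)%:~R * h * x + (d + h * x0)) * P x ^+ n))))); last first.
  move=> x _.
  have -> : (k + 1)%:~R * h * x + (d - h * x0) = (k%:~R * h * x + d) + (h * x + - (h * x0)).
    by rewrite intrD; ring.
  have -> : (k - 1)%:~R * h * x + (d + h * x0) = (k%:~R * h * x + d) - (h * x + - (h * x0)).
    by rewrite intrB; ring.
  set A := k%:~R * h * x + d; set B := h * x + - (h * x0).
  rewrite (cosD A B) (cosB A B) [P x ^+ n.+1]exprS {1}/P /e -/B; by field.
rewrite RintegralD//; last exact: intgD.
by rewrite RintegralD// !RintegralZl// !IH !mulr0 !addr0.
Qed.

Let int_SP n : \int[mu]_(x in `[- a, a]) (S x * P x ^+ n.+1) =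
  (\int[mu]_(x in `[- a, a]) (P x ^+ n.+1)) / (2 * n%:R + 4).
Proof.
have cs : continuous (fun x => S x * P x ^+ n.+1).
  by move=> x; apply: cvgM; [exact: cS|exact: cPn].
(* [F] takes equal values at both ends of the period, so its derivative integrates to 0;
   [sin ^ 2 = 4 S P] and [cos = 1 - 2 S] express this derivative through [P] and [S]. *)
pose F x := sin (h * x + - (h * x0)) * P x ^+ n.+1.
have dF (x : R) : is_derive x 1 F (h * (P x ^+ n.+1 - (2 * n%:R + 4) * (S x * P x ^+ n.+1))).
  have d1 := is_derive_sin_affine h (- (h * x0)) x.
  have d2 : is_derive x 1 P (- (h * sin (h * x + - (h * x0))) / 2).
    have d3 := is_derive_cos_affine h (- (h * x0)) x.
    rewrite /P /e; apply: is_derive_eq; rewrite /GRing.scale/=; ring.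
  have d4 := is_derive_mul d1 (is_derive_pow n d2).
  rewrite /F; apply: (@is_derive_eq _ _ _ _ _ _ _ _ d4).
  have s2 : sin (h * x + - (h * x0)) ^+ 2 = 4 * (S x * P x).
    by rewrite sin2cos2 /S /P /e; field.
  have -> : cos (h * x + - (h * x0)) = 1 - 2 * S x by rewrite /S /e; field.
  have -> : sin (h * x + - (h * x0)) * (n.+1%:R * P x ^+ n * (- (h * sin (h * x + - (h * x0))) / 2)) =
    - (h * n.+1%:R * P x ^+ n * (sin (h * x + - (h * x0)) ^+ 2) / 2) by rewrite expr2; field.
  rewrite s2 exprS -natr1; by field.
have cc : continuous (fun x => h * (P x ^+ n.+1 - (2 * n%:R + 4) * (S x * P x ^+ n.+1))).
  move=> x; apply: cvgM; first exact: cvg_cst.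
  apply: cvgB; first exact: cPn.
  by apply: cvgM; [exact: cvg_cst|exact: cs].
have := Rintegral_derive aa cc dF.
have -> : F a - F (- a) = 0.
  rewrite /F /P /e mulrN ha.
  have -> : - pi - h * x0 = - (h * x0 + pi) by ring.
  have -> : pi - h * x0 = - (h * x0) + pi by ring.
  by rewrite sinN cosN sinDpi cosDpi sinDpi cosDpi sinN cosN opprK subrr.
have i1 : mu.-integrable `[- a, a] (EFin \o (fun x => P x ^+ n.+1)) by exact: cont_itv_integrable.
have i2 : mu.-integrable `[- a, a] (EFin \o (fun x => S x * P x ^+ n.+1)) by exact: cont_itv_integrable.
have i3 : mu.-integrable `[- a, a] (EFin \o (fun x => (2 * n%:R + 4) * (S x * P x ^+ n.+1))).
  exact: intgZ.
have i4 : mu.-integrable `[- a, a] (EFin \o (fun x => P x ^+ n.+1 - (2 * n%:R + 4) * (S x * P x ^+ n.+1))).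
  exact: intgB.
rewrite RintegralZl// RintegralB// RintegralZl// => /eqP.
have n4 : 2 * n%:R + 4 != 0 :> R by rewrite gt_eqF// ltr_wpDl ?mulr_ge0.
rewrite mulf_eq0 (gt_eqF h0)/= subr_eq0 => /eqP ->.
by rewrite mulrAC mulfV// mul1r.
Qed.

(** From [P = 1 - S] and [int_SP], raising the exponent multiplies the integral by
    [1 - 1 / (2 n + 4)]. *)
Let int_P_gt0 n : 0 < \int[mu]_(x in `[- a, a]) (P x ^+ n.+1).
Proof.
elim: n => [|n IH].
  rewrite (@eq_Rintegral _ _ _ mu _ (fun x => 2^-1 * 1 + 2^-1 * cos (h * x + - (h * x0)))); last first.
    by move=> x _; rewrite expr1 /P /e; field.
  have i0 : mu.-integrable `[- a, a] (EFin \o (fun x => 1 : R)).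
    by apply: cont_itv_integrable => x; exact: cvg_cst.
  have i1 : mu.-integrable `[- a, a] (EFin \o (fun x => 2^-1 * (1 : R))) by exact: intgZ.
  have i3 : mu.-integrable `[- a, a] (EFin \o (fun x => cos (h * x + - (h * x0)))).
    by apply: cont_itv_integrable; exact: continuous_cos_affine.
  have i2 : mu.-integrable `[- a, a] (EFin \o (fun x => 2^-1 * cos (h * x + - (h * x0)))).
    exact: intgZ.
  rewrite RintegralD// !RintegralZl// Rintegral_cos_affine ?gt_eqF//.
  rewrite Rintegral_cst//= lebesgue_measure_itv/= lte_fin aa/=.
  have -> : h * a + - (h * x0) = - (h * x0) + pi by rewrite ha addrC.
  have -> : h * - a + - (h * x0) = - (h * x0 + pi) by rewrite mulrN ha; ring.
  rewrite sinDpi !sinN sinDpi !opprK subrr !mul0r mulr0 addr0 mul1r.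
  by rewrite mulr_gt0 ?addr_gt0.
have -> : \int[mu]_(x in `[- a, a]) P x ^+ n.+2 =
    \int[mu]_(x in `[- a, a]) (P x ^+ n.+1 - S x * P x ^+ n.+1).
  by apply: eq_Rintegral => x _; rewrite [LHS]exprS {1}/P /S; field.
rewrite RintegralB//; last 2 first.
- exact: cont_itv_integrable.
- by apply: cont_itv_integrable => x; apply: cvgM; [exact: cS|exact: cPn].
rewrite int_SP -[X in X - _]mulr1 -mulrBr mulr_gt0// subr_gt0 invf_lt1.
  by rewrite ltr_wpDl ?mulr_ge0// ltr1n.
by rewrite ltr_wpDl ?mulr_ge0.
Qed.

(** Near [x0] this is continuity; elsewhere [Psi] is bounded and [S] is bounded below. *)
Let peak_bound (eps : R) : 0 < eps -> exists2 C, 0 <= C &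
  forall x, x \in `[- a, a] -> `|Psi x0 - Psi x| <= eps + C * S x.
Proof.
move=> eps0.
have x0I : x0 \in `]- a, a[ by rewrite in_itv/= x0a.
have cx0 : {for x0, continuous Psi}.
  exact: (within_continuous_continuous aa cPsi x0I).
move/cvgrPdist_le : cx0 => /(_ _ eps0)[dl /= dl0 hdl].
(* [w] is positive exactly within [dl] of [x0], so [q], which is [S] plus twice the positive part of
   [w], is positive on the whole segment; its minimum bounds [S] below where [w <= 0]. *)
pose w x := dl - `|x0 - x|.
pose q x := S x + (w x + `|w x|).
have cq : continuous q.
  move=> x; apply: cvgD; first exact: cS.
  have cw : w y @[y --> x] --> w x.
    apply: cvgB; first exact: cvg_cst.
    by apply: cvg_norm; apply: cvgB; [exact: cvg_cst|exact: cvg_id].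
  by apply: cvgD => //; exact: cvg_norm.
have [c cI hc] := EVT_min (ltW aa) (continuous_subspaceT cq).
have qc : 0 < q c.
  rewrite /q; have [lt|ge] := ltP `|x0 - c| dl.
    rewrite ltr_wpDl ?S_ge0//; have : 0 < w c by rewrite subr_gt0.
    by have := normr_ge0 (w c); lra.
  rewrite ltr_wpDr//; first by have := ler_norm (- w c); rewrite normrN; lra.
  rewrite divr_gt0// subr_gt0 /e.
  have {}ge : 0 < `|c - x0| by rewrite distrC (lt_le_trans dl0).
  have -> : h * c + - (h * x0) = h * (c - x0) by ring.
  rewrite -cos_norm normrM (ger0_norm (ltW h0)).
  (* As [x0] is interior, the angle [y] stays strictly between 0 and 2 pi, so its cosine is below 1;
     the range beyond pi is reflected. *)
  have cub : `|c - x0| < 2 * a.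
    move: cI x0a; rewrite in_itv/= ltr_norml => /andP[? ?] /andP[? ?].
    by apply/andP; split; lra.
  set y := h * `|c - x0|.
  have y0 : 0 < y by rewrite mulr_gt0.
  have y2 : y < 2 * pi by rewrite /y -ha mulrCA ltr_pM2l.
  have [ypi|piy] := leP y pi.
    rewrite -cos0 ltr_cos// in_itv/= ?lexx ?pi_ge0//.
    by rewrite ypi ltW.
  have -> : cos y = cos (2 * pi - y).
    rewrite -[RHS]cosN opprB -[RHS](cosD2pi (y - 2 * pi)); congr cos.
    by rewrite mulr2n; ring.
  have c1 : 0 < 2 * pi - y by rewrite subr_gt0.
  have c2 : 2 * pi - y <= pi by lra.
  by rewrite -[X in _ < X]cos0 ltr_cos ?in_itv/= ?lexx ?pi_ge0 ?(ltW c1).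
have cnPsi : {within `[- a, a], continuous (fun x => `|Psi x|)}.
  by move=> x; apply: cvg_norm; exact: cPsi.
have [d dI hd] := EVT_max (ltW aa) cnPsi.
have Psi_d x : x \in `[- a, a] -> `|Psi x| <= `|Psi d| by exact: hd.
exists (2 * `|Psi d| / q c); first by rewrite divr_ge0 ?mulr_ge0// ltW.
move=> x xI; have [lt|ge] := ltP `|x0 - x| dl.
  by apply: le_trans (hdl x lt) _; rewrite lerDl mulr_ge0 ?S_ge0// divr_ge0 ?mulr_ge0// ltW.
have qx : q c <= S x.
  apply: le_trans (hc x xI) _; rewrite /q; have wx : w x <= 0 by rewrite subr_le0.
  by rewrite ler0_norm// subrr addr0.
apply: (@le_trans _ _ (2 * `|Psi d|)).
  apply: le_trans (ler_normB _ _) _.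
  have := Psi_d _ xI; have : x0 \in `[- a, a] by exact: subset_itv_oo_cc.
  by move=> /Psi_d; lra.
rewrite ler_wpDl ?(ltW eps0)// mulrAC ler_pdivlMr// ler_wpM2l// mulr_ge0//.
Qed.

Lemma peak_eq0 : Psi x0 = 0.
Proof.
apply/eqP; rewrite -normr_le0; apply/ler_addgt0Pl => eps eps0; rewrite addr0.
have e2 : 0 < eps / 2 by rewrite divr_gt0.
have [C C0 hC] := peak_bound e2.
have [n hn] : exists n : nat, C / (2 * n%:R + 4) <= eps / 2.
  have [n hn] : exists n : nat, C / eps < n%:R.
    by exists (Num.bound (C / eps)); apply: archi_boundP; rewrite divr_ge0// ltW.
  exists n; rewrite ler_pdivrMr ?ltr_wpDl ?mulr_ge0//.
  by move: hn; rewrite ltr_pdivrMr// => hn; have : 0 <= n%:R :> R by []; nra.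
set J := \int[mu]_(x in `[- a, a]) (P x ^+ n.+1).
have J0 : 0 < J by exact: int_P_gt0.
have iP : mu.-integrable `[- a, a] (EFin \o (fun x => P x ^+ n.+1)) by exact: cont_itv_integrable.
have iSP : mu.-integrable `[- a, a] (EFin \o (fun x => S x * P x ^+ n.+1)).
  by apply: cont_itv_integrable => x; apply: cvgM; [exact: cS|exact: cPn].
have iPsiP : mu.-integrable `[- a, a] (EFin \o (fun x => Psi x * P x ^+ n.+1)).
  by apply: continuous_itv_integrable; apply: withinM => //; exact: cPn.
have PsiP : \int[mu]_(x in `[- a, a]) (Psi x * P x ^+ n.+1) = 0.
  have := Psi_pow n.+1 0 0.
  by under eq_Rintegral do rewrite mul0r mul0r add0r cos0 mul1r.
(* [Psi] itself integrates to 0 against the peak, so only its oscillation around [Psi x0]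
   remains. *)
have E : Psi x0 * J = \int[mu]_(x in `[- a, a]) ((Psi x0 - Psi x) * P x ^+ n.+1).
  under eq_Rintegral do rewrite mulrBl.
  by rewrite RintegralB// ?RintegralZl// ?PsiP ?subr0//; exact: intgZ.
have : `|Psi x0| * J <= eps * J.
  rewrite -[X in _ * X <= _](ger0_norm (ltW J0)) -normrM E.
  have iB : mu.-integrable `[- a, a] (EFin \o (fun x => (Psi x0 - Psi x) * P x ^+ n.+1)).
    have -> : (fun x => (Psi x0 - Psi x) * P x ^+ n.+1) =
        (fun x => Psi x0 * P x ^+ n.+1 - Psi x * P x ^+ n.+1).
      by apply/funext => x; rewrite mulrBl.
    by apply: intgB => //; exact: intgZ.
  apply: le_trans (le_normr_Rintegral _ iB) _ => //.
  apply: (@le_trans _ _ (\int[mu]_(x in `[- a, a]) (eps / 2 * P x ^+ n.+1 + C * (S x * P x ^+ n.+1)))).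
    apply: le_Rintegral => //.
    - exact: intg_norm.
    - by apply: intgD => //; exact: intgZ.
    - move=> x xI; rewrite normrM (ger0_norm (exprn_ge0 _ (P_ge0 x))).
      by rewrite mulrA -mulrDl ler_wpM2r ?exprn_ge0// hC.
  rewrite RintegralD//; [|exact: intgZ|exact: intgZ].
  rewrite !RintegralZl// int_SP -/J.
  have -> : eps / 2 * J + C * (J / (2 * n%:R + 4)) = (eps / 2 + C / (2 * n%:R + 4)) * J by ring.
  by rewrite ler_wpM2r ?(ltW J0)//; lra.
by rewrite ler_pM2r.
Qed.

End Peak.

(* Only integrability is assumed: the peaking argument is applied to the antiderivative of [u]. *)
Lemma trig_complete (u : R -> R) : mu.-integrable setT (EFin \o u) ->
    (forall x, x \notin `[- a, a] -> u x = 0) ->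
    (forall (k : int) (d : R), \int[mu]_x (u x * cos (k%:~R * h * x + d)) = 0) ->
  {ae mu, forall x, u x = 0}.
Proof.
move=> iu u0 ucos.
have iuI A : measurable A -> mu.-integrable A (EFin \o u).
  by move=> mA; apply: integrableS iu.
pose Phi x := \int[mu]_(t in `[- a, x]) u t.
have cPhi : {within `[- a, a], continuous Phi}.
  by apply: parameterized_integral_continuous; [exact: ltW|exact: iuI].
have PhiE x : x <= a -> Phi x = \int[mu]_t (u t * (if t <= x then 1 else 0)).
  move=> xa; rewrite /Phi Rintegral_mkcond; apply: eq_Rintegral => t _.
  rewrite patchE; case: ifPn.
    by rewrite inE/= in_itv/= => /andP[_ ->]; rewrite mulr1.
  rewrite notin_setE/= in_itv/= => /negP; rewrite negb_and => /orP[ta|/negPf ->].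
    by rewrite u0 ?mul0r// in_itv/= (negPf ta).
  by rewrite mulr0.
(* Subtracting the mean value [m] settles the frequency 0; for the others [m] drops out because the
   cosine integrates to 0 over a period. *)
pose m := (\int[mu]_(x in `[- a, a]) Phi x) / (2 * a).
have Phim x : - a < x < a -> Phi x = m.
  move=> xa; apply/eqP; rewrite -subr_eq0; apply/eqP.
  apply: (@peak_eq0 (fun x => Phi x - m) x) => //.
    by move=> y; apply: cvgB; [exact: cPhi|exact: cvg_cst].
  have iPhi : mu.-integrable `[- a, a] (EFin \o Phi) by exact: continuous_itv_integrable.
  move=> k d; have [->|k0] := eqVneq k 0.
    under eq_Rintegral do rewrite !mul0r add0r mulrC.
    have im : mu.-integrable `[- a, a] (EFin \o (fun=> m)).
      by apply: cont_itv_integrable => y; exact: cvg_cst.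
    rewrite RintegralZl//; last exact: intgB.
    rewrite RintegralB// Rintegral_cst//= lebesgue_measure_itv/= lte_fin aa/= /m.
    by rewrite (_ : a - - a = 2 * a) ?divfK ?subrr ?mulr0// ?mulf_neq0 ?gt_eqF//; lra.
  have kh0 : k%:~R * h != 0 by rewrite mulf_neq0 ?intr_eq0// gt_eqF.
  have ccos := @continuous_cos_affine R (k%:~R * h) d.
  have icos : mu.-integrable `[- a, a] (EFin \o (fun x => cos (k%:~R * h * x + d))) by exact: cont_itv_integrable.
  have iPc : mu.-integrable `[- a, a] (EFin \o (fun x => Phi x * cos (k%:~R * h * x + d))).
    by apply: continuous_itv_integrable => y; apply: cvgM; [exact: cPhi|exact: continuous_subspaceT].
  under eq_Rintegral do rewrite mulrBl.
  rewrite RintegralB//; last exact: intgZ.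
  rewrite RintegralZl// Rintegral_cos_affine//.
  have sinB : sin (k%:~R * h * a + d) - sin (k%:~R * h * - a + d) = 0 :> R.
    have -> : k%:~R * h * a = k%:~R * pi by rewrite -mulrA ha.
    have -> : k%:~R * h * - a = - (k%:~R * pi) by rewrite mulrN -mulrA ha.
    by rewrite !sinD sinN cosN sin_intpi oppr0 !mul0r subrr.
  rewrite sinB mul0r mulr0 subr0.
  pose f x := (fun x => cos (k%:~R * h * x + d) : R) \_ `[- a, a] x.
  (* Exchanging the integrals over [t <= x] replaces integration by parts: the cosine integrated
     from [t] to [a] is a constant minus a sine, and a sine is a cosine shifted by pi / 2. *)
  pose kk (z : R * R) : R := if z.2 <= z.1 then 1 else 0.
  transitivity (\int[mu]_x (f x * \int[mu]_t (u t * kk (x, t)))).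
    rewrite Rintegral_mkcond; apply: eq_Rintegral => y _.
    rewrite /f !patchE; case: ifPn => [|_]; last by rewrite mul0r.
    by rewrite inE/= in_itv/= => /andP[_ xa']; rewrite mulrC PhiE.
  rewrite Fubini_kernel//; last 3 first.
  - have -> : EFin \o f = (EFin \o (fun x => cos (k%:~R * h * x + d) : R)) \_ `[- a, a].
      by rewrite restrict_EFin.
    by apply/(integrable_mkcond _ _).1.
  - apply: measurable_fun_ifT => //; apply: measurable_fun_ler.
      exact: measurable_snd. exact: measurable_fst.
  - by move=> z; rewrite /kk; case: ifP => _; rewrite ?normr1 ?normr0.
  transitivity (\int[mu]_y ((sin (k%:~R * h * a + d) / (k%:~R * h)) * u y -
      (k%:~R * h)^-1 * (u y * cos (k%:~R * h * y + (d - pi / 2))))).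
    apply: eq_Rintegral => t _.
    have [tI|tI] := boolP (t \in `[- a, a]); last by rewrite u0// !mul0r !mulr0 subrr.
    have E y : cos (k%:~R * h * y + (d - pi / 2)) = sin (k%:~R * h * y + d).
      by rewrite addrA cosBpihalf.
    rewrite (_ : \int[mu]_x (f x * kk (x, t)) = \int[mu]_(x in `[t, a]) cos (k%:~R * h * x + d)).
      move: tI; rewrite in_itv/= => /andP[_]; rewrite le_eqVlt => /predU1P[->|ta].
        rewrite set_itv1 Rintegral_set1 mulr0.
        rewrite E; set K := k%:~R * h; ring.
      rewrite Rintegral_cos_affine// E; set K := k%:~R * h; ring.
    rewrite [RHS]Rintegral_mkcond; apply: eq_Rintegral => y _.
    rewrite /f /kk !patchE/= !mem_setE !in_itv/=.
    move: tI; rewrite in_itv/= => /andP[at1 ta].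
    have [tx|xt] := leP t y; last by rewrite mulr0.
    by rewrite mulr1 (le_trans at1 tx).
  have iuc b : mu.-integrable setT (EFin \o (fun y => u y * cos (k%:~R * h * y + b))).
    apply: (le_integrable measurableT _ _ iu).
      apply/measurable_EFinP; apply: measurable_funM.
        by apply/measurable_EFinP; exact: measurable_int iu.
      by apply: continuous_measurable_fun; exact: continuous_cos_affine.
    by move=> x' _ /=; rewrite lee_fin normrM ler_piMr// cos_max.
  rewrite RintegralB//; [|exact: intgZ|exact: intgZ].
  rewrite !RintegralZl// ucos mulr0 subr0.
  have := ucos 0 0; under eq_Rintegral do rewrite !mul0r add0r cos0 mulr1.
  by move=> ->; rewrite mulr0.
(* By Lebesgue differentiation [u] is almost everywhere the derivative of [Phi], which is constant
   inside the interval. *)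
have FT := @FTC1 R u (BLeft (- a)) (fun y => iuI _ (measurable_itv _)) .
have li : locally_integrable [set: R] u.
  by apply: open_integrable_locally => //; exact: openT.
have := FT li.
have aeN (y : R) : {ae mu, forall x : R, x != y}.
  exists [set y]; split => //; first exact: lebesgue_measure_set1.
  by move=> x /= /negP; rewrite negbK => /eqP.
move=> /= FTx; have aF : Filter (almost_everywhere mu) := ae_filter_ringOfSetsType mu.
apply: filterS3 FTx (aeN (- a)) (aeN a) => x FTx xNa xa'.
have [xI|/u0//] := boolP (x \in `[- a, a]).
have xa : - a < x < a.
  by move: xI; rewrite in_itv/= !lt_neqAle xa' eq_sym xNa.
have [|_ <-] := FTx; first by rewrite lte_fin; case/andP: xa.
rewrite derive1E (@near_eq_derive _ _ _ Phi (cst m))//; first exact: derive_cst.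
have : x \in `]- a, a[ by rewrite in_itv.
move=> /near_in_itvoo; apply: filterS => y; rewrite in_itv/=; exact: Phim.
Qed.

End TrigonometricCompleteness.

(* 0, 1, -1, 2, -2, and so on: the first [2N+1] values are the integers of absolute value at most N. *)
Definition zenum (i : nat) : int :=
  if odd i then (i./2.+1)%:Z else - (i./2)%:Z.

Lemma zenum_surj k : exists i, zenum i = k.
Proof.
case: k => [[|n]|n].
- by exists 0%N.
- by exists n.*2.+1; rewrite /zenum /= odd_double /= uphalf_double.
- exists n.+1.*2; rewrite /zenum odd_double doubleK NegzE; by [].
Qed.

Lemma zenum_inj : injective zenum.
Proof.
have E i : i = (odd i + (i./2).*2)%N by rewrite odd_double_half.
move=> i j; rewrite /zenum; case: ifP => oi; case: ifP => oj.
- by move=> [h]; rewrite (E i) (E j) oi oj h.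
- by move=> h; exfalso; move: h; case: (j./2).
- by move=> h; exfalso; move: h; case: (i./2).
- by move=> /oppr_inj[h]; rewrite (E i) (E j) oi oj h.
Qed.

Section Exponentials.
Local Open Scope complex_scope.
Variable R : realType.
Notation mu := (@lebesgue_measure R).
Notation dot := (dot mu).
Notation cL2 := (cL2 mu).
Implicit Types (f g : R -> R[i]) (w x : R).

Lemma sqn_cis x : sqn (cis x) = 1.
Proof. by rewrite /sqn/= cos2Dsin2. Qed.

Lemma cisD x y : cis (x + y) = cis x * cis y.
Proof. by apply: complex_eq; rewrite !complex_partsE/= ?cosD ?sinD//; ring. Qed.

Lemma measurable_cos_affine (c d : R) : measurable_fun setT (fun x => cos (c * x + d)).
Proof. by apply: continuous_measurable_fun; exact: continuous_cos_affine. Qed.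

Lemma measurable_sin_affine (c d : R) : measurable_fun setT (fun x => sin (c * x + d)).
Proof. by apply: continuous_measurable_fun; exact: continuous_sin_affine. Qed.

Lemma cL2_cis f w : cL2 f -> cL2 (fun x => f x * cis (w * x)).
Proof.
move=> cf; apply: cL2bM => //=.
- by have := measurable_cos_affine w 0; under eq_fun do rewrite addr0.
- by have := measurable_sin_affine w 0; under eq_fun do rewrite addr0.
- by move=> x; rewrite sqn_cis.
Qed.

(** The half-width is a parameter: [a = pi] gives [expo], and Plancherel is also needed on the
    truncation intervals [-N, N]. *)
Definition expw (a w : R) : R -> R[i] := fun x =>
  if x \in `[- a, a] then ((Num.sqrt (2 * a))^-1)%:C * cis (w * x) else 0.

Lemma cL2_indic (a : R) : cL2 (fun x => (\1_(`[- a, a] : set R) x)%:C).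
Proof.
split=> /=; last exact: sqint0.
apply: sqintP; first exact: measurable_indic.
under eq_integral do rewrite indicE -natrX; rewrite [X in (X < _)%E](_ : _ = \int[mu]_x (\1_(`[- a, a] : set R) x)%:E)%E.
  rewrite integral_indic// setIT.
  apply: (@le_lt_trans _ _ (@lebesgue_measure R `[- a, a]%classic)) => //.
  rewrite lebesgue_measure_itv/=; by case: ifP => _; rewrite ?ltry// -EFinB ltry.
by apply: eq_integral => x _; rewrite indicE; case: (_ \in _).
Qed.

Lemma cL2_expw a w : cL2 (expw a w).
Proof.
have -> : expw a w = (fun x => ((Num.sqrt (2 * a))^-1)%:C * ((\1_(`[- a, a] : set R) x)%:C * cis (w * x))).
  apply/funext => x; rewrite /expw indicE mem_setE.
  by case: (x \in _); rewrite ?mul1r// mul0r mulr0.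
by apply: cL2M; apply: cL2_cis; exact: cL2_indic.
Qed.

Lemma dotiE f g : dot f (fun x => 'i * g x) =
  \int[mu]_x (complex.Im (f x) * complex.Re (g x) - complex.Re (f x) * complex.Im (g x)).
Proof. by apply: eq_Rintegral => x _; rewrite !complex_partsE/=; ring. Qed.

Lemma dotii f g : dot (fun x => 'i * f x) (fun x => 'i * g x) = dot f g.
Proof. by apply: eq_Rintegral => x _; rewrite !complex_partsE/=; ring. Qed.

Section Scale.
Variable a : R.
Hypothesis a0 : 0 < a.
Let aa : - a < a. Proof. by rewrite gtrN. Qed.
Let sa : (Num.sqrt (2 * a))^-1 ^+ 2 = (2 * a)^-1.
Proof. by rewrite exprVn sqr_sqrtr// mulr_ge0// ltW. Qed.

Lemma dot_expw w1 w2 : dot (expw a w1) (expw a w2) = sinc ((w1 - w2) * a).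
Proof.
transitivity (\int[mu]_(x in `[- a, a]) ((2 * a)^-1 * cos ((w1 - w2) * x + 0))).
  rewrite [RHS]Rintegral_mkcond; apply: eq_Rintegral => x _.
  rewrite patchE mem_setE /expw; case: ifP => _; last by rewrite /= !mul0r addr0.
  rewrite !complex_partsE/= -sa addr0 mulrBl cosB; ring.
rewrite RintegralZl//; last by apply: cont_itv_integrable; exact: continuous_cos_affine.
rewrite /sinc; have [w0|w0] := eqVneq (w1 - w2) 0.
  rewrite w0 mul0r eqxx; under eq_Rintegral do rewrite mul0r addr0 cos0.
  rewrite Rintegral_cst//= lebesgue_measure_itv/= lte_fin aa/= mul1r opprK.
  by rewrite (_ : a + a = 2 * a) ?mulVf ?mulf_neq0 ?gt_eqF//; ring.
rewrite mulf_eq0 (negPf w0) (gt_eqF a0)/= Rintegral_cos_affine//.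
rewrite mulrN !addr0 sinN opprK; field.
by rewrite w0 gt_eqF.
Qed.

(** The imaginary part of a product of exponentials integrates an odd sine over a symmetric
    interval; the sine is written as a cosine shifted by pi / 2. *)
Lemma dot_expw_i w1 w2 : dot (expw a w1) (fun x => 'i * expw a w2 x) = 0.
Proof.
rewrite dotiE.
transitivity (\int[mu]_(x in `[- a, a]) ((2 * a)^-1 * cos ((w1 - w2) * x + - (pi / 2)))).
  rewrite [RHS]Rintegral_mkcond; apply: eq_Rintegral => x _.
  rewrite patchE mem_setE /expw; case: ifP => _; last by rewrite /= !mul0r subrr.
  by rewrite !complex_partsE/= -sa cosBpihalf mulrBl sinB; ring.
rewrite RintegralZl//; last by apply: cont_itv_integrable; exact: continuous_cos_affine.
have [w0|w0] := eqVneq (w1 - w2) 0.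
  rewrite w0; under eq_Rintegral do rewrite mul0r add0r cosN cos_pihalf.
  by rewrite Rintegral_cst// mul0r mulr0.
by rewrite Rintegral_cos_affine// mulrN !sinBpihalf cosN subrr mul0r mulr0.
Qed.

(* An orthonormal basis for the real product [dot]: each exponential occurs with its multiple by ['i]. *)
Definition expsys (j : nat) : R -> R[i] := fun x =>
  (if odd j then 'i else 1) * expw a ((zenum j./2)%:~R * (pi / a)) x.

Lemma cL2_expsys j : cL2 (expsys j).
Proof. by apply: cL2M; exact: cL2_expw. Qed.

Lemma expsys0 j x : x \notin `[- a, a] -> expsys j x = 0.
Proof. by move=> xa; rewrite /expsys /expw (negPf xa) mulr0. Qed.

Lemma sinc_int (k : int) : sinc (k%:~R * pi) = (k == 0)%:R :> R.
Proof.
rewrite /sinc mulf_eq0 intr_eq0 (gt_eqF (pi_gt0 R)) orbF sin_intpi mul0r.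
by case: eqP.
Qed.

Lemma expsysON i j : dot (expsys i) (expsys j) = (i == j)%:R.
Proof.
have E (k : nat) : k = (odd k + (k./2).*2)%N by rewrite odd_double_half.
have S (k l : nat) : sinc (((zenum k)%:~R * (pi / a) - (zenum l)%:~R * (pi / a)) * a) = (k == l)%:R :> R.
  have -> : ((zenum k)%:~R * (pi / a) - (zenum l)%:~R * (pi / a)) * a = (zenum k - zenum l)%:~R * pi.
    by rewrite intrB; field; rewrite gt_eqF.
  by rewrite sinc_int subr_eq0 (inj_eq zenum_inj).
have h (k l : nat) : (k == l) = (odd k == odd l) && (k./2 == l./2).
  apply/eqP/andP => [->|[/eqP o /eqP e]]; first by rewrite !eqxx.
  by rewrite (E k) (E l) o e.
rewrite h /expsys; case: (odd i); case: (odd j) => /=.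
- by rewrite dotii dot_expw S.
- rewrite dotC; under [X in dot X]eq_fun do rewrite mul1r.
  by rewrite dot_expw_i.
- under [X in dot X]eq_fun do rewrite mul1r.
  by rewrite dot_expw_i.
- under [X in dot X]eq_fun do rewrite mul1r.
  under [X in dot _ X]eq_fun do rewrite mul1r.
  by rewrite dot_expw S.
Qed.

Lemma sqint_supp_integrable (u : R -> R) : sqint mu u -> (forall x, x \notin `[- a, a] -> u x = 0) ->
  mu.-integrable setT (EFin \o u).
Proof.
move=> su u0; have [si _] := cL2_indic a.
have := sqint_mul su si.
have -> // : (fun x => (u x * complex.Re (\1_(`[- a, a] : set R) x)%:C)%:E) = EFin \o u.
apply/funext => x /=; rewrite indicE mem_setE.
by have [xa|xa] := boolP (x \in `[- a, a]); rewrite ?mulr1// u0// mul0r.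
Qed.

(** Orthogonality mixes the two parts of [g], through [C u k + S v k = 0] and [C v k - S u k = 0].
    As [C] is even and [S] odd in [k], the indices [k] and [- k] together separate them, and
    [trig_complete] applies to [u] and [v]. *)
Lemma expsys_complete g : cL2 g -> (forall x, ~ `[- a, a]%classic x -> g x = 0) ->
  (forall j, dot g (expsys j) = 0) -> dot g g = 0.
Proof.
move=> cg g0 gj.
have g0' x : x \notin `[- a, a] -> g x = 0 by move=> /negP; exact: g0.
pose u x := complex.Re (g x); pose v x := complex.Im (g x).
have u0 x : x \notin `[- a, a] -> u x = 0 by move=> /g0'; rewrite /u => ->.
have v0 x : x \notin `[- a, a] -> v x = 0 by move=> /g0'; rewrite /v => ->.
have iu := sqint_supp_integrable cg.1 u0.
have iv := sqint_supp_integrable cg.2 v0.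
have ib (s b : R -> R) : mu.-integrable setT (EFin \o s) -> measurable_fun setT b -> (forall x, `|b x| <= 1) ->
    mu.-integrable setT (EFin \o (fun x => s x * b x)).
  move=> is_ mb b1; apply: (le_integrable measurableT _ _ is_).
    apply/measurable_EFinP; apply: measurable_funM => //.
    by apply/measurable_EFinP; exact: measurable_int is_.
  by move=> x' _ /=; rewrite lee_fin normrM ler_piMr.
pose h : R := pi / a.
pose C (s : R -> R) (k : int) := \int[mu]_x (s x * cos (k%:~R * h * x + 0)).
pose S (s : R -> R) (k : int) := \int[mu]_x (s x * sin (k%:~R * h * x + 0)).
have ic s k : mu.-integrable setT (EFin \o s) -> mu.-integrable setT (EFin \o (fun x => s x * cos (k%:~R * h * x + 0))).
  by move=> is_; apply: ib => //; [exact: measurable_cos_affine|move=> x; exact: cos_max].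
have is_ s k : mu.-integrable setT (EFin \o s) -> mu.-integrable setT (EFin \o (fun x => s x * sin (k%:~R * h * x + 0))).
  by move=> is_; apply: ib => //; [exact: measurable_sin_affine|move=> x; exact: sin_max].
have sN0 : (Num.sqrt (2 * a))^-1 != 0.
  by rewrite invr_eq0 gt_eqF// sqrtr_gt0 mulr_gt0.
have eq1 k : C u k + S v k = 0.
  have [i <-] := zenum_surj k.
  have := gj i.*2; rewrite /expsys odd_double doubleK => /eqP.
  rewrite (_ : dot _ _ = (Num.sqrt (2 * a))^-1 * (C u (zenum i) + S v (zenum i))).
    by rewrite mulf_eq0 (negPf sN0)/= => /eqP.
  rewrite /C /S -RintegralD//; [|exact: ic|exact: is_].
  rewrite -RintegralZl//; last by apply: intgD => //; [exact: ic|exact: is_].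
  apply: eq_Rintegral => x _; rewrite mul1r /expw addr0; case: ifPn => [xa|/[dup] /u0 -> /v0 ->].
    by rewrite !complex_partsE/= -/h /u /v; ring.
  by rewrite /= !mul0r !mulr0 addr0 mulr0.
have eq2 k : C v k - S u k = 0.
  have [i <-] := zenum_surj k.
  have := gj i.*2.+1; rewrite /expsys /= odd_double /= uphalf_double => /eqP.
  rewrite dotiE.
  rewrite (_ : Rintegral _ _ _ = (Num.sqrt (2 * a))^-1 * (C v (zenum i) - S u (zenum i))).
    by rewrite mulf_eq0 (negPf sN0)/= => /eqP.
  rewrite /C /S -RintegralB//; [|exact: ic|exact: is_].
  rewrite -RintegralZl//; last by apply: intgB => //; [exact: ic|exact: is_].
  apply: eq_Rintegral => x _; rewrite /expw addr0; case: ifPn => [xa|/[dup] /u0 -> /v0 ->].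
    by rewrite !complex_partsE/= -/h /u /v; ring.
  by rewrite /= !mul0r !mulr0 subrr mulr0.
have CN s k : C s (- k) = C s k.
  by apply: eq_Rintegral => x _; rewrite mulrNz !mulNr !addr0 cosN.
have SN s k : mu.-integrable setT (EFin \o s) -> S s (- k) = - S s k.
  move=> ints; rewrite /S -[RHS]mulN1r -RintegralZl//; last exact: is_.
  by apply: eq_Rintegral => x _; rewrite mulrNz !mulNr !addr0 sinN mulrN mul1r.
have Cu k : C u k = 0 by have := eq1 k; have := eq1 (- k); rewrite CN SN//; lra.
have Sv k : S v k = 0 by have := eq1 k; rewrite Cu add0r.
have Cv k : C v k = 0 by have := eq2 k; have := eq2 (- k); rewrite CN SN//; lra.
have Su k : S u k = 0 by have := eq2 k; rewrite Cv; lra.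
have null s : mu.-integrable setT (EFin \o s) -> (forall x, x \notin `[- a, a] -> s x = 0) ->
    (forall k, C s k = 0) -> (forall k, S s k = 0) -> {ae mu, forall x, s x = 0}.
  move=> ints s0 Cs Ss; apply: (trig_complete a0 ints s0) => k d.
  transitivity (cos d * C s k - sin d * S s k); last by rewrite Cs Ss !mulr0 subrr.
  rewrite -!RintegralZl//; [|exact: is_|exact: ic].
  rewrite -RintegralB//; [|apply: intgZ => //; exact: ic|apply: intgZ => //; exact: is_].
  by apply: eq_Rintegral => x _; rewrite !addr0 cosD -/h; ring.
have au := null u iu u0 Cu Su; have av := null v iv v0 Cv Sv.
have aF : Filter (almost_everywhere mu) := ae_filter_ringOfSetsType mu.
apply/EFin_inj; rewrite dotE//.
have -> : 0%:E = (\int[mu]_x (cst 0%E x))%E :> \bar R by rewrite integral0.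
apply: ae_eq_integral => //.
- by apply/measurable_EFinP/measurable_funD; apply: measurable_funX; [exact: cg.1.1|exact: cg.2.1].
- by apply: filterS2 au av => x ux vx _; rewrite /sqn -/(u x) -/(v x) ux vx expr0n addr0.
Qed.

Lemma parseval_expsys g : cL2 g -> (forall x, x \notin `[- a, a] -> g x = 0) ->
  (fun n => \sum_(i < n) dot g (expsys i) ^+ 2) @ \oo --> dot g g.
Proof.
move=> cg g0; apply: (@parseval _ _ _ mu _ cL2_expsys expsysON `[- a, a]%classic) => //.
- by move=> i x /negP; exact: expsys0.
- exact: expsys_complete.
- by move=> x /negP; exact: g0.
Qed.

End Scale.

End Exponentials.

(** * Fourier transforms of functions with compact support *)

Section FourierCompact.
Local Open Scope complex_scope.
Variable R : realType.
Notation mu := (@lebesgue_measure R).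
Notation dot := (dot mu).
Notation cL2 := (cL2 mu).
Implicit Types (f g : R -> R[i]) (x y w : R).

(** For square-integrable functions of compact support the integral converges absolutely, so the
    transform has a value at every point without limits in the mean. *)
Definition hat f x : R[i] := Cintegral setT (fun xi => f xi * cis (- (xi * x))).

Definition suppin (a : R) f := forall x, x \notin `[- a, a] -> f x = 0.

Lemma suppin_le (a b : R) f : a <= b -> suppin a f -> suppin b f.
Proof.
move=> ab fa x xb; apply: fa; apply: contra xb; rewrite !in_itv/= => /andP[ax xa].
by rewrite (le_trans _ ax) ?lerN2// (le_trans xa).
Qed.

Section Support.
Variable a : R.
Hypothesis a0 : 0 < a.
Let h : R := pi / a.
Let h0 : 0 < h. Proof. by rewrite divr_gt0// pi_gt0. Qed.
Let sN0 : Num.sqrt (2 * a) != 0.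
Proof. by rewrite gt_eqF// sqrtr_gt0 mulr_gt0. Qed.
Let s2 : Num.sqrt (2 * a) ^+ 2 = 2 * a.
Proof. by rewrite sqr_sqrtr// mulr_ge0// ltW. Qed.

Let dot_expwE f x : cL2 f -> suppin a f ->
  dot f (expw a x) = (Num.sqrt (2 * a))^-1 * complex.Re (hat f x) /\
  dot f (fun xi => 'i * expw a x xi) = (Num.sqrt (2 * a))^-1 * complex.Im (hat f x).
Proof.
move=> cf f0.
have cfc : cL2 (fun xi => f xi * cis (- x * xi)) by exact: cL2_cis.
have sfc : suppin a (fun xi => f xi * cis (- x * xi)) by move=> y /f0 ->; rewrite mul0r.
have E y : cis (- (y * x)) = cis (- x * y) :> R[i] by rewrite mulNr mulrC.
split.
  rewrite /hat/= -RintegralZl//; last first.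
    under eq_fun do rewrite E; apply: sqint_supp_integrable cfc.1 _ => //.
    by move=> y /sfc ->.
  apply: eq_Rintegral => y _; rewrite /expw; case: ifPn => [_|/f0 ->].
    by rewrite !complex_partsE/= cosN sinN [y * x]mulrC; ring.
  by rewrite !complex_partsE/=; ring.
rewrite /hat/= -RintegralZl//; last first.
  under eq_fun do rewrite E; apply: sqint_supp_integrable cfc.2 _ => //.
  by move=> y /sfc ->.
rewrite dotiE; apply: eq_Rintegral => y _; rewrite /expw; case: ifPn => [_|/f0 ->].
  by rewrite !complex_partsE/= cosN sinN [y * x]mulrC; ring.
by rewrite !complex_partsE/=; ring.
Qed.

(** Values of the transform are coordinates along exponentials; facts about [dot] become facts about
    [hat]. *)
Lemma hatE f x : cL2 f -> suppin a f ->
  hat f x = (Num.sqrt (2 * a))%:C * (dot f (expw a x) +i* dot f (fun xi => 'i * expw a x xi)).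
Proof.
move=> cf f0; have [-> ->] := dot_expwE x cf f0.
by apply: complex_eq; rewrite !complex_partsE/= mulrA divff// mul1r.
Qed.

Lemma sqn_hatE f x : cL2 f -> suppin a f ->
  sqn (hat f x) = 2 * a * (dot f (expw a x) ^+ 2 + dot f (fun xi => 'i * expw a x xi) ^+ 2).
Proof.
by move=> cf f0; rewrite hatE// /sqn !complex_partsE/= -[X in _ = X * _]s2; ring.
Qed.

Lemma hatD f g x : cL2 f -> suppin a f -> cL2 g -> suppin a g ->
  hat (fun xi => f xi + g xi) x = hat f x + hat g x.
Proof.
move=> cf f0 cg g0.
have ce := @cL2_expw R a x.
have cie : cL2 (fun xi => 'i * expw a x xi) by exact: cL2M.
rewrite !hatE//; first by rewrite !dotDl//; apply: complex_eq; rewrite !complex_partsE/=; ring.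
- exact: cL2D.
- by move=> y ya; rewrite f0// g0// addr0.
Qed.

Lemma hatM f x (c : R[i]) : cL2 f -> suppin a f ->
  hat (fun xi => c * f xi) x = c * hat f x.
Proof.
move=> cf f0.
have i1 : mu.-integrable setT (EFin \o (fun xi => complex.Re (f xi * cis (- (xi * x))))).
  apply: (@sqint_supp_integrable _ a) => [|y /f0 ->]; last by rewrite mul0r.
  by have := (cL2_cis (- x) cf).1; under eq_fun do rewrite mulNr mulrC [x * _]mulrC mulrC.
have i2 : mu.-integrable setT (EFin \o (fun xi => complex.Im (f xi * cis (- (xi * x))))).
  apply: (@sqint_supp_integrable _ a) => [|y /f0 ->]; last by rewrite mul0r.
  by have := (cL2_cis (- x) cf).2; under eq_fun do rewrite mulNr mulrC [x * _]mulrC mulrC.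
apply: complex_eq; rewrite !complex_partsE /hat /Cintegral /=.
  rewrite -!RintegralZl// -RintegralB//; [|exact: intgZ|exact: intgZ].
  by apply: eq_Rintegral => y _; rewrite -mulrA cReM.
rewrite -!RintegralZl// -RintegralD//; [|exact: intgZ|exact: intgZ].
by apply: eq_Rintegral => y _; rewrite -mulrA cImM.
Qed.

Lemma hat_shift f x y : hat (fun xi => f xi * cis (- (xi * y))) x = hat f (y + x).
Proof.
by congr Cintegral; apply/funext => xi; rewrite -mulrA -cisD mulrDr opprD.
Qed.

Lemma dot_modulate f y : dot (fun xi => f xi * cis (y * xi)) (fun xi => f xi * cis (y * xi)) = dot f f.
Proof.
apply: eq_Rintegral => x _; rewrite -!expr2 -/(sqn _) -/(sqn (f x)).
by rewrite sqnM sqn_cis mulr1.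
Qed.

Lemma sum_pairs (F : nat -> R) n : \sum_(i < n.*2) F i = \sum_(i < n) (F i.*2 + F i.*2.+1).
Proof.
elim: n => [|n IH]; first by rewrite !big_ord0.
by rewrite doubleS !big_ord_recr/= IH addrA.
Qed.

(** An exponential and its multiple by ['i] together give one squared modulus of [hat], which is why
    partial sums of even length are taken. *)
Lemma parseval_hat f : cL2 f -> suppin a f ->
  (fun n => \sum_(i < n) sqn (hat f ((zenum i)%:~R * h))) @ \oo --> 2 * a * dot f f.
Proof.
move=> cf f0.
have := parseval_expsys a0 cf f0.
have dbl : (fun n => n.*2) @ \oo --> \oo.
  by move=> A [N _ hN]; exists N => // n /= Nn; apply: hN => /=; rewrite (leq_trans Nn)// -addnn leq_addr.
move=> /(cvg_comp _ _ dbl) pj.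
have : (fun n => 2 * a * \sum_(i < n.*2) dot f (expsys a i) ^+ 2) @ \oo --> 2 * a * dot f f.
  by apply: cvgM; [exact: cvg_cst|exact: pj].
apply: cvg_trans; apply: near_eq_cvg; apply: nearW => n.
rewrite /= (sum_pairs (fun i => dot f (expsys a i) ^+ 2)) mulr_sumr; apply: eq_bigr => i _; rewrite sqn_hatE//.
congr (_ * (_ ^+ 2 + _ ^+ 2)).
  congr dot; apply/funext => y.
  by rewrite /expsys odd_double doubleK mul1r.
congr dot; apply/funext => y.
by rewrite /expsys /= odd_double /= uphalf_double.
Qed.

Lemma cL2_L1 f : cL2 f -> suppin a f ->
  mu.-integrable setT (EFin \o (fun x => complex.Re (f x))) /\
  mu.-integrable setT (EFin \o (fun x => complex.Im (f x))).
Proof.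
move=> cf f0; split; apply: (@sqint_supp_integrable _ a) => //; [exact: cf.1| |exact: cf.2|].
  by move=> x /f0 ->.
by move=> x /f0 ->.
Qed.

(** Dominated convergence with bound [|u| + |v|]. Both parts of [hat], the cosine and sine
    transforms and the Wallis integrals have this form. *)
Lemma continuous_transform (u v : R -> R) :
    mu.-integrable setT (EFin \o u) -> mu.-integrable setT (EFin \o v) ->
  continuous (fun x => \int[mu]_xi (u xi * cos (xi * x) + v xi * sin (xi * x))).
Proof.
move=> iu iv x.
have mu_ : measurable_fun setT u by apply/measurable_EFinP; exact: measurable_int iu.
have mv : measurable_fun setT v by apply/measurable_EFinP; exact: measurable_int iv.
have mc y : measurable_fun setT (fun xi : R => cos (xi * y)).
  by have := measurable_cos_affine y 0; under eq_fun do rewrite addr0 mulrC.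
have ms y : measurable_fun setT (fun xi : R => sin (xi * y)).
  by have := measurable_sin_affine y 0; under eq_fun do rewrite addr0 mulrC.
have dom xi y : `|u xi * cos (xi * y) + v xi * sin (xi * y)| <= `|u xi| + `|v xi|.
  rewrite (le_trans (ler_normD _ _))// !normrM lerD// ler_piMr//.
    exact: cos_max.
  exact: sin_max.
have iuv : mu.-integrable setT (EFin \o (fun xi => `|u xi| + `|v xi|)).
  by apply: intgD => //; exact: intg_norm.
have xI : x \in (`]x - 1, x + 1[)%classic.
  by rewrite inE/= in_itv/=; apply/andP; split; lra.
apply: (@continuity_under_integral _ _ _ mu
  (fun y xi => u xi * cos (xi * y) + v xi * sin (xi * y)) setT measurableT (x - 1) (x + 1)
  _ _ (fun xi => `|u xi| + `|v xi|)) => //.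
- move=> y _; apply: (le_integrable measurableT _ _ iuv).
    apply/measurable_EFinP; apply: measurable_funD; apply: measurable_funM; [exact: mu_|exact: mc|exact: mv|exact: ms].
  move=> xi _ /=; rewrite lee_fin; apply: le_trans (dom xi y) _.
  exact: ler_norm.
- apply/aeW => xi _ y _.
  have cl : xi * z @[z --> y] --> xi * y by apply: cvgM; [exact: cvg_cst|exact: cvg_id].
  apply: cvgD; apply: cvgM; try exact: cvg_cst.
    by apply: (@cvg_comp _ _ _ (fun z => xi * z) cos _ _ _ cl); exact: continuous_cos.
  by apply: (@cvg_comp _ _ _ (fun z => xi * z) sin _ _ _ cl); exact: continuous_sin.
- by move=> y _; apply/aeW => xi _; exact: dom.
Qed.

Lemma continuous_Re_hat f : cL2 f -> suppin a f -> continuous (fun x => complex.Re (hat f x)).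
Proof.
move=> cf f0; have [iu iv] := cL2_L1 cf f0.
have -> : (fun x => complex.Re (hat f x)) = (fun x => \int[mu]_xi
    (complex.Re (f xi) * cos (xi * x) + complex.Im (f xi) * sin (xi * x))).
  apply/funext => x; rewrite /hat /=; apply: eq_Rintegral => xi _.
  by rewrite !complex_partsE/= cosN sinN; ring.
exact: continuous_transform.
Qed.

Lemma continuous_Im_hat f : cL2 f -> suppin a f -> continuous (fun x => complex.Im (hat f x)).
Proof.
move=> cf f0; have [iu iv] := cL2_L1 cf f0.
have -> : (fun x => complex.Im (hat f x)) = (fun x => \int[mu]_xi
    (complex.Im (f xi) * cos (xi * x) + (-1 * complex.Re (f xi)) * sin (xi * x))).
  apply/funext => x; rewrite /hat /=; apply: eq_Rintegral => xi _.
  by rewrite !complex_partsE/= cosN sinN; ring.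
by apply: continuous_transform => //; exact: intgZ.
Qed.

Lemma continuous_sqn_hat f : cL2 f -> suppin a f -> continuous (fun x => sqn (hat f x)).
Proof.
move=> cf f0; have cr := continuous_Re_hat cf f0; have ci := continuous_Im_hat cf f0.
have -> : (fun x => sqn (hat f x)) = (fun x => complex.Re (hat f x) * complex.Re (hat f x) +
    complex.Im (hat f x) * complex.Im (hat f x)).
  by apply/funext => x; rewrite -!expr2.
by move=> x; apply: cvgD; apply: cvgM; [exact: cr|exact: cr|exact: ci|exact: ci].
Qed.

Let cell (j : nat) : set R := [set x | Num.floor (x / h) == zenum j].

Let cellE j : cell j = `[(zenum j)%:~R * h, (zenum j)%:~R * h + h[%classic.
Proof.
apply/seteqP; split=> x; rewrite /cell /= floor_eq in_itv/= intrD.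
  by rewrite ler_pdivlMr// ltr_pdivrMr// mulrDl mul1r.
by rewrite ler_pdivlMr// ltr_pdivrMr// mulrDl mul1r.
Qed.

(* Plancherel follows from Parseval for the modulations of [f]: the integral over the line is cut into
   translates of [[0, h]]. *)
Lemma ge0_integral_periodize (F : R -> R) : continuous F -> (forall x, 0 <= F x) ->
  (\int[mu]_x (F x)%:E =
   \int[mu]_(x in `[0%R, h]) \sum_(0 <= j <oo) (F ((zenum j)%:~R * h + x))%:E)%E.
Proof.
move=> cF F0.
have mF : measurable_fun setT (fun x => (F x)%:E).
  by apply/measurable_EFinP; exact: continuous_measurable_fun.
have cov : \bigcup_j cell j = setT.
  apply/seteqP; split=> // x _; have [j hj] := zenum_surj (Num.floor (x / h)).
  by exists j => //=; rewrite /cell /= hj.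
have mcell j : measurable (cell j) by rewrite cellE; exact: measurable_itv.
rewrite -cov ge0_integral_bigcup//; last 3 first.
- by rewrite cov.
- by move=> x _; rewrite lee_fin.
- move=> i j _ _ [x [/eqP xi /eqP xj]].
  by apply: zenum_inj; rewrite -xi xj.
rewrite integral_nneseries//; last 2 first.
- move=> j; apply/measurable_EFinP; apply: measurable_funTS; apply: continuous_measurable_fun.
  move=> x; apply: continuous_comp; last exact: cF.
  by apply: cvgD; [exact: cvg_cst|exact: cvg_id].
- by move=> j x _; rewrite lee_fin.
apply: eq_eseriesr => j _.
set c := (zenum j)%:~R * h.
rewrite cellE -/c integral_itv_bndo_bndc; last exact: measurable_funTS.
have dc (x : R) : is_derive x 1 (fun y : R => y + c) 1.
  by apply: is_derive_eq; rewrite addr0.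
have dc1 : (fun y : R => y + c)^`()%classic = cst 1.
  by apply/funext => x; rewrite derive1E; have [_ ->] := dc x.
have cc : continuous (fun y : R => y + c).
  by move=> x; apply: cvgD; [exact: cvg_id|exact: cvg_cst].
have := @integration_by_substitution_increasing R (fun y : R => y + c) F 0 h (ltW h0).
rewrite add0r [h + c]addrC => ->.
- apply: eq_integral => x _; rewrite dc1 /= mulr1 /= [x + c]addrC //.
- by move=> x y _ _; rewrite ltrD2r.
- by rewrite dc1 => x _; exact: cvg_cst.
- by rewrite dc1; exact: is_cvg_cst.
- by rewrite dc1; exact: is_cvg_cst.
- split.
  + by move=> x _; have [] := dc x.
  + by apply: cvg_at_right_filter; exact: cc.
  + by apply: cvg_at_left_filter; exact: cc.
- exact: continuous_subspaceT.
Qed.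

Lemma plancherel_ereal f : cL2 f -> suppin a f ->
  (\int[mu]_x (sqn (hat f x))%:E = (2 * pi * dot f f)%:E)%E.
Proof.
move=> cf f0.
rewrite (ge0_integral_periodize (continuous_sqn_hat cf f0)); last by move=> x; exact: sqn_ge0.
(* Parseval for the modulated [f] makes the integrand constant; its value carries the factor 2 a,
   and the length pi / a of the interval turns this into 2 pi. *)
transitivity (\int[mu]_(x in `[0%R, h]) (2 * a * dot f f)%:E)%E.
  apply: eq_integral => x _.
  pose g := fun xi => f xi * cis (- (xi * x)).
  have gE : g = (fun xi => f xi * cis (- x * xi)).
    by apply/funext => xi; rewrite /g mulNr mulrC [x * _]mulrC mulrC.
  have cg : cL2 g by rewrite gE; exact: cL2_cis.
  have g0 : suppin a g by move=> y /f0; rewrite /g => ->; rewrite mul0r.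
  have := parseval_hat cg g0.
  rewrite [in X in _ --> X]gE dot_modulate => pg.
  apply/cvg_lim => //; apply: cvg_EFin; first by apply: nearW => n; rewrite sumEFin.
  apply: cvg_trans pg; apply: near_eq_cvg; apply: nearW => n /=.
  rewrite sumEFin /= big_mkord; apply: eq_bigr => i _.
  by rewrite hat_shift addrC.
rewrite integral_cst//= lebesgue_measure_itv/= lte_fin h0 -EFinM subr0 /h; congr EFin.
by field; rewrite gt_eqF.
Qed.

Lemma cL2_hat f : cL2 f -> suppin a f -> cL2 (hat f).
Proof.
move=> cf f0.
have mr : measurable_fun setT (fun x => complex.Re (hat f x)).
  by apply: continuous_measurable_fun; exact: continuous_Re_hat.
have mi : measurable_fun setT (fun x => complex.Im (hat f x)).
  by apply: continuous_measurable_fun; exact: continuous_Im_hat.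
have fin : (\int[mu]_x (sqn (hat f x))%:E < +oo)%E by rewrite plancherel_ereal// ltry.
have ms : measurable_fun setT (fun x => (sqn (hat f x))%:E).
  by apply/measurable_EFinP/measurable_funD; exact: measurable_funX.
split; apply: sqintP => //; apply: le_lt_trans fin; apply: ge0_le_integral => //.
- by move=> x _; rewrite lee_fin sqr_ge0.
- exact/measurable_EFinP/measurable_funX.
- by move=> x _; rewrite lee_fin lerDl sqr_ge0.
- by move=> x _; rewrite lee_fin sqr_ge0.
- exact/measurable_EFinP/measurable_funX.
- by move=> x _; rewrite lee_fin lerDr sqr_ge0.
Qed.

Lemma plancherel f : cL2 f -> suppin a f -> dot (hat f) (hat f) = 2 * pi * dot f f.
Proof.
move=> cf f0; apply: EFin_inj.
by rewrite dotE ?plancherel_ereal//; exact: cL2_hat.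
Qed.

Lemma plancherel_dot f g : cL2 f -> suppin a f -> cL2 g -> suppin a g ->
  dot (hat f) (hat g) = 2 * pi * dot f g.
Proof.
move=> cf f0 cg g0.
have cfg : cL2 (fun x => f x + g x) by exact: cL2D.
have fg0 : suppin a (fun x => f x + g x) by move=> x xa; rewrite f0// g0// addr0.
have := plancherel cfg fg0.
have -> : hat (fun x => f x + g x) = (fun x => hat f x + hat g x).
  by apply/funext => x; rewrite hatD.
have chf := cL2_hat cf f0; have chg := cL2_hat cg g0.
rewrite !dotDl ?dotDr//; [|exact: cL2D..].
by rewrite !plancherel// (dotC mu (hat g) (hat f)) (dotC mu g f); lra.
Qed.

End Support.

End FourierCompact.

(** * The Paley-Wiener space *)

Section L2Bridge.
Local Open Scope complex_scope.
Variable R : realType.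
Notation mu := (@lebesgue_measure R).
Notation dot := (dot mu).
Notation cL2 := (cL2 mu).
Implicit Types (f g : R -> R[i]) (x y w : R).

Lemma normc_sqr (z : R[i]) : ComplexField.Normc.normc z ^+ 2 = sqn z.
Proof. by case: z => p q; rewrite /= sqr_sqrtr// addr_ge0 ?sqr_ge0. Qed.

Lemma normc_ge0 (z : R[i]) : 0 <= ComplexField.Normc.normc z.
Proof. by case: z => p q; rewrite /= sqrtr_ge0. Qed.

Lemma L2norm_int f : L2norm f = ((\int[mu]_x (sqn (f x))%:E) `^ 2^-1)%E.
Proof.
rewrite /L2norm unlock; congr (_ `^ _)%E; apply: eq_integral => x _.
by rewrite abse_EFin ger0_norm ?normc_ge0// poweR_EFin powR_mulrn ?normc_ge0// normc_sqr.
Qed.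

Lemma L2normE f : cL2 f -> L2norm f = (Num.sqrt (dot f f))%:E.
Proof.
by move=> cf; rewrite L2norm_int -dotE// poweR_EFin powR12_sqrt// dot_ge0.
Qed.

Lemma L2P f : L2 f <-> cL2 f.
Proof.
split=> [[mr mi]|cf]; last first.
  by split; [exact: cf.1.1|exact: cf.2.1|rewrite L2normE// ltry].
rewrite L2norm_int => /lty_poweRy fin.
have {}fin : (\int[mu]_x (sqn (f x))%:E < +oo)%E by apply: fin; rewrite invr_neq0.
have ms : measurable_fun setT (fun x => (sqn (f x))%:E).
  by apply/measurable_EFinP/measurable_funD; exact: measurable_funX.
split; apply: sqintP => //; apply: le_lt_trans fin; apply: ge0_le_integral => //.
- by move=> x _; rewrite lee_fin sqr_ge0.
- exact/measurable_EFinP/measurable_funX.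
- by move=> x _; rewrite lee_fin lerDl sqr_ge0.
- by move=> x _; rewrite lee_fin sqr_ge0.
- exact/measurable_EFinP/measurable_funX.
- by move=> x _; rewrite lee_fin lerDr sqr_ge0.
Qed.

Lemma L2norm_cvg0 (w_ : nat -> R -> R[i]) : (forall n, cL2 (w_ n)) ->
  ((fun n => L2norm (w_ n)) @ \oo --> 0%E) <-> ((fun n => dot (w_ n) (w_ n)) @ \oo --> 0).
Proof.
move=> cw; have -> : (fun n => L2norm (w_ n)) = EFin \o (fun n => Num.sqrt (dot (w_ n) (w_ n))).
  by apply/funext => n /=; rewrite L2normE.
split=> [/fine_cvgP[_ /= h]|h].
  have -> : (fun n => dot (w_ n) (w_ n)) =
      (fun n => Num.sqrt (dot (w_ n) (w_ n)) * Num.sqrt (dot (w_ n) (w_ n))).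
    by apply/funext => n; rewrite -expr2 sqr_sqrtr// dot_ge0.
  by rewrite -[X in _ --> X](mul0r 0); apply: cvgM.
apply: cvg_EFin; first exact: nearW.
rewrite -[X in _ --> X](sqrtr0 R).
by apply: (@cvg_comp _ _ _ (fun n => dot (w_ n) (w_ n)) Num.sqrt _ _ _ h); exact: sqrt_continuous.
Qed.

Lemma innerE f g : inner f g = dot f g +i* dot f (fun x => 'i * g x).
Proof.
apply: complex_eq; rewrite /inner /Cintegral /=.
  by apply: eq_Rintegral => x _; rewrite !complex_partsE; ring.
by rewrite dotiE; apply: eq_Rintegral => x _; rewrite !complex_partsE; ring.
Qed.

Lemma dot_i_l f g : cL2 f -> cL2 g -> dot (fun x => 'i * f x) g = - dot f (fun x => 'i * g x).
Proof.
move=> cf cg; rewrite -dotNl//; last exact: cL2M.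
by apply: eq_Rintegral => x _; rewrite !complex_partsE/=; ring.
Qed.

Definition trunc (N : R) f : R -> R[i] := fun x => if x \in `[- N, N] then f x else 0.

Lemma suppin_trunc N f : suppin N (trunc N f).
Proof. by move=> x /negPf xN; rewrite /trunc xN. Qed.

Lemma truncE N f x : trunc N f x = f x * (\1_(`[- N, N]%classic : set R) x)%:C.
Proof. by rewrite /trunc indicE mem_setE; case: (x \in _); rewrite ?mulr1// mulr0. Qed.

Lemma truncB N f g : trunc N (fun x => f x - g x) = (fun x => trunc N f x - trunc N g x).
Proof. by apply/funext => x; rewrite /trunc; case: ifP => // _; rewrite subr0. Qed.

Lemma cL2_trunc N f : cL2 f -> cL2 (trunc N f).
Proof.
move=> cf; rewrite (funext (truncE N f)); apply: cL2bM => //=.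
- exact: measurable_indic.
- by move=> x; rewrite /sqn/= expr0n addr0 indicE; case: (_ \in _); rewrite ?expr1n ?expr0n ?ler01.
Qed.

Lemma dot_trunc N f g : dot (trunc N f) g = dot (trunc N f) (trunc N g).
Proof.
apply: eq_Rintegral => x _; rewrite /trunc; case: ifP => // _.
by rewrite !mul0r.
Qed.

Lemma dot_trunc_cvg f : cL2 f ->
  (fun n : nat => dot (trunc n%:R f) (trunc n%:R f)) @ \oo --> dot f f.
Proof.
move=> cf.
have ms h : cL2 h -> measurable_fun setT (fun x => (sqn (h x))%:E).
  by move=> ch; apply/measurable_EFinP/measurable_funD; apply: measurable_funX; [exact: ch.1.1|exact: ch.2.1].
have ifin : mu.-integrable setT (fun x => (sqn (f x))%:E).
  apply/integrableP; split; first exact: ms.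
  under eq_integral do rewrite abse_EFin ger0_norm ?sqn_ge0//.
  by rewrite -dotE// ltry.
suff : (fun n : nat => (dot (trunc n%:R f) (trunc n%:R f))%:E) @ \oo --> (dot f f)%:E.
  by move=> /fine_cvgP[].
have -> : (fun n : nat => (dot (trunc n%:R f) (trunc n%:R f))%:E) =
    (fun n : nat => \int[mu]_x (sqn (trunc n%:R f x))%:E)%E.
  by apply/funext => n; rewrite dotE//; exact: cL2_trunc.
rewrite dotE//.
apply: (@dominated_cvg _ _ _ mu _ _ (fun n x => (sqn (trunc n%:R f x))%:E) _ (fun x => (sqn (f x))%:E)) => //.
- by move=> n; apply: ms; exact: cL2_trunc.
- move=> x _; apply: cvg_near_cst.
  exists (Num.bound `|x|) => // n /= xn.
  have xb : `|x| < n%:R.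
    by apply: lt_le_trans (archi_boundP (normr_ge0 x)) _; rewrite ler_nat; exact: xn.
  by rewrite /trunc in_itv/= -ler_norml (ltW xb).
- move=> n x _; rewrite abse_EFin lee_fin ger0_norm ?sqn_ge0// /trunc.
  by case: ifP => // _; rewrite /sqn/= expr0n addr0 addr_ge0 ?sqr_ge0.
Qed.

(** The inverse transform written through [hat] by conjugation, so that Plancherel carries over. *)
Definition ihat f x : R[i] := ((2 * pi)^-1)%:C * conjc (hat (fun y => conjc (f y)) x).

Lemma Cintegral_ihat (a N : R) f x : cL2 f ->
  ((2 * pi)^-1)%:C * Cintegral `[- N, N] (fun xi => f xi * cis (xi * x)) = ihat (trunc N f) x.
Proof.
move=> cf; congr (_ * _).
have ct := cL2J (cL2_trunc N cf).
have st : suppin N (fun y => conjc (trunc N f y)).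
  by move=> y /suppin_trunc ->; exact: conjc0.
have i2 : mu.-integrable setT (EFin \o (fun xi => complex.Im (conjc (trunc N f xi) * cis (- (xi * x))))).
  apply: (@sqint_supp_integrable _ N) => [|y /st ->]; last by rewrite mul0r.
  have := (cL2_cis (- x) ct).2; have -> // : (fun xi => complex.Im (conjc (trunc N f xi) * cis (- x * xi))) =
    (fun xi => complex.Im (conjc (trunc N f xi) * cis (- (xi * x)))).
  by apply/funext => xi; rewrite mulNr mulrC [x * _]mulrC mulrC.
apply: complex_eq; rewrite !complex_partsE /hat /Cintegral /=.
  rewrite Rintegral_mkcond; apply: eq_Rintegral => y _.
  rewrite patchE mem_setE /trunc; case: ifP => _; last by rewrite conjc0 mul0r.
  by rewrite !complex_partsE/= cosN sinN; ring.
rewrite -[RHS]mulN1r -RintegralZl// [LHS]Rintegral_mkcond; apply: eq_Rintegral => y _.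
rewrite patchE mem_setE /trunc; case: ifP => _; last by rewrite conjc0 mul0r mulr0.
by rewrite !complex_partsE/= cosN sinN; ring.
Qed.

Lemma dotJ f g : dot (fun x => conjc (f x)) (fun x => conjc (g x)) = dot f g.
Proof. by apply: eq_Rintegral => x _; rewrite !complex_partsE; ring. Qed.

Lemma suppinJ a f : suppin a f -> suppin a (fun x => conjc (f x)).
Proof. by move=> fa x /fa ->; exact: conjc0. Qed.

Lemma cL2_ihat a f : 0 < a -> cL2 f -> suppin a f -> cL2 (ihat f).
Proof.
by move=> a0 cf fa; apply: cL2M; apply: cL2J; apply: (cL2_hat a0); [exact: cL2J|exact: suppinJ].
Qed.

Lemma dot_ihat a f : 0 < a -> cL2 f -> suppin a f -> dot (ihat f) (ihat f) = (2 * pi)^-1 * dot f f.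
Proof.
move=> a0 cf fa.
have ch : cL2 (fun x => conjc (hat (fun y => conjc (f y)) x)).
  by apply: cL2J; apply: (cL2_hat a0); [exact: cL2J|exact: suppinJ].
have p0 : 2 * pi != 0 :> R by rewrite mulf_neq0// gt_eqF// pi_gt0.
rewrite /ihat dotZl//; last exact: cL2M.
have h1 := plancherel a0 (cL2J cf) (suppinJ fa).
have h2 := dotJ f f.
have h3 := dotJ (hat (fun y => conjc (f y))) (hat (fun y => conjc (f y))).
by rewrite dotZr// h3 h1 h2 mulKf.
Qed.

Lemma ihatB a f g x : 0 < a -> cL2 f -> suppin a f -> cL2 g -> suppin a g ->
  ihat (fun y => f y - g y) x = ihat f x - ihat g x.
Proof.
move=> a0 cf fa cg ga; rewrite /ihat -mulrBr -rmorphB; congr (_ * conjc _).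
have -> : (fun y => conjc (f y - g y)) = (fun y => conjc (f y) + (-1) * conjc (g y)).
  by apply/funext => y; rewrite mulN1r -rmorphB.
have c1 : cL2 (fun y => (-1) * conjc (g y)) by apply: cL2M; exact: cL2J.
have s1 : suppin a (fun y => (-1) * conjc (g y)) by move=> y /ga ->; rewrite conjc0 mulr0.
by rewrite (hatD a0 _ (cL2J cf) (suppinJ fa) c1 s1) (hatM _ (-1) (cL2J cg) (suppinJ ga)) mulN1r.
Qed.

Let tc (r : R -> R) x := \int[mu]_xi (r xi * cos (xi * x)).
Let ts (r : R -> R) x := \int[mu]_xi (r xi * sin (xi * x)).

Let measurable_cos_mul x : measurable_fun setT (fun xi : R => cos (xi * x)).
Proof. by have := measurable_cos_affine x 0; under eq_fun do rewrite addr0 mulrC. Qed.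

Let measurable_sin_mul x : measurable_fun setT (fun xi : R => sin (xi * x)).
Proof. by have := measurable_sin_affine x 0; under eq_fun do rewrite addr0 mulrC. Qed.

Let intg_bM (p b : R -> R) (M : R) : mu.-integrable setT (EFin \o p) -> measurable_fun setT b ->
  (forall x, `|b x| <= M) -> mu.-integrable setT (EFin \o (fun x => p x * b x)).
Proof.
move=> ip mb bM; apply: (le_integrable measurableT _ _ (intgZ measurableT M ip)).
  apply/measurable_EFinP; apply: measurable_funM => //.
  by apply/measurable_EFinP; exact: measurable_int ip.
move=> x _ /=; rewrite lee_fin !normrM mulrC ler_wpM2r//.
exact: le_trans (bM x) (ler_norm _).
Qed.

Let intg_cos p x : mu.-integrable setT (EFin \o p) ->
  mu.-integrable setT (EFin \o (fun xi => p xi * cos (xi * x))).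
Proof. by move=> ip; apply: (intg_bM ip (measurable_cos_mul x)) => y; exact: cos_max. Qed.

Let intg_sin p x : mu.-integrable setT (EFin \o p) ->
  mu.-integrable setT (EFin \o (fun xi => p xi * sin (xi * x))).
Proof. by move=> ip; apply: (intg_bM ip (measurable_sin_mul x)) => y; exact: sin_max. Qed.

Let intg0 : mu.-integrable setT (EFin \o (fun=> 0 : R)).
Proof. exact: integrable0. Qed.

Let intg_tc p r : mu.-integrable setT (EFin \o p) -> mu.-integrable setT (EFin \o r) ->
  mu.-integrable setT (EFin \o (fun x => p x * tc r x)).
Proof.
move=> ip ir; apply: (@intg_bM _ _ (\int[mu]_x `|r x|)) => //.
  apply: continuous_measurable_fun; have := continuous_transform ir intg0.
  suff -> : tc r = (fun x => \int[mu]_xi (r xi * cos (xi * x) + 0 * sin (xi * x))) by [].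
  by apply/funext => x; apply: eq_Rintegral => xi _; rewrite mul0r addr0.
move=> x; apply: le_trans (le_normr_Rintegral _ (intg_cos _ ir)) _ => //.
apply: le_Rintegral => //; [exact: intg_norm (intg_cos _ ir)|exact: intg_norm|].
by move=> y _; rewrite normrM ler_piMr// cos_max.
Qed.

Let intg_ts p r : mu.-integrable setT (EFin \o p) -> mu.-integrable setT (EFin \o r) ->
  mu.-integrable setT (EFin \o (fun x => p x * ts r x)).
Proof.
move=> ip ir; apply: (@intg_bM _ _ (\int[mu]_x `|r x|)) => //.
  apply: continuous_measurable_fun; have := continuous_transform intg0 ir.
  suff -> : ts r = (fun x => \int[mu]_xi (0 * cos (xi * x) + r xi * sin (xi * x))) by [].
  by apply/funext => x; apply: eq_Rintegral => xi _; rewrite mul0r add0r.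
move=> x; apply: le_trans (le_normr_Rintegral _ (intg_sin _ ir)) _ => //.
apply: le_Rintegral => //; [exact: intg_norm (intg_sin _ ir)|exact: intg_norm|].
by move=> y _; rewrite normrM ler_piMr// sin_max.
Qed.

Let Fubini_cos p r : mu.-integrable setT (EFin \o p) -> mu.-integrable setT (EFin \o r) ->
  \int[mu]_x (p x * tc r x) = \int[mu]_y (r y * tc p y).
Proof.
move=> ip ir; rewrite /tc.
have := @Fubini_kernel _ p r (fun z => cos (z.2 * z.1)) ip ir.
move=> /= ->.
- by apply: eq_Rintegral => y _; congr (_ * _); apply: eq_Rintegral => x _; rewrite mulrC [y * x]mulrC mulrC.
- apply: measurableT_comp; first by apply: continuous_measurable_fun; exact: continuous_cos.
  by apply: measurable_funM; [exact: measurable_snd|exact: measurable_fst].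
- by move=> z; exact: cos_max.
Qed.

Let Fubini_sin p r : mu.-integrable setT (EFin \o p) -> mu.-integrable setT (EFin \o r) ->
  \int[mu]_x (p x * ts r x) = \int[mu]_y (r y * ts p y).
Proof.
move=> ip ir; rewrite /ts.
have := @Fubini_kernel _ p r (fun z => sin (z.2 * z.1)) ip ir.
move=> /= ->.
- by apply: eq_Rintegral => y _; congr (_ * _); apply: eq_Rintegral => x _; rewrite mulrC [y * x]mulrC mulrC.
- apply: measurableT_comp; first by apply: continuous_measurable_fun; exact: continuous_sin.
  by apply: measurable_funM; [exact: measurable_snd|exact: measurable_fst].
- by move=> z; exact: sin_max.
Qed.

Let hat_parts a f x : cL2 f -> suppin a f ->
  complex.Re (hat f x) = tc (fun y => complex.Re (f y)) x + ts (fun y => complex.Im (f y)) x /\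
  complex.Im (hat f x) = tc (fun y => complex.Im (f y)) x - ts (fun y => complex.Re (f y)) x.
Proof.
move=> cf fa; have [iu iv] := cL2_L1 cf fa; rewrite /tc /ts; split.
  rewrite -RintegralD//; [|exact: intg_cos|exact: intg_sin].
  by apply: eq_Rintegral => y _; rewrite !complex_partsE/= cosN sinN; ring.
rewrite -RintegralB//; [|exact: intg_cos|exact: intg_sin].
by apply: eq_Rintegral => y _; rewrite !complex_partsE/= cosN sinN; ring.
Qed.

(** Up to the factor [(2 * pi)^-1], [ihat] is the adjoint of [hat]: after splitting into cosine and
    sine transforms each term is one Fubini exchange. *)
Lemma dot_ihat_hat a f g : 0 < a -> cL2 f -> suppin a f -> cL2 g -> suppin a g ->
  dot (ihat f) g = (2 * pi)^-1 * dot f (hat g).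
Proof.
move=> a0 cf fa cg ga.
have [iA iB] := cL2_L1 cf fa; have [iu iv] := cL2_L1 cg ga.
have cJ := cL2J cf; have sJ := suppinJ fa.
rewrite /ihat dotZl//; last by apply: cL2J; exact: (cL2_hat a0).
congr (_ * _).
pose A x := complex.Re (f x); pose B x := complex.Im (f x).
pose u x := complex.Re (g x); pose v x := complex.Im (g x).
have tcN r x : mu.-integrable setT (EFin \o r) -> tc (fun y => - r y) x = - tc r x.
  move=> ir; rewrite /tc -[RHS]mulN1r -RintegralZl//; last exact: intg_cos.
  by apply: eq_Rintegral => y _; rewrite mulN1r mulNr.
have tsN r x : mu.-integrable setT (EFin \o r) -> ts (fun y => - r y) x = - ts r x.
  move=> ir; rewrite /ts -[RHS]mulN1r -RintegralZl//; last exact: intg_sin.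
  by apply: eq_Rintegral => y _; rewrite mulN1r mulNr.
have E1 x : complex.Re (conjc (hat (fun y => conjc (f y)) x)) = tc A x - ts B x.
  rewrite cReJ; have [-> _] := hat_parts x cJ sJ.
  by under [X in tc X]eq_fun do rewrite cReJ; under [X in ts X]eq_fun do rewrite cImJ; rewrite tsN.
have E2 x : complex.Im (conjc (hat (fun y => conjc (f y)) x)) = tc B x + ts A x.
  rewrite cImJ; have [_ ->] := hat_parts x cJ sJ.
  by under [X in tc X]eq_fun do rewrite cImJ; under [X in ts X]eq_fun do rewrite cReJ; rewrite tcN// opprD !opprK.
transitivity (\int[mu]_x ((u x * tc A x - u x * ts B x) + (v x * tc B x + v x * ts A x))).
  by apply: eq_Rintegral => x _; rewrite E1 E2 /u /v; ring.
rewrite RintegralD//; last 2 first.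
- by apply: intgB => //; [exact: intg_tc|exact: intg_ts].
- by apply: intgD => //; [exact: intg_tc|exact: intg_ts].
rewrite RintegralB//; [|exact: intg_tc|exact: intg_ts].
rewrite RintegralD//; [|exact: intg_tc|exact: intg_ts].
rewrite (Fubini_cos iu iA) (Fubini_sin iu iB) (Fubini_cos iv iB) (Fubini_sin iv iA).
transitivity (\int[mu]_x ((A x * tc u x + A x * ts v x) + (B x * tc v x - B x * ts u x))); last first.
  by apply: eq_Rintegral => x _; have [-> ->] := hat_parts x cg ga; rewrite /A /B; ring.
rewrite RintegralD//; last 2 first.
- by apply: intgD => //; [exact: intg_tc|exact: intg_ts].
- by apply: intgB => //; [exact: intg_tc|exact: intg_ts].
rewrite RintegralD//; [|exact: intg_tc|exact: intg_ts].
rewrite RintegralB//; [|exact: intg_tc|exact: intg_ts].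
have E (p q r s : R) : p - q + (r + s) = p + s + (r - q) by ring.
exact: E.
Qed.

(** Adjointness and Plancherel turn the squared distance into [dot g g] minus [(2 * pi)^-1] times
    the squared norm of [hat g] on [-N, N], which tends to 0 by Plancherel again. *)
Lemma is_inv_fourier_hat a g : 0 < a -> cL2 g -> suppin a g -> is_inv_fourier (hat g) g.
Proof.
move=> a0 cg ga; split; first exact/L2P.
have ch := cL2_hat a0 cg ga.
have p0 : 2 * pi != 0 :> R by rewrite mulf_neq0// gt_eqF// pi_gt0.
pose w (N : nat) x := ihat (trunc N%:R (hat g)) x - g x.
have -> : (fun N : nat => L2norm (fun x => ((2 * pi)^-1)%:C *
       Cintegral `[- N%:R, N%:R] (fun xi => hat g xi * cis (xi * x)) - g x)) = (fun N => L2norm (w N)).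
  by apply/funext => N; congr L2norm; apply/funext => x; rewrite Cintegral_ihat.
have big (N : nat) : exists b, [/\ 0 < b, suppin b (trunc N%:R (hat g)) & suppin b g].
  exists (N%:R + a); split; first by rewrite ltr_wpDl.
    by apply: (@suppin_le _ N%:R); [rewrite lerDl ltW|exact: suppin_trunc].
  by apply: (@suppin_le _ a) => //; rewrite lerDr.
have ct (N : nat) : cL2 (trunc N%:R (hat g)) by exact: cL2_trunc.
have ci (N : nat) : cL2 (ihat (trunc N%:R (hat g))).
  by have [b [b0 sb _]] := big N; exact: (cL2_ihat b0).
apply/L2norm_cvg0; first by move=> n; apply: cL2B.
have E (N : nat) : dot (w N) (w N) = dot g g - (2 * pi)^-1 * dot (trunc N%:R (hat g)) (trunc N%:R (hat g)).
  have [b [b0 sb gb]] := big N.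
  rewrite /w dotBl//; last exact: cL2B.
  rewrite !dotBr// (dot_ihat b0)// (dotC mu g (ihat _)) (dot_ihat_hat b0)// (dot_trunc N%:R (hat g) (hat g)); ring.
under eq_fun do rewrite E.
have -> : 0 = dot g g - (2 * pi)^-1 * (2 * pi * dot g g) by rewrite mulKf// subrr.
apply: cvgB; first exact: cvg_cst.
apply: cvgM; first exact: cvg_cst.
by rewrite -(plancherel a0)//; exact: dot_trunc_cvg.
Qed.

Lemma suppin_supp a g : (forall x, x \notin `[- a, a] -> g x = 0) -> supp g `<=` `[- a, a].
Proof.
move=> ga x sx; apply: contrapT => xa; apply: sx.
exists (~` `[- a, a]%classic) => //=; split.
  by apply: closed_openC; exact: interval_closed.
by apply: aeW => y /= /negP /ga.
Qed.

Lemma continuous_complex f : continuous (fun x => complex.Re (f x)) ->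
  continuous (fun x => complex.Im (f x)) -> continuous (f : R -> R[i]^o).
Proof.
move=> cr ci x; apply/(@cvgrPdist_lt R[i] R[i]^o) => -[e e'].
rewrite ltcE/= => /andP[/eqP -> e0].
have e20 : 0 < e / 2 by rewrite divr_gt0.
have hr := (@cvgrPdist_lt R R^o _ _ _ _ _).1 (cr x) _ e20.
have hi := (@cvgrPdist_lt R R^o _ _ _ _ _).1 (ci x) _ e20.
have {}hr := hr (nbhs_filter x); have {}hi := hi (nbhs_filter x).
near=> y.
have h1 : `|complex.Re (f x) - complex.Re (f y)| < e / 2 by near: y.
have h2 : `|complex.Im (f x) - complex.Im (f y)| < e / 2 by near: y.
rewrite normc_def ltcE/= eqxx/= !complex_partsE.
set p := _ - _ in h1 *; set q := _ - _ in h2 *.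
rewrite -[ltRHS]gtr0_norm// -sqrtr_sqr ltr_sqrt ?exprn_gt0//.
rewrite -(real_normK (num_real p)) -(real_normK (num_real q)).
have := normr_ge0 p; have := normr_ge0 q; nra.
Unshelve. all: by end_near.
Qed.

Lemma PW_hat g : cL2 g -> suppin pi g -> PW (hat g).
Proof.
move=> cg g0; have p0 := pi_gt0 R; split.
- by apply/L2P; exact: (cL2_hat p0).
- by apply: continuous_complex; [exact: continuous_Re_hat cg g0|exact: continuous_Im_hat cg g0].
- by exists g; [exact: (is_inv_fourier_hat p0)|exact: suppin_supp].
Qed.

Lemma dot_ae0 f : cL2 f -> {ae mu, forall x, f x = 0} -> dot f f = 0.
Proof.
move=> cf f0; rewrite (ae_eq_dotl f0)//; last exact: cL20.
by rewrite /dot; under eq_Rintegral do rewrite !mul0r addr0; rewrite Rintegral_cst// mul0r.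
Qed.

(** Intervals with rational endpoints reduce the union of open null sets to a countable one. *)
Lemma supp_ae0 g (D : set R) : supp g `<=` D -> {ae mu, forall x, ~ D x -> g x = 0}.
Proof.
move=> gD.
pose P (pq : rat * rat) := ae_eq mu `]ratr pq.1, ratr pq.2[%classic g (cst 0).
pose F n : set R := if unpickle n is Some pq then
  [set x | P pq /\ `]ratr pq.1, ratr pq.2[%classic x /\ g x <> 0] else set0.
have nF n : mu.-negligible (F n).
  rewrite /F; case: (unpickle n) => [pq|]; last exact: negligible_set0.
  have [Ppq|nP] := pselect (P pq); last first.
    by apply: (negligibleS _ (negligible_set0 _)) => x [].
  by apply: negligibleS Ppq => x /= [_ [xI gx0]] h; apply: gx0; exact: h.
apply: negligibleS (negligible_bigcup nF) => x /= h.
have [nDx gx0] : ~ D x /\ g x <> 0.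
  by split=> [Dx|gx]; apply: h.
have : ~ supp g x by move=> /gD.
rewrite /supp /setC /= => /contrapT[U [oU Uae] Ux].
have [e /= e0 eU] := (@nbhs_ballP _ _ x U).1 (open_nbhs_nbhs (conj oU Ux)).
have /rat_in_itvoo[p pI] : x - e < x by rewrite gtrBl.
have /rat_in_itvoo[q qI] : x < x + e by rewrite ltrDl.
move: pI qI; rewrite !in_itv/= => /andP[p1 p2] /andP[q1 q2].
exists (pickle (p, q)); first exact: I.
rewrite /F (pickleK (p, q)); split; last first.
  by split; [rewrite /= in_itv/= p2 q1|exact: gx0].
apply: filterS Uae => y Uy /=; rewrite in_itv/= => /andP[py yq]; apply: Uy.
by apply: eU; rewrite /ball/= ltr_distl; apply/andP; split; lra.
Qed.

Lemma continuous_ae0 (u : R -> R) : continuous u -> {ae mu, forall x, u x = 0} -> forall x, u x = 0.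
Proof.
move=> cu [Z [mZ Z0 uZ]] x; apply: contrapT => /eqP ux0.
have ux : 0 < `|u x| by rewrite normr_gt0.
have := (@cvgrPdist_lt R R^o _ _ _ _ _).1 (cu x) _ ux => /(_ _)[e /= e0 he].
have sub : `]x - e, x + e[%classic `<=` Z.
  move=> y /=; rewrite in_itv/= => /andP[y1 y2]; apply: uZ => /= uy0.
  have : ball_ Num.norm x e y by rewrite /ball_/= ltr_distl; apply/andP; split; lra.
  by move=> /he; rewrite uy0 subr0 ltxx.
pose J : set R := `]x - e, x + e[%classic.
have : (mu J <= mu Z)%E.
  by apply: le_measure => //; rewrite inE//; exact: measurable_itv.
rewrite Z0 /J lebesgue_measure_itv/= lte_fin.
have -> : x - e < x + e by lra.
by rewrite -EFinB lee_fin; lra.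
Qed.

(** [g] is the inverse transform of [G], cut to [-pi, pi]. The truncations of [G - hat g] have
    inverse transforms tending to 0 in norm, so [G - hat g] is null, and continuity gives equality
    at every point. *)
Lemma PW_inv G : PW G -> exists g, [/\ cL2 g, suppin pi g & forall x, G x = hat g x].
Proof.
move=> [/L2P cG contG [g0 [/L2P cg0 G0] sg0]].
have p0 := pi_gt0 R.
pose g := trunc pi g0.
have cg : cL2 g by exact: cL2_trunc.
have sg : suppin pi g by exact: suppin_trunc.
have aF : Filter (almost_everywhere mu) := ae_filter_ringOfSetsType mu.
have gg0 : {ae mu, forall x, g0 x - g x = 0}.
  apply: filterS (supp_ae0 sg0) => x /= h; rewrite /g /trunc.
  by case: ifPn => [_|xI]; [rewrite subrr|rewrite h ?subr0//; exact/negP].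
exists g; split => //.
have chg := cL2_hat p0 cg sg.
have [_ hg] := is_inv_fourier_hat p0 cg sg.
pose D x := G x - hat g x.
have cD : cL2 D by exact: cL2B.
have ct f (N : nat) : cL2 f -> cL2 (trunc N%:R f) by move=> cf; exact: cL2_trunc.
have posN (N : nat) : 0 < N%:R + 1 :> R by rewrite ltr_wpDl.
have st f (N : nat) : suppin (N%:R + 1) (trunc N%:R f).
  by apply: (@suppin_le _ N%:R); [rewrite lerDl|exact: suppin_trunc].
have ci f (N : nat) : cL2 f -> cL2 (ihat (trunc N%:R f)).
  by move=> cf; apply: (cL2_ihat (posN N)) => //; exact: ct.
have E f k : cL2 f -> (fun N : nat => L2norm (fun x => ((2 * pi)^-1)%:C *
       Cintegral `[- N%:R, N%:R] (fun xi => f xi * cis (xi * x)) - k x)) =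
    (fun N => L2norm (fun x => ihat (trunc N%:R f) x - k x)).
  by move=> cf; apply/funext => N; congr L2norm; apply/funext => x; rewrite Cintegral_ihat.
rewrite E// in G0; rewrite E// in hg.
have {}G0 := (L2norm_cvg0 (fun N => cL2B (ci _ N cG) cg0)).1 G0.
have {}hg := (L2norm_cvg0 (fun N => cL2B (ci _ N chg) cg)).1 hg.
have cgg : cL2 (fun x => g0 x - g x) by exact: cL2B.
(* Two uses of [dotD2] give the constants 4 and 2; [g0 - g] is null and contributes nothing. *)
have bound (N : nat) : (2 * pi)^-1 * dot (trunc N%:R D) (trunc N%:R D) <=
   4 * dot (fun x => ihat (trunc N%:R G) x - g0 x) (fun x => ihat (trunc N%:R G) x - g0 x) +
   2 * dot (fun x => ihat (trunc N%:R (hat g)) x - g x) (fun x => ihat (trunc N%:R (hat g)) x - g x).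
  rewrite -(dot_ihat (posN N))//; last exact: ct.
  have -> : ihat (trunc N%:R D) = (fun x => ((ihat (trunc N%:R G) x - g0 x) + (g0 x - g x)) +
      - (ihat (trunc N%:R (hat g)) x - g x)).
    apply/funext => x; transitivity (ihat (trunc N%:R G) x - ihat (trunc N%:R (hat g)) x); last by ring.
    rewrite -(ihatB _ (posN N))//; [|exact: ct|exact: ct].
    by rewrite (truncB N%:R G (hat g) : trunc N%:R D = _).
  have c1 : cL2 (fun x => ihat (trunc N%:R G) x - g0 x) by apply: cL2B => //; exact: ci.
  have c2 : cL2 (fun x => ihat (trunc N%:R (hat g)) x - g x) by apply: cL2B => //; exact: ci.
  apply: le_trans (dotD2 (cL2D c1 cgg) (cL2N c2)) _.
  rewrite [dot (fun x => - _) _]dotNl//; last exact: cL2N.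
  rewrite [dot _ (fun x => - _)]dotC dotNl// opprK.
  have := dotD2 c1 cgg; rewrite (dot_ae0 cgg gg0); lra.
have D0 : dot D D = 0.
  have lim0 : (fun N : nat => (2 * pi)^-1 * dot (trunc N%:R D) (trunc N%:R D)) @ \oo --> 0.
    apply: (@squeeze_cvgr _ _ _ _ (cst 0) (fun N : nat =>
       4 * dot (fun x => ihat (trunc N%:R G) x - g0 x) (fun x => ihat (trunc N%:R G) x - g0 x) +
   2 * dot (fun x => ihat (trunc N%:R (hat g)) x - g x) (fun x => ihat (trunc N%:R (hat g)) x - g x))).
    - apply: nearW => N; rewrite bound andbT.
      by rewrite mulr_ge0 ?dot_ge0// invr_ge0 mulr_ge0// ltW.
    - exact: cvg_cst.
    - have -> : 0 = 4 * 0 + 2 * 0 :> R by rewrite !mulr0 addr0.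
      by apply: cvgD; apply: cvgM => //; exact: cvg_cst.
  have : (fun N : nat => (2 * pi)^-1 * dot (trunc N%:R D) (trunc N%:R D)) @ \oo --> (2 * pi)^-1 * dot D D.
    by apply: cvgM; [exact: cvg_cst|exact: dot_trunc_cvg].
  move=> /cvg_lim; rewrite (cvg_lim _ lim0)// => /(_ (@Rhausdorff _)) /eqP.
  by rewrite eq_sym mulf_eq0 invr_eq0 mulf_eq0 pnatr_eq0/= (gt_eqF p0)/= => /eqP.
have Dae := dot_eq0_ae cD D0.
have cReG : continuous (fun x => complex.Re (G x)) /\ continuous (fun x => complex.Im (G x)).
  split=> x; apply/(@cvgrPdist_lt R R^o) => e e0;
    have := (@cvgrPdist_lt R[i] R[i]^o _ _ _ _ _).1 (contG x) e%:C;
    rewrite ltcR => /(_ _ e0); apply: filterS => y; rewrite normc_def ltcR => /le_lt_trans; apply;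
    rewrite -sqrtr_sqr ler_wsqrtr// !complex_partsE ?lerDl ?lerDr sqr_ge0//.
have [cr ci'] := cReG.
have cr' := continuous_Re_hat cg sg; have cii := continuous_Im_hat cg sg.
move=> x; apply/eqP; rewrite -subr_eq0; apply/eqP; apply: complex_eq.
  apply: (@continuous_ae0 (fun x => complex.Re (D x))) => [y|].
    by rewrite /D; under [X in continuous_at _ X]eq_fun do rewrite cReD cReN; apply: cvgB; [exact: cr|exact: cr'].
  by apply: filterS Dae => y ->.
apply: (@continuous_ae0 (fun x => complex.Im (D x))) => [y|].
  by rewrite /D; under [X in continuous_at _ X]eq_fun do rewrite cImD cImN; apply: cvgB; [exact: ci'|exact: cii].
by apply: filterS Dae => y ->.
Qed.

Lemma hat_expw (s x : R) : hat (expw pi s) x = (Num.sqrt (2 * pi) * sinc (pi * (x - s)))%:C.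
Proof.
have p0 := pi_gt0 R.
have se : suppin pi (expw pi s) by move=> y /negPf ys; rewrite /expw ys.
rewrite (hatE p0 x (cL2_expw _ _) se) dot_expw// dot_expw_i//.
have -> : sinc ((s - x) * pi) = sinc (pi * (x - s)) :> R.
  rewrite /sinc; have -> : (s - x) * pi = - (pi * (x - s)) by ring.
  by rewrite oppr_eq0 sinN invrN mulrNN.
by apply: complex_eq; rewrite !complex_partsE/= ?mulr0.
Qed.

(** sinc is the reproducing kernel: by Plancherel the product is a coordinate of [g] along
    [expw pi s]. The conjugate appears because the transform is the second argument of [inner]. *)
Lemma inner_sinc (s : R) g : cL2 g -> suppin pi g ->
  inner (fun x => (sinc (pi * (x - s)))%:C) (hat g) = conjc (hat g s).
Proof.
move=> cg sg; have p0 := pi_gt0 R.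
have ce := @cL2_expw R pi s.
have se : suppin pi (expw pi s) by move=> y /negPf ys; rewrite /expw ys.
have q0 : 0 < 2 * pi :> R by rewrite mulr_gt0.
have sq0 : Num.sqrt (2 * pi) != 0 :> R by rewrite gt_eqF// sqrtr_gt0.
have sq2 : 2 * pi = Num.sqrt (2 * pi) * Num.sqrt (2 * pi) :> R by rewrite -expr2 sqr_sqrtr// ltW.
have -> : (fun x => (sinc (pi * (x - s)))%:C) = (fun x => ((Num.sqrt (2 * pi))^-1)%:C * hat (expw pi s) x).
  by apply/funext => x; rewrite hat_expw -rmorphM mulKf.
have ch := cL2_hat p0 ce se; have chg := cL2_hat p0 cg sg.
have cig : cL2 (fun x => 'i * g x) by exact: cL2M.
have sig : suppin pi (fun x => 'i * g x) by move=> x /sg ->; rewrite mulr0.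
rewrite innerE !dotZl//; last exact: cL2M.
have -> : (fun x => 'i * hat g x) = hat (fun x => 'i * g x).
  by apply/funext => x; rewrite (hatM _ _ cg sg).
rewrite !(plancherel_dot p0)// (hatE p0 s cg sg) dotC.
have -> : dot (expw pi s) (fun x => 'i * g x) = - dot g (fun x => 'i * expw pi s x).
  by rewrite dotC dot_i_l.
have K (z : R) : (Num.sqrt (2 * pi))^-1 * (2 * pi * z) = Num.sqrt (2 * pi) * z.
  by rewrite [X in _ * (X * _)]sq2 -!mulrA mulKf.
by apply: complex_eq; rewrite !complex_partsE/= !K ?mulrN.
Qed.

End L2Bridge.

(** * The Euler product of the sine *)

Section Wallis.
Variable R : realType.
Notation mu := (@lebesgue_measure R).
Implicit Types (x t : R).

(** Wallis integrals with a parameter; dividing by the value at [x = 0] gives the remainders of the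
    sine product. The [+ 0] matches the affine form of the cosine lemmas. *)
Definition wallis (m : nat) x : R := \int[mu]_(t in `[0, pi / 2]) (cos (2 * x * t + 0) * cos t ^+ m).

Let p2 : 0 < pi / 2 :> R. Proof. by rewrite divr_gt0// pi_gt0. Qed.

Let ccos m : continuous (fun t : R => cos t ^+ m).
Proof.
elim: m => [|m IH]; first by under eq_fun do rewrite expr0; move=> t; exact: cvg_cst.
by under eq_fun do rewrite exprS; move=> t; apply: cvgM; [exact: continuous_cos|exact: IH].
Qed.

Let cwallis x m : continuous (fun t : R => cos (2 * x * t + 0) * cos t ^+ m).
Proof. by move=> t; apply: cvgM; [exact: continuous_cos_affine|exact: ccos]. Qed.

Lemma wallis_rec m x :
  (m.+2%:R ^+ 2 - 4 * x ^+ 2) * wallis m.+2 x = m.+2%:R * m.+1%:R * wallis m x.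
Proof.
pose C t : R := cos (2 * x * t + 0); pose S t : R := sin (2 * x * t + 0).
(* Two integrations by parts collected in one antiderivative, which vanishes at 0 and at pi / 2. *)
pose F t : R := m.+2%:R * (C t * (cos t ^+ m.+1 * sin t)) - 2 * x * (S t * cos t ^+ m.+2).
pose f t : R := (m.+2%:R ^+ 2 - 4 * x ^+ 2) * (C t * cos t ^+ m.+2) - m.+2%:R * m.+1%:R * (C t * cos t ^+ m).
have dF t : is_derive t 1 F (f t).
  have dC := is_derive_cos_affine (2 * x) 0 t.
  have dS := is_derive_sin_affine (2 * x) 0 t.
  have dc n := is_derive_pow n (is_derive_cos t).
  have d1 := is_derive_mul dC (is_derive_mul (dc m) (is_derive_sin t)).
  have d2 := is_derive_mul dS (dc m.+1).
  have d3 := is_derive_mul (is_derive_cst (m.+2%:R : R) t 1) d1.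
  have d4 := is_derive_mul (is_derive_cst (2 * x : R) t 1) d2.
  have d5 := is_deriveB d3 d4.
  apply: (is_derive_eq d5).
  rewrite /f /C /S /cst/=.
  have s2 : sin t * sin t = 1 - cos t * cos t by rewrite -!expr2 sin2cos2.
  have -> : m.+2%:R = m%:R + 2 :> R by rewrite -addn2 natrD.
  have -> : m.+1%:R = m%:R + 1 :> R by rewrite -addn1 natrD.
  rewrite [cos t ^+ m.+2]exprS [cos t ^+ m.+1]exprS.
  set M : R := m%:R.
  set c := cos t in s2 *; set s := sin t in s2 *; set cm := c ^+ m.
  set Cx := cos (2 * x * t + 0); set Sx := sin (2 * x * t + 0).
  transitivity ((M + 2) * (- (2 * x * Sx) * (c * cm * s) + Cx * (c * cm * c - (M + 1) * cm * (s * s))) -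
   2 * x * (2 * x * Cx * (c * (c * cm)) - Sx * ((M + 2) * (c * cm) * s))); first by ring.
  rewrite s2; ring.
have cf : continuous f.
  move=> t; apply: cvgB; (apply: cvgM; first exact: cvg_cst); exact: cwallis.
have := Rintegral_derive p2 cf dF.
have -> : F (pi / 2) - F 0 = 0.
  by rewrite /F /S cos_pihalf !mulr0 !addr0 !sin0 !exprS; ring.
rewrite RintegralB//; last 2 first.
- by apply: cont_itv_integrable => t; apply: cvgM; [exact: cvg_cst|exact: cwallis].
- by apply: cont_itv_integrable => t; apply: cvgM; [exact: cvg_cst|exact: cwallis].
rewrite !RintegralZl//; [|exact: cont_itv_integrable (@cwallis x _)..].
by move=> /eqP; rewrite subr_eq0 => /eqP.
Qed.

Lemma wallis_gt0 m : 0 < wallis m.*2 0.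
Proof.
elim: m => [|m IH].
  rewrite /wallis; under eq_Rintegral do rewrite mulr0 mul0r add0r cos0 expr0 mulr1.
  by rewrite Rintegral_cst//= lebesgue_measure_itv/= lte_fin p2/= subr0 mul1r.
have := wallis_rec m.*2 0; rewrite expr0n/= mulr0 subr0 doubleS.
have : 0 < m.*2.+2%:R * m.*2.+1%:R * wallis m.*2 0 :> R by rewrite mulr_gt0.
by move=> h E; move: h; rewrite -E pmulr_rgt0// exprn_gt0.
Qed.

(* The tail [prod_(k > N) (1 - x^2/k^2)] of the Euler product. *)
Definition wratio (N : nat) x : R := wallis N.*2 x / wallis N.*2 0.

(** The recursion at [x] against the recursion at 0. The product form survives at the integers
    [N.+1] and [- N.+1], where the factor vanishes. *)
Lemma wratioS N x : (1 - x ^+ 2 / N.+1%:R ^+ 2) * wratio N.+1 x = wratio N x.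
Proof.
have r1 := wallis_rec N.*2 x; have r0 := wallis_rec N.*2 0.
have g0 := wallis_gt0 N; have g1 := wallis_gt0 N.+1.
rewrite /wratio; rewrite doubleS in g1 *.
move: r1 r0; rewrite expr0n/= mulr0 subr0.
have -> : N.*2.+2%:R = 2 * N.+1%:R :> R by rewrite -natrM mul2n doubleS.
set k : R := N.+1%:R; have k0 : k != 0 by rewrite pnatr_eq0.
set l : R := N.*2.+1%:R; have l0 : l != 0 by rewrite pnatr_eq0.
set a := wallis _ x; set b := wallis _ 0 in g1 *; set c := wallis _ x; set e := wallis _ 0 in g0 *.
clearbody k l; move=> r1 r0.
have cE : c = (4 * k ^+ 2 - 4 * x ^+ 2) * a / (2 * k * l).
  have -> : 4 * k ^+ 2 = (2 * k) ^+ 2 by ring.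
  by rewrite r1; field; rewrite ?k0 ?l0.
have eE : e = (4 * k ^+ 2) * b / (2 * k * l).
  have -> : 4 * k ^+ 2 = (2 * k) ^+ 2 by ring.
  by rewrite r0; field; rewrite ?k0 ?l0.
by rewrite cE eE; field; rewrite ?k0 ?l0 ?gt_eqF.
Qed.

Lemma wratio0 x : wratio 0 x = sinc (pi * x).
Proof.
have w0 : wallis 0 0 = pi / 2.
  rewrite /wallis; under eq_Rintegral do rewrite mulr0 mul0r add0r cos0 expr0 mulr1.
  by rewrite Rintegral_cst//= lebesgue_measure_itv/= lte_fin p2/= subr0 mul1r.
rewrite /wratio double0 w0 /sinc; have [->|x0] := eqVneq x 0.
  by rewrite mulr0 eqxx w0 divff// gt_eqF.
rewrite mulf_eq0 (negPf x0) (gt_eqF (pi_gt0 R))/=.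
rewrite /wallis; under eq_Rintegral do rewrite expr0 mulr1.
rewrite Rintegral_cos_affine// ?mulf_neq0// mulr0 !addr0 sin0 subr0.
have E : 2 * x * (pi / 2) = pi * x by field.
by rewrite -mulrA -invfM E.
Qed.

(** Euler's product with an explicit remainder, exact for every [N] and at every [x], integers
    included; no convergence is involved. *)
Lemma sinc_wratio N x :
  sinc (pi * x) = \prod_(1 <= k < N.+1) (1 - x ^+ 2 / k%:R ^+ 2) * wratio N x.
Proof.
elim: N => [|N IH]; first by rewrite big_geq// mul1r wratio0.
by rewrite IH [in RHS]big_nat_recr//= -mulrA wratioS.
Qed.

Lemma continuous_wratio N : continuous (wratio N).
Proof.
pose u t : R := ((fun t => cos t ^+ N.*2) \_ `[0, pi / 2]) t.
have iu : mu.-integrable setT (EFin \o u).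
  have -> : EFin \o u = (EFin \o (fun t : R => cos t ^+ N.*2)) \_ `[0, pi / 2].
    by rewrite restrict_EFin.
  by apply/(integrable_mkcond _ _).1 => //; exact: cont_itv_integrable.
have i0 : mu.-integrable setT (EFin \o (fun=> 0 : R)) by exact: integrable0.
have ct := continuous_transform iu i0.
have E x : wallis N.*2 x = \int[mu]_xi (u xi * cos (xi * (2 * x)) + 0 * sin (xi * (2 * x))).
  rewrite /wallis [LHS]Rintegral_mkcond; apply: eq_Rintegral => t _.
  rewrite /u !patchE; case: ifP => _; last by rewrite !mul0r addr0.
  by rewrite mul0r !addr0 mulrC [t * _]mulrC.
move=> x; apply: cvgM; last exact: cvg_cst.
rewrite (funext E).
have c2 : (2 * y : R) @[y --> x] --> 2 * x by apply: cvgM; [exact: cvg_cst|exact: cvg_id].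
exact: (@cvg_comp _ _ _ (fun y : R => 2 * y) (fun z => \int[mu]_xi (u xi * cos (xi * z) + 0 * sin (xi * z))) _ _ _ c2 (ct (2 * x))).
Qed.

(** The weight cos^(2N) concentrates at t = 0, where [cos (2 * x * t)] is 1. The recursion at x = 0
    measures this: the weighted mean of sin^2 is 1 / (2N + 2). *)
Lemma wratio_cvg1 x : (fun N => wratio N x) @ \oo --> (1 : R).
Proof.
apply/(@cvgrPdist_le R R^o) => eps eps0.
have e2 : 0 < eps / 2 by rewrite divr_gt0.
have c0 := @continuous_cos_affine R (2 * x) 0 0.
have := (@cvgrPdist_lt R R^o _ _ _ _ _).1 c0 _ e2 => /(_ (nbhs_filter _))[dl /= dl0 hdl].
pose de : R := Num.min dl (pi / 2).
have de0 : 0 < de by rewrite lt_min dl0 p2.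
have dep : de <= pi / 2 by rewrite /de ge_min lexx orbT.
have sd : 0 < sin de.
  apply: sin_gt0_pi; rewrite de0/=; apply: (@le_lt_trans _ _ (pi / 2)); first by rewrite ge_min lexx orbT.
  by have := pi_gt0 R; lra.
(* Beyond [de] the bound 2 for one minus the cosine is absorbed by [K * sin t ^+ 2], as sin
   increases up to pi / 2. *)
pose K := 2 / sin de ^+ 2.
have K0 : 0 <= K by rewrite divr_ge0// exprn_ge0// ltW.
have bound t : t \in `[0, pi / 2] -> 1 - cos (2 * x * t + 0) <= eps / 2 + K * sin t ^+ 2.
  rewrite in_itv/= => /andP[t0 tp]; have [tde|det] := ltP t de.
    have : ball_ Num.norm 0 dl t.
      by rewrite /ball_/= sub0r normrN ger0_norm// (lt_le_trans tde)// ge_min lexx.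
    move=> /hdl; rewrite mulr0 addr0 cos0 => h; apply: le_trans (ler_norm _) _.
    by apply: le_trans (ltW h) _; rewrite lerDl mulr_ge0// sqr_ge0.
  have st : sin de <= sin t.
    move: det; rewrite le_eqVlt => /predU1P[->//|det]; apply: ltW.
    rewrite ltr_sin// in_itv/=; apply/andP; split; have := pi_gt0 R; lra.
  apply: (@le_trans _ _ 2); first by have := cos_geN1 (2 * x * t + 0); lra.
  apply: (@le_trans _ _ (K * sin t ^+ 2)); last by rewrite lerDr ltW.
  rewrite /K mulrAC ler_pdivlMr ?exprn_gt0// ler_pM2l// ler_sqr// nnegrE; first exact: ltW.
  exact: le_trans (ltW sd) st.
have [N0 hN0] : exists N : nat, K / eps < N%:R.
  by exists (Num.bound (K / eps)); apply: archi_boundP; rewrite divr_ge0// ltW.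
exists N0 => // N /= N0N.
have w0 := wallis_gt0 N.
have iw y m : mu.-integrable `[0, pi / 2] (EFin \o (fun t : R => cos (2 * y * t + 0) * cos t ^+ m)).
  exact: cont_itv_integrable (@cwallis y m).
have -> : 1 - wratio N x = (wallis N.*2 0 - wallis N.*2 x) / wallis N.*2 0.
  by rewrite /wratio mulrBl divff// gt_eqF.
have sin2 : wallis N.*2 0 - wallis N.*2.+2 0 = wallis N.*2 0 / N.*2.+2%:R.
  have := wallis_rec N.*2 0; rewrite expr0n/= mulr0 subr0 => h.
  have h2 : N.*2.+2%:R * wallis N.*2.+2 0 = N.*2.+1%:R * wallis N.*2 0 :> R.
    by apply: (@mulfI _ (N.*2.+2%:R)); rewrite ?pnatr_eq0// mulrA -expr2 h mulrA.
  apply: (@mulfI _ (N.*2.+2%:R)); first by rewrite pnatr_eq0.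
  rewrite mulrBr h2 mulrCA divff ?pnatr_eq0// mulr1 -[N.*2.+2%:R]natr1; ring.
have E1 : wallis N.*2 0 - wallis N.*2 x =
    \int[mu]_(t in `[0, pi / 2]) ((1 - cos (2 * x * t + 0)) * cos t ^+ N.*2).
  rewrite /wallis -RintegralB//; apply: eq_Rintegral => t _.
  by rewrite mulr0 mul0r add0r cos0 mulrBl.
have E2 : wallis N.*2 0 - wallis N.*2.+2 0 =
    \int[mu]_(t in `[0, pi / 2]) (sin t ^+ 2 * cos t ^+ N.*2).
  rewrite /wallis -RintegralB//; apply: eq_Rintegral => t _.
  by rewrite mulr0 mul0r add0r cos0 sin2cos2 !exprS; ring.
have cnn t : 0 <= cos t ^+ N.*2 by rewrite -mul2n exprM exprn_ge0// sqr_ge0.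
have cs : continuous (fun t : R => sin t ^+ 2 * cos t ^+ N.*2).
  under eq_fun do rewrite expr2.
  by move=> t; apply: cvgM; [apply: cvgM; exact: continuous_sin|exact: ccos].
have c1 : continuous (fun t : R => (1 - cos (2 * x * t + 0)) * cos t ^+ N.*2).
  by move=> t; apply: cvgM; [apply: cvgB; [exact: cvg_cst|exact: continuous_cos_affine]|exact: ccos].
have i1 := cont_itv_integrable (0 : R) (pi / 2) c1.
have i2 := cont_itv_integrable (0 : R) (pi / 2) cs.
have i3 := cont_itv_integrable (0 : R) (pi / 2) (@ccos N.*2).
rewrite ger0_norm; last first.
  rewrite divr_ge0 ?(ltW w0)// E1; apply: Rintegral_ge0 => t _.
  by rewrite mulr_ge0// subr_ge0 cos_le1.
rewrite ler_pdivrMr// E1.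
apply: (@le_trans _ _ (\int[mu]_(t in `[0, pi / 2]) (eps / 2 * cos t ^+ N.*2 + K * (sin t ^+ 2 * cos t ^+ N.*2)))).
  apply: le_Rintegral => //; first by apply: intgD => //; exact: intgZ.
  by move=> t tI; rewrite mulrA -mulrDl ler_wpM2r// bound.
rewrite RintegralD//; [|exact: intgZ|exact: intgZ].
rewrite !RintegralZl// -E2 sin2.
have -> : \int[mu]_(t in `[0, pi / 2]) cos t ^+ N.*2 = wallis N.*2 0.
  by apply: eq_Rintegral => t _; rewrite mulr0 mul0r add0r cos0 mul1r.
have N2 : K / N.*2.+2%:R <= eps / 2.
  rewrite ler_pdivrMr// ; move: hN0; rewrite ltr_pdivrMr// => hN0.
  have : N0%:R <= N%:R :> R by rewrite ler_nat.
  have -> : N.*2.+2%:R = 2 * N%:R + 2 :> R by rewrite -natr1 -natr1 -mul2n natrM; ring.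
  nra.
have -> : eps / 2 * wallis N.*2 0 + K * (wallis N.*2 0 / N.*2.+2%:R) =
  (eps / 2 + K / N.*2.+2%:R) * wallis N.*2 0 by ring.
by rewrite ler_wpM2r ?(ltW w0)// [leRHS]splitr lerD2l.
Qed.

End Wallis.

(** * Finite sections of a perturbation of the identity *)

Section FiniteSections.
Variable R : realType.

Lemma sum_CS (I : Type) (r : seq I) (a b : I -> R) :
  (\sum_(i <- r) a i * b i) ^+ 2 <= (\sum_(i <- r) a i ^+ 2) * \sum_(i <- r) b i ^+ 2.
Proof.
elim: r => [|i r IH]; first by rewrite !big_nil mul0r expr0n.
rewrite !big_cons.
have A0 : 0 <= \sum_(j <- r) a j ^+ 2 by apply: sumr_ge0 => j _; exact: sqr_ge0.
have B0 : 0 <= \sum_(j <- r) b j ^+ 2 by apply: sumr_ge0 => j _; exact: sqr_ge0.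
move: IH A0 B0; set C := \sum_(j <- r) _ * _; set A := \sum_(j <- r) a j ^+ 2.
set B := \sum_(j <- r) _ ^+ 2; set x := a i; set y := b i; move=> IH A0 B0.
have h : 2 * C * (x * y) <= A * y ^+ 2 + B * x ^+ 2.
  have p0 : 0 <= A * y ^+ 2 + B * x ^+ 2 by rewrite addr_ge0// mulr_ge0// sqr_ge0.
  apply: le_trans (ler_norm _) _; rewrite -(@ler_pXn2r _ 2)// ?nnegrE//.
  rewrite real_normK ?num_real//.
  apply: (@le_trans _ _ (4 * (A * B) * (x * y) ^+ 2)).
    rewrite exprMn [(2 * C) ^+ 2]exprMn -natrX; apply: ler_wpM2r; first exact: sqr_ge0.
    by rewrite ler_pM2l.
  rewrite -subr_ge0; set z := (X in 0 <= X).
  have -> : z = (A * y ^+ 2 - B * x ^+ 2) ^+ 2 by rewrite /z; ring.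
  exact: sqr_ge0.
rewrite -subr_ge0; set z := (X in 0 <= X).
have -> : z = (A * B - C ^+ 2) + (A * y ^+ 2 + B * x ^+ 2 - 2 * C * (x * y)) by rewrite /z; ring.
by rewrite addr_ge0// subr_ge0.
Qed.

Lemma cvg_sumR (T I : Type) (F : set_system T) (r : seq I) (f : I -> T -> R) (a : I -> R) : Filter F ->
  (forall i, f i x @[x --> F] --> a i) -> \sum_(i <- r) f i x @[x --> F] --> \sum_(i <- r) a i.
Proof.
move=> FF fa; elim: r => [|i r IH].
  by under eq_fun do rewrite big_nil; rewrite big_nil; exact: cvg_cst.
by under eq_fun do rewrite big_cons; rewrite big_cons; apply: cvgD => //; exact: IH.
Qed.

(** [s x] stands for the coordinates of evaluation at [x], so [s (tau i) j] is the infinite matrix;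
    [near_id] controls all its sections with the same constant. *)
Variables (X : Type) (s : X -> nat -> R) (tau : nat -> X) (Q : R).
Hypothesis Q1 : Q < 1.
Hypothesis s_bessel : forall x n, \sum_(j < n) s x j ^+ 2 <= 1.
Hypothesis near_id : forall n (c : nat -> R),
  \sum_(i < n) (c i - \sum_(j < n) c j * s (tau i) j) ^+ 2 <= Q * \sum_(j < n) c j ^+ 2.

Lemma near_id_inj n (c : nat -> R) : (forall i, (i < n)%N -> \sum_(j < n) c j * s (tau i) j = 0) ->
  forall i, (i < n)%N -> c i = 0.
Proof.
move=> h; have := near_id n c.
under eq_bigr => i _ do rewrite h// subr0.
set S := \sum_(i < n) _ => SQ.
have S0 : 0 <= S by apply: sumr_ge0 => i _; exact: sqr_ge0.
have S00 : S = 0 by apply/eqP; rewrite eq_le S0 andbT; move: Q1; nra.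
move=> i ni; have := psumr_eq0P _ S00 => /(_ (fun j _ => sqr_ge0 _) (Ordinal ni) isT)/eqP.
by rewrite sqrf_eq0 => /eqP.
Qed.

Variables (l : nat) (m : nat -> nat) (ga : nat -> nat -> R).
Hypothesis m_ge : forall N, (N <= m N)%N.
Hypothesis gaE : forall N i, (l < m N)%N -> (i < m N)%N -> \sum_(j < m N) ga N j * s (tau i) j = (i == l)%:R.

Let B : R := 2 * (1 + 2 / (1 - Q)) / (1 - Q).

(** The section maps the solution to the unit vector at [l], which is therefore at squared distance
    at most [Q * S] from it, [S] being the sum of squares. With [d = 1 - Q], a weighted triangle
    inequality gives [S <= (1 + d / 2) * Q * S + (1 + 2 / d)], and [(1 + d / 2) * Q <= 1 - d / 2]
    leaves [S <= B]. *)
Let ga_bound N : (l < m N)%N -> \sum_(j < m N) ga N j ^+ 2 <= B.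
Proof.
move=> lm; have := near_id (m N) (ga N).
under eq_bigr => i _ do rewrite gaE//.
have d0 : 0 < 1 - Q by rewrite subr_gt0.
set d := 1 - Q in d0 *.
have sq (a b : R) : a ^+ 2 <= (1 + d / 2) * (a - b) ^+ 2 + (1 + 2 / d) * b ^+ 2.
  rewrite -subr_ge0; set z := (X in 0 <= X).
  have -> : z = d / 2 * ((a - b) - 2 / d * b) ^+ 2 by rewrite /z; field; rewrite gt_eqF.
  by rewrite mulr_ge0 ?sqr_ge0// divr_ge0// ltW.
have : \sum_(j < m N) ga N j ^+ 2 <= \sum_(j < m N) ((1 + d / 2) * (ga N j - (j == l :> nat)%:R) ^+ 2 + (1 + 2 / d) * (j == l :> nat)%:R ^+ 2).
  by apply: ler_sum => j _; exact: sq.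
rewrite big_split/= -!mulr_sumr.
have -> : \sum_(j < m N) (j == l :> nat)%:R ^+ 2 = 1 :> R.
  rewrite (bigD1 (Ordinal lm))//= eqxx expr1n big1 ?addr0// => j jl.
  by rewrite (negPf jl : (j == l :> nat) = false) expr0n.
set S := \sum_(j < m N) _; set W := \sum_(j < m N) _ => h1 h2.
have S0 : 0 <= S by apply: sumr_ge0 => j _; exact: sqr_ge0.
rewrite /B -/d ler_pdivlMr//.
have QE : Q = 1 - d by rewrite /d; ring.
have h3 : (1 + d / 2) * W <= (1 + d / 2) * (Q * S) by rewrite ler_pM2l// addr_gt0// divr_gt0.
have h4 : S <= (1 + d / 2) * (Q * S) + (1 + 2 / d) * 1 by apply: le_trans h1 _; rewrite lerD2r.
have h5 : (1 + d / 2) * (Q * S) <= S - d / 2 * S.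
  rewrite QE -subr_ge0; set z := (X in 0 <= X).
  have -> : z = d ^+ 2 * S / 2 by rewrite /z; field.
  by rewrite divr_ge0// mulr_ge0// sqr_ge0.
lra.
Qed.

Let g N j := if (j < m N)%N then ga N j else 0.

Let gaS N n (F : nat -> R) : (n <= m N)%N -> \sum_(j < n) g N j * F j = \sum_(j < n) ga N j * F j.
Proof. by move=> nm; apply: eq_bigr => j _; rewrite /g (leq_trans (ltn_ord j) nm). Qed.

Let g_bound N n : (l < m N)%N -> \sum_(j < n) g N j ^+ 2 <= B.
Proof.
move=> lm; apply: le_trans (ga_bound lm).
rewrite -!(big_mkord xpredT (fun j => _ j ^+ 2)).
apply: (@le_trans _ _ (\sum_(0 <= j < maxn n (m N)) g N j ^+ 2)).
  rewrite [leRHS](@big_cat_nat _ _ _ n)//= ?leq_maxl// lerDl.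
  by apply: sumr_ge0 => j _; exact: sqr_ge0.
rewrite [leLHS](@big_cat_nat _ _ _ (m N))//= ?leq_maxr//.
rewrite [X in _ + X]big1_seq ?addr0; last first.
  by move=> j /=; rewrite mem_index_iota => /andP[mj _]; rewrite /g ltnNge mj expr0n.
rewrite le_eqVlt; apply/orP; left; apply/eqP; apply: eq_big_nat => j /andP[_ jm].
by rewrite /g jm.
Qed.

Let l_near : \forall N \near \oo, (l < m N)%N.
Proof. by exists l.+1 => // N /= lN; exact: leq_trans (m_ge N). Qed.

(* A coordinatewise limit along an ultrafilter avoids extracting a diagonal subsequence; the limit is
   upgraded to strong convergence of the whole sequence in [finite_section_limit]. *)
Let weak_limit : exists U : set_system nat, exists c : nat -> R, [/\ ProperFilter U, \oo `<=` U &
  forall j, g N j @[N --> U] --> c j].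
Proof.
have [U [uU oU]] := ultraFilterLemma (F := \oo) _.
have pU : ProperFilter U by case: uU.
have lim j : exists x : R, g N j @[N --> U] --> x.
  have := segment_compact (a := - (B + 1)) (b := B + 1).
  move=> /(_ (fmap (fun N => g N j) U) _) [].
    rewrite /fmap/=; apply: (oU).
    case: l_near => N0 _ hN0; exists N0 => // N /= /hN0 lm.
    have := g_bound j.+1 lm; rewrite big_ord_recr/= => h.
    have h2 : g N j ^+ 2 <= B.
      by apply: le_trans h; rewrite lerDr; apply: sumr_ge0 => i _; exact: sqr_ge0.
    by rewrite in_itv/=; apply/andP; split; nra.
  move=> x [_ hx]; exists x => V xV.
  have [//|hV] := in_ultra_setVsetC ((fun N => g N j) @^-1` V) uU.
  by have [y [+ yV]] := hx (~` V) V hV xV; case.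
exists U, (fun j => projT1 (cid (lim j))); split => // j.
by case: cid.
Qed.

(** The ultrafilter limit [c] solves the infinite system. Comparing [c] with the solution of a
    section through [near_id] bounds their l^2 distance by a tail of [c], a bound that no longer
    involves the ultrafilter. *)
Lemma finite_section_limit : exists c : nat -> R, [/\ forall n, \sum_(j < n) c j ^+ 2 <= B,
  forall i, (fun n => \sum_(j < n) c j * s (tau i) j) @ \oo --> ((i == l)%:R : R) &
  forall x, (fun N => \sum_(j < m N) ga N j * s x j - \sum_(j < m N) c j * s x j) @ \oo --> (0 : R)].
Proof.
have [U [c [pU oU cU]]] := weak_limit.
have B0 : 0 <= B.
  have q0 : 0 <= 1 - Q by rewrite subr_ge0 ltW.
  by rewrite /B divr_ge0// mulr_ge0// addr_ge0// divr_ge0.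
have cB n : \sum_(j < n) c j ^+ 2 <= B.
  apply: (cvgr_to_le (F := U) (f := fun N => \sum_(j < n) g N j ^+ 2)); last first.
    by apply: oU; case: l_near => N0 _ hN0; exists N0 => // N /= /hN0; exact: g_bound.
  by apply: cvg_sumR => j; under eq_fun do rewrite expr2; rewrite expr2; apply: cvgM; exact: cU.
(* Tails of the row [s (tau i)] are small, and Cauchy-Schwarz with the common bound [B] makes the
   remainders small uniformly in [N]; so the ultrafilter limit passes through sums of growing
   length. *)
have cv i : (fun n => \sum_(j < n) c j * s (tau i) j) @ \oo --> ((i == l)%:R : R).
  apply/(@cvgrPdist_le R R^o) => e e0.
  have [n0 hn0] := series_sqr_tail (divr_gt0 (exprn_gt0 2 e0) (ltr_pwDr ltr01 B0)) (s_bessel (tau i)).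
  exists n0 => // n /= n0n.
  have h N : (l < m N)%N -> (i < m N)%N -> (n <= m N)%N ->
      ((i == l)%:R - \sum_(j < n) g N j * s (tau i) j) ^+ 2 <= e ^+ 2.
    move=> lm im nm; rewrite gaS// -(gaE lm im) (sum_nat_sub (fun j => ga N j * s (tau i) j))//.
    apply: le_trans (sum_CS _ _ _) _.
    have b1 : \sum_(n <= j < m N) ga N j ^+ 2 <= B.
      apply: le_trans (ga_bound lm); rewrite -(sum_nat_sub (fun j => ga N j ^+ 2))// gerBl.
      by apply: sumr_ge0 => j _; exact: sqr_ge0.
    have b2 := hn0 n (m N) n0n.
    apply: le_trans (ler_pM _ _ b1 b2) _.
    - by apply: sumr_ge0 => j _; exact: sqr_ge0.
    - by apply: sumr_ge0 => j _; exact: sqr_ge0.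
    rewrite mulrCA ler_piMr ?sqr_ge0// ler_pdivrMr ?mul1r ?lerDl//.
    exact: ltr_pwDr.
  have : ((i == l)%:R - \sum_(j < n) c j * s (tau i) j) ^+ 2 <= e ^+ 2.
    apply: (cvgr_to_le (F := U) (f := fun N => ((i == l)%:R - \sum_(j < n) g N j * s (tau i) j) ^+ 2)).
      under eq_fun do rewrite expr2; rewrite expr2.
      by apply: cvgM; (apply: cvgB; [exact: cvg_cst|apply: cvg_sumR => j]; apply: cvgM; [exact: cU|exact: cvg_cst]).
    apply: oU; exists (maxn l.+1 (maxn i.+1 n)) => // N /=.
    rewrite !geq_max => /and3P[a1 a2 a3]; apply: h; exact: leq_trans (m_ge N).
  by rewrite -(real_normK (num_real _)) ler_pXn2r// nnegrE ltW.
exists c; split => // x.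
have d0 : 0 < 1 - Q by rewrite subr_gt0.
have Q0 : 0 <= Q.
  have := near_id 1 (fun=> 1); rewrite !big_ord1 expr1n mulr1; apply: le_trans; exact: sqr_ge0.
have strong N e : (l < m N)%N -> 0 <= e -> (forall n, \sum_(m N <= j < n) c j ^+ 2 <= e) ->
    \sum_(j < m N) (ga N j - c j) ^+ 2 <= e / (1 - Q).
  move=> lm e0 he; set M := m N in lm he *.
  set D := \sum_(j < M) _.
  suff : D <= Q * (D + e).
    move=> h; rewrite ler_pdivlMr//; 
    rewrite mulrBr mulr1 lerBlDr; apply: le_trans h _.
    by rewrite mulrDr addrC [Q * D]mulrC lerD2r ler_piMl// ltW.
  (* [near_id] is applied to [ga N] cut at [M] minus [c] cut at [n], and then [n] goes to infinity. *)
  pose ee j : R := if (j < M)%N then ga N j - c j else - c j.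
  have eeS n (F : nat -> R) : (M <= n)%N -> \sum_(j < n) ee j * F j =
      \sum_(j < M) ga N j * F j - \sum_(j < n) c j * F j.
    move=> Mn; rewrite -!(big_mkord xpredT (fun j => _ j * F j)).
    rewrite !(@big_cat_nat _ _ _ M 0%N n)//= opprD addrA -!sumrB; congr (_ + _).
      by apply: eq_big_nat => j /andP[_ jM]; rewrite /ee jM mulrBl.
    rewrite -sumrN; apply: eq_big_nat => j /andP[Mj _].
    by rewrite /ee ltnNge Mj mulNr.
  (* Only the rows below [M] are kept: there the section is exact for [ga N], and the defect of [c]
     vanishes as [n] grows. *)
  apply: (cvgr_to_le (F := \oo) (f := fun n => \sum_(i < M) ((ga N i - c i) - ((i == l :> nat)%:R - \sum_(j < n) c j * s (tau i) j)) ^+ 2)).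
    rewrite /D; apply: cvg_sumR => i; under eq_fun do rewrite expr2; rewrite expr2.
    have w : (fun n => (ga N i - c i) - ((i == l :> nat)%:R - \sum_(j < n) c j * s (tau i) j)) @ \oo --> ga N i - c i.
      rewrite [X in _ --> X](_ : _ = ga N i - c i - ((i == l :> nat)%:R - (i == l :> nat)%:R)); last by rewrite subrr subr0.
      by apply: cvgB; [exact: cvg_cst|apply: cvgB; [exact: cvg_cst|exact: cv]].
    by apply: cvgM; exact: w.
  exists M => // n /= Mn.
  apply: (@le_trans _ _ (\sum_(i < n) (ee i - \sum_(j < n) ee j * s (tau i) j) ^+ 2)).
    rewrite -[leRHS](big_mkord xpredT (fun i => (ee i - \sum_(j < n) ee j * s (tau i) j) ^+ 2)).
    rewrite (@big_cat_nat _ _ _ M 0%N n)//= big_mkord.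
    apply: (@le_trans _ _ (\sum_(i < M) (ee i - \sum_(j < n) ee j * s (tau i) j) ^+ 2)).
      apply: ler_sum => i _; rewrite eeS// gaE//.
      by rewrite /ee ltn_ord.
    by rewrite lerDl; apply: sumr_ge0 => i _; exact: sqr_ge0.
  apply: le_trans (near_id _ _) _; apply: ler_wpM2l => //.
  rewrite -(big_mkord xpredT (fun j => ee j ^+ 2)) (@big_cat_nat _ _ _ M 0%N n)//= lerD//.
    rewrite /D -(big_mkord xpredT (fun j => (ga N j - c j) ^+ 2)).
    rewrite le_eqVlt; apply/orP; left; apply/eqP; apply: eq_big_nat => j /andP[_ jM].
    by rewrite /ee jM.
  apply: le_trans (he n); rewrite le_eqVlt; apply/orP; left; apply/eqP.
  by apply: eq_big_nat => j /andP[Mj _]; rewrite /ee ltnNge Mj/= sqrrN.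
apply/(@cvgrPdist_le R R^o) => e e0.
have e20 : 0 < e ^+ 2 * (1 - Q) by rewrite mulr_gt0// exprn_gt0.
have [n0 hn0] := series_sqr_tail e20 cB.
exists (maxn n0 l.+1) => // N /=; rewrite geq_max => /andP[n0N lN].
have lm := leq_trans lN (m_ge N).
have := strong N _ lm (ltW e20) (fun n => hn0 (m N) n (leq_trans n0N (m_ge N))).
rewrite mulfK ?gt_eqF// => h; rewrite sub0r normrN -sumrB.
rewrite -(@ler_pXn2r _ 2)// ?nnegrE//; last exact: ltW.
rewrite real_normK ?num_real//; under eq_bigr do rewrite -mulrBl.
apply: le_trans (sum_CS _ _ _) _; apply: le_trans h.
by rewrite ler_piMr ?s_bessel//; apply: sumr_ge0 => j _; exact: sqr_ge0.
Qed.

End FiniteSections.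

(** * Interpolation at the integers *)

Section Interpolation.
Variable R : realType.
Notation mu := (@lebesgue_measure R).
Implicit Types (x y : R).

Definition zpt (j : nat) : R := (zenum j)%:~R.

(** The matrix entries: the coordinate of [expw pi x] along the exponential of integer frequency
    [zpt j]. *)
Definition shsinc x (j : nat) : R := sinc (pi * (x - zpt j)).

Lemma zenum_odd N : zenum N.*2.+1 = N.+1%:Z.
Proof. by rewrite /zenum/= odd_double/= uphalf_double. Qed.

Lemma zenum_even N : zenum N.*2.+2 = - N.+1%:Z.
Proof. by rewrite /zenum/= odd_double/= doubleK. Qed.

Lemma continuous_sinc s : continuous (fun x => sinc (pi * (x - s))).
Proof.
have -> : (fun x => sinc (pi * (x - s))) = wratio 0 \o (fun y => y - s).
  by apply/funext => x /=; rewrite wratio0.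
move=> x; have c1 : (y - s) @[y --> x] --> x - s by apply: cvgB; [exact: cvg_id|exact: cvg_cst].
exact: (@cvg_comp _ _ _ (fun y : R => y - s) (wratio 0) _ _ _ c1 (@continuous_wratio R 0 (x - s))).
Qed.

(** Identities obtained by dividing by [x - k] are first found off the integers; continuity adds the
    missing points. *)
Lemma eq_off_int (f g : R -> R) : continuous f -> continuous g ->
  (forall x, (forall k : int, x != k%:~R) -> f x = g x) -> forall x, f x = g x.
Proof.
move=> cf cg fg x.
have [[k ->]|xk] := pselect (exists k : int, x = k%:~R); last first.
  by apply: fg => k; apply/eqP => xE; apply: xk; exists k.
(* The shift [n.+2] keeps the increment strictly between 0 and 1, so no term of the sequence is an
   integer. *)
have ux : (fun n : nat => k%:~R + n.+2%:R^-1) @ \oo --> (k%:~R : R).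
  rewrite -[X in _ --> X]addr0; apply: cvgD; first exact: cvg_cst.
  have := @cvg_harmonic R; rewrite /harmonic/= => h.
  by rewrite -(cvg_shiftS (fun n : nat => n.+1%:R^-1 : R)) in h.
pose u n : R := k%:~R + n.+2%:R^-1.
have h1 := @cvg_comp _ _ _ u f _ _ _ ux (cf k%:~R); have h2 := @cvg_comp _ _ _ u g _ _ _ ux (cg k%:~R).
have E : f \o u = g \o u.
  apply/funext => n; rewrite /u/=; apply: fg => m; apply/eqP => km.
  have : (0 : R) < (n.+2%:R^-1 : R) < 1 by rewrite invr_gt0 ltr0n/= invf_lt1// ltr1n.
  have -> : (n.+2%:R^-1 : R) = (m - k)%:~R by rewrite intrB -km; ring.
  by rewrite ltr0z ltrz1; case: (m - k) => [[|z]|z].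
rewrite -E in h2; exact: (cvg_unique _ h1 h2).
Qed.

Lemma mul_prod_zpt N :
  exists2 C : R, C != 0 & forall x, x * (\prod_(1 <= k < N.+1) (1 - x ^+ 2 / k%:R ^+ 2)) =
    C * \prod_(j < N.*2.+1) (x - zpt j).
Proof.
elim: N => [|N [C C0 IH]].
  by exists 1 => // y; rewrite big_geq// big_ord1 /zpt/= subr0 mulr1 mul1r.
exists (C * - (N.+1%:R ^+ 2)^-1) => [|y].
  by rewrite mulf_neq0// oppr_eq0 invr_eq0 expf_neq0// pnatr_eq0.
rewrite big_nat_recr//= mulrA IH doubleS !big_ord_recr/= /zpt zenum_odd zenum_even.
set P := \prod_(j < _) _; rewrite mulrNz opprK -pmulrn.
have : N.+1%:R != 0 :> R by rewrite pnatr_eq0.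
set k : R := N.+1%:R; clearbody k P => k0.
by field.
Qed.

Lemma continuous_prod (I : Type) (r : seq I) (P : pred I) (F : I -> R -> R) :
  (forall i, continuous (F i)) -> continuous (fun x => \prod_(i <- r | P i) F i x).
Proof.
move=> cF; elim: r => [|i r IH] x; rewrite /continuous_at.
  by under eq_fun do rewrite big_nil; rewrite big_nil; exact: cvg_cst.
under eq_fun do rewrite big_cons; rewrite big_cons; case: ifP => _; last exact: IH.
by apply: cvgM; [exact: cF|exact: IH].
Qed.

(** The product has all integers of absolute value at most N but one as zeros, and the tail vanishes
    at the larger ones: together they have the zeros of a shifted sinc. *)
Lemma wratio_prod_zpt N i : (i < N.*2.+1)%N -> exists K : R, forall x,
  wratio N x * \prod_(j < N.*2.+1 | j != i :> nat) (x - zpt j) = K * shsinc x i.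
Proof.
move=> iN; have [C C0 CE] := mul_prod_zpt N.
(* [C] compares the finite sine product with the monic polynomial. For an integer k,
   [sin (pi * (x - k))] is [cos (pi * k) * sin (pi * x)], and [cos (pi * k)] is its own inverse. *)
exists (cos (pi * zpt i) / C); apply: eq_off_int.
- move=> x; apply: cvgM; first exact: continuous_wratio.
  by apply: continuous_prod => j y; apply: cvgB; [exact: cvg_id|exact: cvg_cst].
- by move=> x; apply: cvgM; [exact: cvg_cst|exact: continuous_sinc].
move=> x xk.
have xi : x - zpt i != 0 by rewrite subr_eq0 xk.
have x0 : x != 0 by exact: (xk 0).
have := CE x; rewrite (bigD1 (Ordinal iN))//=.
have := sinc_wratio N x.
set P := \prod_(1 <= k < _) _; set W := wratio N x.
have -> : \prod_(j < N.*2.+1 | j != Ordinal iN) (x - zpt j) = \prod_(j < N.*2.+1 | j != i :> nat) (x - zpt j).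
  by apply: eq_bigl.
set V := \prod_(j < _ | _) _ => sE pE.
have p0 : pi != 0 :> R by rewrite gt_eqF// pi_gt0.
have sx : sin (pi * x) = pi * (C * ((x - zpt i) * V)) * W.
  rewrite -pE; transitivity (pi * x * sinc (pi * x)); last by rewrite sE; ring.
  by rewrite /sinc mulf_eq0 (negPf p0) (negPf x0)/= mulrCA divff ?mulr1// mulf_neq0.
have sk : sin (pi * zpt i) = 0 by rewrite mulrC sin_intpi.
have ck : cos (pi * zpt i) ^+ 2 = 1 by rewrite cos2sin2 sk expr0n subr0.
have sx2 : sin (pi * (x - zpt i)) = sin (pi * x) * cos (pi * zpt i).
  by rewrite mulrBr sinB sk mulr0 subr0.
rewrite /shsinc /sinc mulf_eq0 (negPf p0) (negPf xi)/= sx2 sx.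
transitivity (cos (pi * zpt i) ^+ 2 * (W * V)); first by rewrite ck mul1r.
move: (cos (pi * zpt i)) (x - zpt i) xi (pi : R) p0 => c y y0 q q0.
by field; rewrite C0 q0 y0.
Qed.

Lemma zpt_inj : injective zpt.
Proof. by move=> i j /intr_inj/zenum_inj. Qed.

(** Lagrange interpolation at the integers of absolute value at most N: the tail turns each Lagrange
    polynomial into a multiple of one shifted sinc. *)
Lemma wratio_poly N (p : {poly R}) : (size p <= N.*2.+1)%N -> exists d : nat -> R, forall x,
  wratio N x * p.[x] = \sum_(i < N.*2.+1) d i * shsinc x i.
Proof.
move=> sp.
have KE i : {K : R | (i < N.*2.+1)%N -> forall x,
    wratio N x * \prod_(j < N.*2.+1 | j != i :> nat) (x - zpt j) = K * shsinc x i}.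
  apply: cid; have [iN|Ni] := ltnP i N.*2.+1; last by exists 0.
  by have [K hK] := wratio_prod_zpt iN; exists K.
exists (fun i => p.[zpt i] / (\prod_(j < N.*2.+1 | j != i :> nat) (zpt i - zpt j)) * projT1 (KE i)) => x.
rewrite [in LHS](lagrange_gen (ltn0Sn _) zpt_inj sp) horner_sum mulr_sumr.
apply: eq_bigr => i _; rewrite lagrangeE//; last exact: zpt_inj.
have hp (y : R) : (\prod_(j < N.*2.+1 | j != i :> nat) ('X - (zpt j)%:P)).[y] =
    \prod_(j < N.*2.+1 | j != i :> nat) (y - zpt j).
  by rewrite horner_prod; apply: eq_bigr => j _; rewrite !hornerE.
rewrite !hornerM !hornerC !hp.
case: (KE i) => K /= hK; rewrite -[RHS]mulrA -hK//.
by move: (\prod_(j < _ | _) (x - _)) (\prod_(j < _ | _) _)^-1 => a b; ring.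
Qed.

Lemma wratio_neq0 N x : 0 < x -> x < 1 -> wratio N x != 0.
Proof.
move=> x0 x1; apply/eqP => w0; have := sinc_wratio N x; rewrite w0 mulr0.
have p0 := pi_gt0 R.
rewrite /sinc mulf_eq0 !gt_eqF//= => /eqP; apply/negP.
rewrite mulf_neq0 ?invr_eq0 ?mulf_neq0 ?gt_eqF// sin_gt0_pi// mulr_gt0//=.
by rewrite -[ltRHS]mulr1 ltr_pM2l.
Qed.

(** The polynomial with zeros at all [tau j] but [tau l], multiplied by the tail, is a combination
    of shifted sincs; normalised at [tau l], its coefficients solve the section. *)
Lemma finite_section_solution (tau : nat -> R) (Q : R) N l : Q < 1 ->
  (forall n (c : nat -> R),
    \sum_(i < n) (c i - \sum_(j < n) c j * shsinc (tau i) j) ^+ 2 <= Q * \sum_(j < n) c j ^+ 2) ->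
  (l < N.*2.+1)%N ->
  exists ga : nat -> R, [/\ wratio N (tau l) != 0,
    forall i, (i < N.*2.+1)%N -> \sum_(j < N.*2.+1) ga j * shsinc (tau i) j = (i == l)%:R &
    forall x, \sum_(j < N.*2.+1) ga j * shsinc x j =
      wratio N x / wratio N (tau l) * \prod_(j < N.*2.+1 | j != l :> nat) ((x - tau j) / (tau l - tau j))].
Proof.
move=> Q1 near_id lN; set n := N.*2.+1 in lN *.
pose p : {poly R} := \prod_(j < n | j != l :> nat) ('X - (tau j)%:P).
have pE x : p.[x] = \prod_(j < n | j != l :> nat) (x - tau j).
  by rewrite horner_prod; apply: eq_bigr => j _; rewrite !hornerE.
have sp : (size p <= n)%N.
  rewrite /p -big_filter size_prod_XsubC; set s := [seq _ <- _ | _].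
  have : (size s < size (index_enum 'I_n))%N.
    rewrite /s size_filter -(count_predC (fun j : 'I_n => j != l :> nat) (index_enum _)) -addn1 leq_add2l.
    by rewrite -has_count; apply/hasP; exists (Ordinal lN); rewrite ?mem_index_enum//= eqxx.
  have -> // : size (index_enum 'I_n) = n.
  by rewrite -sum1_size big_const_ord iter_addn_0 mul1n.
have [d dE] := wratio_poly sp.
have pt i : (i < n)%N -> i != l -> p.[tau i] = 0.
  by move=> ni il; rewrite pE (bigD1 (Ordinal ni))//= subrr mul0r.
pose v := wratio N (tau l) * p.[tau l].
(* If the value at [tau l] were 0, injectivity of the section would annihilate the coefficients, and
   [p] would have more roots between 0 and 1 than its degree allows. In particular [tau l] differs
   from the other nodes. *)
have v0 : v != 0.
  apply/eqP => v0.
  have d0 : forall i, (i < n)%N -> d i = 0.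
    apply: (near_id_inj Q1 near_id) => i ni; rewrite -dE.
    by have [->//|il] := eqVneq i l; rewrite pt// mulr0.
  have px x : 0 < x -> x < 1 -> p.[x] = 0.
    move=> x0 x1; have := dE x; rewrite big1 => [|i _]; last by rewrite d0// mul0r.
    by move/eqP; rewrite mulf_eq0 (negPf (wratio_neq0 N x0 x1)) => /eqP.
  have p0 : p != 0 by rewrite monic_neq0//; exact: monic_prod_XsubC.
  pose rs : seq R := [seq i.+2%:R^-1 | i <- iota 0 n].
  have := max_poly_roots p0 (rs := rs); rewrite size_map size_iota => h.
  suff : (n < size p)%N by rewrite ltnNge sp.
  apply: h.
    apply/allP => x /mapP[i _ ->]; apply/eqP/px; rewrite ?invr_gt0 ?ltr0n//.
    by rewrite invf_lt1// ltr1n.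
  by rewrite map_inj_uniq ?iota_uniq// => i j /invr_inj/eqP; rewrite eqr_nat => /eqP[].
have [w0 pl0] : wratio N (tau l) != 0 /\ p.[tau l] != 0.
  by move: v0; rewrite mulf_eq0 negb_or => /andP.
have gE x : \sum_(j < n) d j / v * shsinc x j = wratio N x * p.[x] / v.
  by rewrite dE mulr_suml; apply: eq_bigr => j _; rewrite mulrAC.
exists (fun j => d j / v); split => // [i ni|x]; rewrite gE.
  by have [->|il] := eqVneq i l; [rewrite divff|rewrite pt// mulr0 mul0r].
by rewrite prodf_div -!pE /v; field; rewrite w0 pl0.
Qed.

End Interpolation.

(** * Limits of the interpolating functions *)

Section SamplingLimit.
Local Open Scope complex_scope.
Variable R : realType.
Notation mu := (@lebesgue_measure R).
Notation dot := (dot mu).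
Notation cL2 := (cL2 mu).
Implicit Types (x : R).

Lemma suppin_expw (a w : R) : suppin a (expw a w).
Proof. by move=> y /negPf ya; rewrite /expw ya. Qed.

Lemma sincN x : sinc (- x) = sinc x :> R.
Proof. by rewrite /sinc oppr_eq0 sinN invrN mulrNN. Qed.

Lemma dot_expw_zpt x j : dot (expw pi (zpt R j)) (expw pi x) = shsinc x j.
Proof. by rewrite dot_expw ?pi_gt0// /shsinc -sincN mulrC -mulrN opprB. Qed.

Lemma expw_zptON i j : dot (expw pi (zpt R i)) (expw pi (zpt R j)) = (i == j)%:R.
Proof.
rewrite dot_expw ?pi_gt0// /zpt -intrB sinc_int subr_eq0.
by rewrite (inj_eq zenum_inj).
Qed.

Lemma shsinc_bessel x n : \sum_(j < n) shsinc x j ^+ 2 <= 1.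
Proof.
have h := bessel (fun i => cL2_expw pi (zpt R i)) expw_zptON n (cL2_expw pi x).
have e1 : dot (expw pi x) (expw pi x) = 1.
  by rewrite dot_expw ?pi_gt0// subrr mul0r /sinc eqxx.
rewrite -e1; apply: le_trans h; rewrite le_eqVlt; apply/orP; left; apply/eqP.
by apply: eq_bigr => j _; rewrite dotC dot_expw_zpt.
Qed.

Lemma leq_doubleS N : (N <= N.*2.+1)%N.
Proof. by rewrite -addnn -addnS leq_addr. Qed.

(** The coefficients of [g] are the l^2 limit of the section solutions. They are real, so the
    products of [g] with ['i] times an exponential vanish and its transform is real on the line. *)
Lemma sampling_limit (tau : nat -> R) (Q : R) (l : nat) : Q < 1 ->
  (forall n (c : nat -> R),
    \sum_(i < n) (c i - \sum_(j < n) c j * shsinc (tau i) j) ^+ 2 <= Q * \sum_(j < n) c j ^+ 2) ->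
  exists g, [/\ cL2 g, suppin pi g,
    forall x, dot g (fun y => 'i * expw pi x y) = 0,
    forall i, dot g (expw pi (tau i)) = (i == l)%:R &
    forall x, (fun N => \prod_(j < N.*2.+1 | j != l :> nat) ((x - tau j) / (tau l - tau j)))
      @ \oo --> dot g (expw pi x)].
Proof.
move=> Q1 near_id.
have sol N : {ga : nat -> R | (l < N.*2.+1)%N -> [/\ wratio N (tau l) != 0,
    forall i, (i < N.*2.+1)%N -> \sum_(j < N.*2.+1) ga j * shsinc (tau i) j = (i == l)%:R &
    forall x, \sum_(j < N.*2.+1) ga j * shsinc x j =
      wratio N x / wratio N (tau l) * \prod_(j < N.*2.+1 | j != l :> nat) ((x - tau j) / (tau l - tau j))]}.
  apply: cid; have [lN|Nl] := ltnP l N.*2.+1; last by exists (fun=> 0).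
  by have [ga h] := finite_section_solution Q1 near_id lN; exists ga.
pose ga N := projT1 (sol N).
have gaE N := projT2 (sol N).
have [c [cB cv cx]] := finite_section_limit Q1 shsinc_bessel near_id (m := fun N => N.*2.+1) (ga := ga)
  leq_doubleS (fun N i lN => let: And3 _ h _ := gaE N lN in h i).
have e0 i x : ~ `[- pi, pi]%classic x -> expw pi (zpt R i) x = 0.
  by move=> /negP; exact: suppin_expw.
have mD : measurable (`[- pi, pi]%classic : set R) by exact: measurable_itv.
have cE i := @cL2_expw R pi (zpt R i).
have [g [cg g0 gl]] := riesz_fischer cE expw_zptON mD e0 cB.
have lim h : cL2 h -> (fun n => \sum_(j < n) c j * dot (expw pi (zpt R j)) h) @ \oo --> dot g h.
  move=> ch; have := dot_cvg (fun n => cL2_lincomb cE c n) cg ch gl.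
  by under eq_fun do rewrite dot_lincomb//.
have limx x : (fun n => \sum_(j < n) c j * shsinc x j) @ \oo --> dot g (expw pi x).
  by have := lim _ (cL2_expw pi x); under eq_fun do under eq_bigr do rewrite dot_expw_zpt.
exists g; split => //.
- by move=> x /negP; exact: g0.
- move=> x; have := lim _ (cL2M 'i (cL2_expw pi x)).
  under eq_fun do under eq_bigr do rewrite dot_expw_i ?pi_gt0// mulr0.
  under eq_fun do rewrite big1//.
  move=> h; have h0 : (fun _ : nat => (0 : R)) @ \oo --> (0 : R) by exact: cvg_cst.
  exact: (cvg_unique _ h h0).
- by move=> i; exact: (cvg_unique _ (limx (tau i)) (cv i)).
move=> x.
have lx2 : (fun N => \sum_(j < N.*2.+1) c j * shsinc x j) @ \oo --> dot g (expw pi x).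
  apply: (cvg_comp (fun N => N.*2.+1) (fun n => \sum_(j < n) c j * shsinc x j) _ (limx x)).
  by move=> A [N _ hA]; exists N => // k /= Nk; apply: hA => /=; exact: leq_trans (leq_doubleS k).
have sx : (fun N => \sum_(j < N.*2.+1) ga N j * shsinc x j) @ \oo --> dot g (expw pi x).
  have -> : (fun N => \sum_(j < N.*2.+1) ga N j * shsinc x j) = (fun N =>
      (\sum_(j < N.*2.+1) ga N j * shsinc x j - \sum_(j < N.*2.+1) c j * shsinc x j) +
      \sum_(j < N.*2.+1) c j * shsinc x j) by apply/funext => N; rewrite subrK.
  by rewrite -[X in _ --> X]add0r; exact: cvgD (cx x) lx2.
(* The tails at [x] and at [tau l] both tend to 1, so dividing them out leaves the bare products
   with the same limit. *)
have wl := wratio_cvg1 (tau l); have wx := wratio_cvg1 x.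
have : (fun N => (\sum_(j < N.*2.+1) ga N j * shsinc x j) * (wratio N (tau l) * (wratio N x)^-1)) @ \oo --> dot g (expw pi x).
  rewrite -[X in _ --> X]mulr1 -[X in _ * X](mulr1 1) -[X in _ * (_ * X)]invr1.
  have wv : (fun N => (wratio N x)^-1) @ \oo --> (1^-1 : R).
    by apply: cvgV; [exact: oner_neq0|exact: wx].
  have wm : (fun N => wratio N (tau l) * (wratio N x)^-1) @ \oo --> (1 * 1^-1 : R).
    by apply: cvgM; [exact: wl|exact: wv].
  by apply: cvgM; [exact: sx|exact: wm].
apply: cvg_trans; apply: near_eq_cvg.
have wn : \forall N \near \oo, 0 < wratio N x.
  exact: (cvgr_gt 1).
near=> N.
have lN : (l < N.*2.+1)%N.
  by apply: leq_trans (leq_doubleS N); near: N; exists l.+1.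
have [wl0 _ gx] := gaE N lN.
have -> : \sum_(j < N.*2.+1) ga N j * shsinc x j = _ := gx x.
have wx0 : wratio N x != 0 by rewrite gt_eqF//; near: N.
move: (\prod_(j < _ | _) _) => P; move: wl0 wx0; move: (wratio N x) (wratio N (tau l)) => u v u0 v0.
by field; rewrite u0 v0.
Unshelve. all: by end_near.
Qed.

End SamplingLimit.

(** * The generating function *)

Section NearIdentity.
Local Open Scope complex_scope.
Variable R : realType.
Notation mu := (@lebesgue_measure R).
Notation dot := (dot mu).
Notation cL2 := (cL2 mu).
Implicit Types (x : R) (f g h : R -> R[i]).

Lemma L2piP f : L2pi f <-> cL2 f /\ suppin pi f.
Proof. by split=> [[/L2P cf f0]|[cf f0]]; split => //; apply/L2P. Qed.

(** The images of [expsys pi] under [L], multiples by ['i] included. *)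
Definition perturbed (t : int -> R) (j : nat) : R -> R[i] := fun x =>
  (if odd j then 'i else 1) * expw pi (t (zenum j./2)) x.

Lemma cL2_perturbed t j : cL2 (perturbed t j).
Proof. by apply: cL2M; exact: cL2_expw. Qed.

Lemma suppin_lincomb (a : R) (c : nat -> R) (b : nat -> R -> R[i]) n :
  (forall j, suppin a (b j)) -> suppin a (lincomb c b n).
Proof. by move=> sb x xa; rewrite /lincomb big1// => j _; rewrite sb// mulr0. Qed.

Lemma suppinM (a : R) (z : R[i]) f : suppin a f -> suppin a (fun x => z * f x).
Proof. by move=> sf x xa; rewrite sf// mulr0. Qed.

Variables (t : int -> R) (L : (R -> R[i]) -> (R -> R[i])).
Hypothesis L_bounded : bounded_operator (@L2pi R) L.
Hypothesis L_basis : forall n, eqL2 (L (std_basis n)) (expo (t n)).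
Hypothesis L_near_id : (opnorm (@L2pi R) (fun f x => (f x - L f x)%R) < 1)%E.

Let b := expsys (pi : R).
Let b' := perturbed t.

Let sb j : suppin pi (b j). Proof. by move=> x; exact: expsys0. Qed.
Let cb j : cL2 (b j). Proof. exact: cL2_expsys. Qed.
Let cb' j : cL2 (b' j). Proof. exact: cL2_perturbed. Qed.
Let bON i j : dot (b i) (b j) = (i == j)%:R. Proof. exact: expsysON (pi_gt0 R) i j. Qed.

Let bE j : b j = fun x => (if odd j then 'i else 1) * std_basis (zenum j./2) x.
Proof. by apply/funext => x; rewrite /b /expsys divff ?mulr1// gt_eqF// pi_gt0. Qed.

Let L_lincomb c n : {ae mu, forall x, L (lincomb c b n) x = lincomb c b' n x}.
Proof.
have aF : Filter (almost_everywhere mu) := ae_filter_ringOfSetsType mu.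
have [LV Leq Llin _] := L_bounded.
have V0 : L2pi (fun=> 0 : R[i]).
  by apply/L2piP; split => // ; exact: cL20.
elim: n => [|n IH].
  have -> : lincomb c b 0 = fun=> 0 by apply/funext => x; rewrite /lincomb big_ord0.
  (* Linearity at 0 gives [L 0 = L 0 + L 0] almost everywhere. *)
  have := Llin 1 _ _ V0 V0; have -> : (fun x : R => 1 * 0 + 0 : R[i]) = fun=> 0.
    by apply/funext => x; rewrite mulr0 addr0.
  apply: filterS => x /(_ I); rewrite mul1r => h; rewrite /lincomb big_ord0.
  by apply: (addrI (L (fun=> 0) x)); rewrite -h addr0.
have Vn : L2pi (lincomb c b n).
  by apply/L2piP; split; [exact: cL2_lincomb|exact: suppin_lincomb].
pose z : R[i] := (c n)%:C * (if odd n then 'i else 1).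
have Vs : L2pi (std_basis (zenum n./2) : R -> R[i]).
  by apply/L2piP; split; [exact: cL2_expw|exact: suppin_expw].
have := Llin z _ _ Vs Vn.
have -> : (fun x => z * std_basis (zenum n./2) x + lincomb c b n x) = lincomb c b n.+1.
  by apply/funext => x; rewrite /lincomb big_ord_recr/= addrC; congr (_ + _); rewrite bE /z mulrA.
move=> h1; have h2 := L_basis (zenum n./2).
near=> x.
have -> : L (lincomb c b n.+1) x = z * L (std_basis (zenum n./2)) x + L (lincomb c b n) x.
  by near: x; apply: filterS h1 => x; apply.
have -> : L (std_basis (zenum n./2)) x = expo (t (zenum n./2)) x.
  by near: x; apply: filterS h2 => x; apply.
have -> : L (lincomb c b n) x = lincomb c b' n x by near: x.
by rewrite /lincomb big_ord_recr/= addrC; congr (_ + _); rewrite /z /b' /perturbed mulrA.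
Unshelve. all: by end_near.
Qed.

(** [opnorm] only sees the unit ball, so a combination is scaled to norm 1, its norm being known
    from orthonormality. *)
Lemma near_identity_coef : exists q : R, [/\ 0 <= q, q < 1 & forall c n,
  dot (fun x => lincomb c (expsys pi) n x - lincomb c (perturbed t) n x)
    (fun x => lincomb c (expsys pi) n x - lincomb c (perturbed t) n x) <= q ^+ 2 * \sum_(j < n) c j ^+ 2].
Proof.
have aF : Filter (almost_everywhere mu) := ae_filter_ringOfSetsType mu.
have [LV _ _ _] := L_bounded.
have [q [q0 q1 hq]] : exists q : R, [/\ 0 <= q, q < 1 & forall f, L2pi f -> (L2norm f <= 1)%E ->
    (L2norm (fun x => (f x - L f x)%R) <= q%:E)%E].
  (* The maximum with 0 provides [0 <= q] without evaluating the supremum. *)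
  exists (Num.max 0 (fine (opnorm (@L2pi R) (fun f x => (f x - L f x)%R)))).
  have up f : L2pi f -> (L2norm f <= 1)%E ->
    (L2norm (fun x => (f x - L f x)%R) <= opnorm (@L2pi R) (fun f x => (f x - L f x)%R))%E.
    by move=> Vf f1; apply: ereal_sup_ubound; exists f.
  move: L_near_id up; case: (opnorm _ _) => [r| |]//= r1 up.
    split; first by rewrite le_max lexx.
      by rewrite gt_max ltr01/= -lte_fin.
    move=> f Vf f1; apply: le_trans (up f Vf f1) _.
    by rewrite lee_fin le_max lexx orbT.
  split; [by rewrite le_max lexx|by rewrite gt_max ltr01/=|].
  move=> f Vf f1; apply: le_trans (up f Vf f1) _.
  exact: leNye.
exists q; split => // c n; set w := fun x => lincomb c _ n x - _.
have unit (c' : nat -> R) : \sum_(j < n) c' j ^+ 2 = 1 ->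
    dot (fun x => lincomb c' b n x - lincomb c' b' n x) (fun x => lincomb c' b n x - lincomb c' b' n x) <= q ^+ 2.
  move=> c1; set w' := fun x => _ - _.
  have cl : cL2 (lincomb c' b n) by exact: cL2_lincomb.
  have cl' : cL2 (lincomb c' b' n) by exact: cL2_lincomb.
  have Vl : L2pi (lincomb c' b n) by apply/L2piP; split => //; exact: suppin_lincomb.
  have := hq _ Vl; rewrite L2normE// (dot_lincomb2 cb bON) c1 sqrtr1 => /(_ (lexx _)).
  have /L2piP[cLl _] := LV _ Vl.
  have cd := cL2B cl cLl; have cw' := cL2B cl cl'.
  rewrite (L2normE cd) lee_fin => h.
  have E : {ae mu, forall x, lincomb c' b n x - L (lincomb c' b n) x = w' x}.
    by apply: filterS (L_lincomb c' n) => x ->.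
  have -> : dot w' w' = dot (fun x => lincomb c' b n x - L (lincomb c' b n) x) (fun x => lincomb c' b n x - L (lincomb c' b n) x).
    rewrite (ae_eq_dotl E cd cw' cd) [RHS]dotC (ae_eq_dotl E cd cw' cw') //.
  rewrite -[leLHS]sqr_sqrtr ?dot_ge0// ler_sqr// nnegrE//; exact: sqrtr_ge0.
set S := \sum_(j < n) _.
have S0 : 0 <= S by apply: sumr_ge0 => j _; exact: sqr_ge0.
have [S00|Sn0] := eqVneq S 0.
  have c0 (j : 'I_n) : c j = 0.
    have := psumr_eq0P (fun (k : 'I_n) _ => sqr_ge0 (c k)) S00 => /(_ j isT)/eqP.
    by rewrite sqrf_eq0 => /eqP.
  have w0 x : w x = 0.
    by rewrite /w /lincomb !big1 ?subr0// => j _; rewrite c0 mul0r.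
  by rewrite S00 mulr0 (funext w0) /dot; under eq_Rintegral do rewrite /= !mul0r addr0; rewrite Rintegral_cst// mul0r.
have Sp : 0 < S by rewrite lt_def Sn0.
pose r := Num.sqrt S; have r0 : r != 0 by rewrite gt_eqF// sqrtr_gt0.
have rr : r ^+ 2 = S by rewrite sqr_sqrtr.
pose c' j := r^-1 * c j.
have := unit c'; rewrite /c'; under eq_bigr do rewrite exprMn.
rewrite -mulr_sumr -/S exprVn rr mulVf// => /(_ erefl)/=.
have lE (B : nat -> R -> R[i]) x : lincomb (fun j => r^-1 * c j) B n x = (r^-1)%:C * lincomb c B n x.
  by rewrite /lincomb mulr_sumr; apply: eq_bigr => j _; rewrite rmorphM/= mulrA.
have -> : (fun x => lincomb (fun j => r^-1 * c j) b n x - lincomb (fun j => r^-1 * c j) b' n x) = fun x => (r^-1)%:C * w x.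
  by apply/funext => x; rewrite !lE -mulrBr.
have cw : cL2 w by apply: cL2B; exact: cL2_lincomb.
have cw2 := cL2M (r^-1)%:C cw.
by rewrite dotZl// dotZr// mulrA -invfM -expr2 rr mulrC ler_pdivrMr.
Qed.

(** The adjoint has the same norm: with these products as coefficients [c], the sum of squares [S]
    equals [dot w f], and Cauchy-Schwarz with [near_identity_coef] bounds [S ^ 2] by
    [q ^ 2 * S * dot f f]. *)
Lemma near_identity_dual : exists q : R, [/\ 0 <= q, q < 1 & forall f, cL2 f -> forall n,
  \sum_(j < n) dot f (fun x => expsys pi j x - perturbed t j x) ^+ 2 <= q ^+ 2 * dot f f].
Proof.
have [q [q0 q1 hq]] := near_identity_coef; exists q; split => // f cf n.
set c := fun j => dot f (fun x => b j x - b' j x).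
have := hq c n; set w := fun x => _ - _ => hw.
have cl : cL2 (lincomb c b n) by exact: cL2_lincomb.
have cl' : cL2 (lincomb c b' n) by exact: cL2_lincomb.
have cw : cL2 w by exact: cL2B.
have E : dot w f = \sum_(j < n) c j ^+ 2.
  rewrite dotBl// !dot_lincomb// -sumrB; apply: eq_bigr => j _.
  by rewrite expr2 -mulrBr; congr (_ * _); rewrite /c dotBr// ![dot f _]dotC.
have S0 : 0 <= \sum_(j < n) c j ^+ 2 by apply: sumr_ge0 => j _; exact: sqr_ge0.
have := dot_CS cw cf; rewrite E.
move: S0 hw; rewrite -/(\sum_(j < n) c j ^+ 2).
set S := \sum_(j < n) c j ^+ 2; set W := dot w w; set F := dot f f => S0 hw h.
have F0 : 0 <= F by exact: dot_ge0.
have [->|Sn0] := eqVneq S 0; first by rewrite mulr_ge0// sqr_ge0.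
have Sp : 0 < S by rewrite lt_def Sn0.
rewrite -(ler_pM2l Sp) -expr2; apply: le_trans h _.
by rewrite mulrA [S * _]mulrC ler_wpM2r.
Qed.

End NearIdentity.

Section GeneratingFunction.
Local Open Scope complex_scope.
Variable R : realType.
Notation mu := (@lebesgue_measure R).
Notation dot := (dot mu).
Notation cL2 := (cL2 mu).
Implicit Types (x : R) (f g h : R -> R[i]).

Lemma continuous_dot_expw g : cL2 g -> suppin pi g -> continuous (fun x => dot g (expw pi x)).
Proof.
move=> cg g0 x.
have s0 : Num.sqrt (2 * pi) != 0 :> R by rewrite gt_eqF// sqrtr_gt0 mulr_gt0// pi_gt0.
have -> : (fun x => dot g (expw pi x)) = fun x => (Num.sqrt (2 * pi))^-1 * complex.Re (hat g x).
  apply/funext => y; rewrite (hatE (pi_gt0 R) y cg g0) complex_partsE/=.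
  by rewrite mulrA mulVf// mul1r.
by apply: cvgM; [exact: cvg_cst|exact: continuous_Re_hat cg g0 x].
Qed.

Lemma continuous_neq0_off (u : R -> R) a b : continuous u -> u a != 0 ->
  exists2 x, x != b & u x != 0.
Proof.
move=> cu ua.
have ua0 : 0 < `|u a| by rewrite normr_gt0.
have := (@cvgrPdist_lt R R^o _ _ _ _ _).1 (cu a) _ ua0 => /(_ (nbhs_filter _))[d /= d0 hd].
have un y : `|a - y| < d -> u y != 0.
  move=> /hd h; apply: contraTneq h => ->; by rewrite subr0 ltxx.
have [ab|ab] := eqVneq a b; last by exists a.
exists (a + d / 2); first by rewrite -ab -subr_eq0 addrC addKr gt_eqF// divr_gt0.
apply: un; rewrite opprD addNKr normrN gtr0_norm ?divr_gt0//; lra.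
Qed.

(** The difference quotient at [a] is exactly [c * G (h + a)], so continuity of [G] suffices. *)
Lemma derivable_factor (H G : R -> R) a c : continuous G -> G a = 1 ->
  (forall x, H x = c * (x - a) * G x) -> derivable H a 1 /\ derive1 H a = c.
Proof.
move=> cG Ga HE.
have lim : (fun h : R => h^-1 *: ((H \o shift a) (h *: 1) - H a)) @ 0^' --> c.
  have lG : (fun h : R => c * G (h + a)) @ 0^' --> c.
    rewrite -[X in _ --> X]mulr1 -Ga; apply: cvgM; first exact: cvg_cst.
    apply: (@cvg_within_filter).
    have ca : (fun h : R => h + a) @ 0 --> a.
      by rewrite -[X in _ --> X]add0r; apply: cvgD; [exact: cvg_id|exact: cvg_cst].
    exact: (@cvg_comp _ _ _ (fun h : R => h + a) G _ _ _ ca (cG a)).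
  apply: cvg_trans lG; apply: near_eq_cvg.
  near=> h.
  have h0 : h != 0 by near: h; exact: nbhs_dnbhs_neq.
  rewrite /= !HE subrr mulr0 mul0r subr0 /GRing.scale/= mulr1 addrK.
  by field.
split; first by apply/cvg_ex; exists c.
by rewrite derive1E; apply: cvg_lim.
Unshelve. all: by end_near.
Qed.

Lemma mul_prod_ratio (tau a : nat -> R) n l x : (l < n)%N ->
  (x - tau l) * \prod_(j < n | j != l :> nat) ((x - tau j) / a j) =
  (\prod_(j < n) (x - tau j)) / \prod_(j < n | j != l :> nat) a j.
Proof.
move=> ln; rewrite prodf_div mulrA; congr (_ / _).
by rewrite [RHS](bigD1 (Ordinal ln)).
Qed.

Variables (t : int -> R) (q : R).
Hypothesis t_neq0 : forall n : int, n != 0 -> t n != 0.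
Hypothesis q0 : 0 <= q.
Hypothesis q1 : q < 1.
Hypothesis dual : forall f, cL2 f -> forall n,
  \sum_(j < n) dot f (fun x => expsys pi j x - perturbed t j x) ^+ 2 <= q ^+ 2 * dot f f.

Let tau i := t (zenum i).
Let tau0 i := if i == 0%N then 0 else tau i.

Let Q1 : q ^+ 2 < 1. Proof. by rewrite expr_lt1. Qed.

Let pipi : pi / pi = 1 :> R. Proof. by rewrite divff// gt_eqF// pi_gt0. Qed.

Let dot_expsysE f j : dot f (expsys pi j) =
  if odd j then dot f (fun x => 'i * expw pi (zpt R j./2) x) else dot f (expw pi (zpt R j./2)).
Proof.
case: ifP => oj; congr dot; apply/funext => x; rewrite /expsys oj pipi mulr1//.
by rewrite mul1r.
Qed.

Let dot_perturbedE f j : dot f (perturbed t j) =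
  if odd j then dot f (fun x => 'i * expw pi (tau j./2) x) else dot f (expw pi (tau j./2)).
Proof. by case: ifP => oj; congr dot; apply/funext => x; rewrite /perturbed oj// mul1r. Qed.

Let dotB f j : cL2 f ->
  dot f (fun x => expsys pi j x - perturbed t j x) = dot f (expsys pi j) - dot f (perturbed t j).
Proof. by move=> cf; rewrite dotBr//; [exact: cL2_expsys|exact: cL2_perturbed]. Qed.

(** The dual bound for a real combination of exponentials of integer frequency; the terms of odd
    index, products with multiples by ['i], are dropped. *)
Lemma near_id_shsinc n (c : nat -> R) :
  \sum_(i < n) (c i - \sum_(j < n) c j * shsinc (tau i) j) ^+ 2 <= q ^+ 2 * \sum_(j < n) c j ^+ 2.
Proof.
have ce i := @cL2_expw R pi (zpt R i).
set f := lincomb c (fun i => expw pi (zpt R i)) n.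
have cf : cL2 f by exact: cL2_lincomb.
have := dual cf n.*2; rewrite (dot_lincomb2 ce (@expw_zptON R)); apply: le_trans.
rewrite (sum_pairs (fun j => dot f (fun x => expsys pi j x - perturbed t j x) ^+ 2)).
apply: ler_sum => i _; rewrite -[leLHS]addr0 lerD ?sqr_ge0//.
rewrite dotB// dot_expsysE dot_perturbedE odd_double doubleK.
rewrite (dot_lincomb_basis ce (@expw_zptON R)) ltn_ord dot_lincomb//; last exact: cL2_expw.
by under [X in _ <= (_ - X) ^+ 2]eq_bigr do rewrite dot_expw_zpt.
Qed.

(* Moving [t 0] to [0] makes the first term of the sum vanish, so the bound survives; it turns
   [Hprod t] into the normalised product attached to the node [0]. *)
Lemma near_id_shsinc0 n (c : nat -> R) :
  \sum_(i < n) (c i - \sum_(j < n) c j * shsinc (tau0 i) j) ^+ 2 <= q ^+ 2 * \sum_(j < n) c j ^+ 2.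
Proof.
apply: le_trans (near_id_shsinc n c); case: n => [|n]; first by rewrite !big_ord0.
rewrite [leLHS]big_ord_recl [leRHS]big_ord_recl; apply: lerD => //.
have -> : c (ord0 : 'I_n.+1) - \sum_(j < n.+1) c j * shsinc (tau0 (ord0 : 'I_n.+1)) j = 0.
  rewrite big_ord_recl big1 => [|j _]; rewrite /tau0/= /shsinc sub0r /zpt.
    by rewrite oppr0 mulr0 /sinc eqxx mulr1 addr0 subrr.
  rewrite mulrN sincN [pi * _]mulrC sinc_int.
  case: eqP => [h|_]; last by rewrite mulr0.
  by have /eqP := zenum_inj (h : zenum (bump 0 j) = zenum 0).
by rewrite expr0n/= sqr_ge0.
Qed.

(* If [h] is orthogonal to the perturbed system, its coefficients in the basis are those of [dual],
   whose squares sum to at most [q^2 dot h h]; Parseval then gives [h = 0]. *)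
Lemma hat_determined h : cL2 h -> suppin pi h -> (forall k, hat h (t k) = 0) -> forall x, hat h x = 0.
Proof.
move=> ch sh h0.
have p0 := pi_gt0 R.
have s0 : Num.sqrt (2 * pi) != 0 :> R by rewrite gt_eqF// sqrtr_gt0 mulr_gt0.
have dp j : dot h (perturbed t j) = 0.
  have := h0 (zenum j./2); rewrite (hatE p0 _ ch sh) => /eqP.
  rewrite mulf_eq0 => /orP[|]; first by rewrite eq_complex/= (negPf s0).
  by rewrite eq_complex/= dot_perturbedE => /andP[/eqP h1 /eqP h2]; case: ifP.
have hh : dot h h = 0.
  have : dot h h <= q ^+ 2 * dot h h.
    apply: (cvgr_to_le (parseval_expsys p0 ch sh)); apply: nearW => n.
    apply: le_trans (dual ch n); rewrite le_eqVlt; apply/orP; left; apply/eqP.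
    by apply: eq_bigr => j _; rewrite dotB// dp subr0.
  have := dot_ge0 mu h; set d := dot h h => d0 dq.
  apply/eqP; rewrite eq_le d0 andbT; move: Q1 dq; nra.
move=> x; apply: sqn_eq0.
have d1 : dot h (expw pi x) = 0.
  by apply/eqP; rewrite -sqrf_eq0 eq_le sqr_ge0 andbT; have := dot_CS ch (cL2_expw pi x); rewrite hh mul0r.
have d2 : dot h (fun y => 'i * expw pi x y) = 0.
  by apply/eqP; rewrite -sqrf_eq0 eq_le sqr_ge0 andbT; have := dot_CS ch (cL2M 'i (cL2_expw pi x)); rewrite hh mul0r.
by rewrite (sqn_hatE p0)// d1 d2 expr0n/= addr0 mulr0.
Qed.

(** Each factor [1 - x / t n] is [(x - t n) / (0 - t n)], and the order of [zenum] matches symmetric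
    partial products with the odd lengths [N.*2.+1]. *)
Lemma Hprod_tau0 x N :
  Hprod t x N = \prod_(j < N.*2.+1 | j != 0%N :> nat) ((x - tau0 j) / (tau0 0%N - tau0 j)).
Proof.
rewrite /Hprod [RHS]big_mkcond/=.
elim: N => [|N IH]; first by rewrite big_geq// big_ord1.
rewrite big_nat_recr//= IH doubleS [in RHS]big_ord_recr [in RHS]big_ord_recr/= -mulrA; congr (_ * _).
rewrite /tau0/= /tau zenum_odd zenum_even !sub0r.
have t1 : t N.+1%:Z != 0 by exact: t_neq0.
have t2 : t (- N.+1%:Z) != 0 by apply: t_neq0; rewrite oppr_eq0.
by congr (_ * _); field.
Qed.

Lemma Hprod_limit : exists g, [/\ cL2 g, suppin pi g, dot g (expw pi 0) = 1 &
  forall x, Hprod t x @ \oo --> dot g (expw pi x)].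
Proof.
have [g [cg g0 _ gi gx]] := sampling_limit 0 Q1 near_id_shsinc0.
exists g; split => //; first exact: gi 0%N.
by move=> x; rewrite (funext (Hprod_tau0 x)); exact: gx.
Qed.

(** Once multiplied by their missing factors, the partial product of [H] and the Lagrange product at
    [t n] have the same zeros, so they differ by a scalar [c_ N]. One point where the second limit
    is nonzero gives the convergence of [c_]. *)
Lemma Hfun_factor n : exists c g, [/\ c != 0, cL2 g /\ suppin pi g,
    forall x, dot g (fun y => 'i * expw pi x y) = 0,
    forall k, dot g (expw pi (t k)) = (k == n)%:R &
    forall x, Hfun t x = c * (x - t n) * dot g (expw pi x)].
Proof.
have [l lE] := zenum_surj n.
have [g [cg g0 gi gtau gx]] := sampling_limit l Q1 near_id_shsinc.
have [e [ce e0 e1 ex]] := Hprod_limit.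
have cG := continuous_dot_expw cg g0; have cE := continuous_dot_expw ce e0.
set G := fun x => dot g (expw pi x) in cG; set E := fun x => dot e (expw pi x) in cE.
have HE x : Hfun t x = (x - t 0) * E x by rewrite /Hfun (cvg_lim _ (ex x)).
have Gl : G (tau l) = 1 by rewrite /G gtau eqxx.
(* The nodes are distinct because [G] is 1 at [tau l] and 0 at the others. *)
have tau_neq j : j != l -> tau l - tau j != 0.
  move=> jl; rewrite subr_eq0; apply/eqP => h; have := gtau j.
  by rewrite -h gtau eqxx (negPf jl) => /eqP; rewrite oner_eq0.
pose P N x := \prod_(j < N.*2.+1 | j != l :> nat) ((x - tau j) / (tau l - tau j)).
pose c_ N := (\prod_(j < N.*2.+1 | j != l :> nat) (tau l - tau j)) /
  \prod_(j < N.*2.+1 | j != 0%N :> nat) (tau0 0%N - tau0 j).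
have level N x : (l < N.*2.+1)%N -> (x - t 0) * Hprod t x N = c_ N * ((x - tau l) * P N x).
  move=> lN; rewrite Hprod_tau0 /P (mul_prod_ratio tau (fun j => tau l - tau j))//.
  have -> : \prod_(j < N.*2.+1 | j != 0%N :> nat) ((x - tau0 j) / (tau0 0%N - tau0 j)) =
     \prod_(j < N.*2.+1 | j != 0%N :> nat) ((x - tau j) / (tau0 0%N - tau0 j)).
    by apply: eq_bigr => j /negPf j0; rewrite [tau0 j]/tau0 j0.
  have -> : t 0 = tau 0%N by [].
  rewrite (mul_prod_ratio tau (fun j => tau0 0%N - tau0 j))// /c_.
  have : \prod_(j < N.*2.+1 | j != l :> nat) (tau l - tau j) != 0.
    by apply/prodf_neq0 => j; exact: tau_neq.
  by move: (\prod_(j < _ | _) _) => u u0; rewrite [RHS]mulrC mulrA divfK.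
have Gtl : G (tau l) != 0 by rewrite Gl oner_neq0.
have [x1 x1l Gx1] := continuous_neq0_off (tau l) cG Gtl.
have lN : \forall N \near \oo, (l < N.*2.+1)%N.
  by exists l.+1 => // N /= lN; apply: leq_trans (leq_doubleS N).
have limH x : (fun N => (x - t 0) * Hprod t x N) @ \oo --> Hfun t x.
  by rewrite HE; apply: cvgM; [exact: cvg_cst|exact: ex].
have limP x : (fun N => (x - tau l) * P N x) @ \oo --> (x - tau l) * G x.
  by apply: cvgM; [exact: cvg_cst|exact: gx].
have D0 : (x1 - tau l) * G x1 != 0 by rewrite mulf_neq0// subr_eq0.
pose c := Hfun t x1 * ((x1 - tau l) * G x1)^-1.
have limc : c_ @ \oo --> c.
  have iv : (fun N => ((x1 - tau l) * P N x1)^-1) @ \oo --> ((x1 - tau l) * G x1)^-1.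
    by apply: cvgV; [exact: D0|exact: limP].
  have : (fun N => ((x1 - t 0) * Hprod t x1 N) * ((x1 - tau l) * P N x1)^-1) @ \oo --> c.
    by apply: cvgM; [exact: limH|exact: iv].
  apply: cvg_trans; apply: near_eq_cvg.
  have nz : \forall N \near \oo, (x1 - tau l) * P N x1 != 0 by exact: (cvgr_neq0 _ (limP x1)).
  near=> N; rewrite level; first by rewrite mulfK//; near: N.
  by near: N.
have HF x : Hfun t x = c * ((x - tau l) * G x).
  apply: (cvg_unique _ (limH x)); first by [].
  have : (fun N => c_ N * ((x - tau l) * P N x)) @ \oo --> c * ((x - tau l) * G x).
    by apply: cvgM; [exact: limc|exact: limP].
  apply: cvg_trans; apply: near_eq_cvg.
  by near=> N; rewrite level//; near: N.
have E0 : E 0 != 0 by rewrite /E e1 oner_neq0.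
(* [E] is 1 at 0 and continuous, hence nonzero at some point other than [t 0], even if [t 0 = 0].
   There [H] does not vanish, which excludes [c = 0]. *)
have [x2 x20 Ex2] := continuous_neq0_off (t 0) cE E0.
exists c, g; split => //.
- apply/eqP => c0; have := HF x2; rewrite c0 mul0r HE => /eqP.
  by rewrite mulf_eq0 subr_eq0 (negPf x20) (negPf Ex2).
- move=> k; have [i <-] := zenum_surj k; rewrite gtau -lE.
  by rewrite (inj_eq zenum_inj).
- by move=> x; rewrite HF /tau lE mulrA.
Unshelve. all: by end_near.
Qed.

End GeneratingFunction.

(** * The transforms of the exponentials and the biorthogonal functions *)

Section Transforms.
Local Open Scope complex_scope.
Variable R : realType.
Notation mu := (@lebesgue_measure R).
Notation dot := (dot mu).
Notation cL2 := (cL2 mu).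

(** The integrals over [-N, N] no longer change as soon as pi <= N. *)
Lemma is_fourier_expo (s : R) :
  is_fourier (expo s) (fun x => (Num.sqrt (2 * pi))%:C * (sinc (pi * (x - s)))%:C).
Proof.
have p0 := pi_gt0 R; have ce := @cL2_expw R pi s.
have -> : (fun x => (Num.sqrt (2 * pi))%:C * (sinc (pi * (x - s)))%:C) = hat (expw pi s).
  by apply/funext => x; rewrite hat_expw rmorphM.
split; first by apply/L2P; exact: (cL2_hat p0 ce (@suppin_expw R pi s)).
have E (N : nat) x : pi <= N%:R :> R ->
    Cintegral `[- N%:R, N%:R] (fun xi => expo s xi * cis (- (xi * x))) = hat (expw pi s) x.
  move=> piN; have out xi : (if xi \in `[- N%:R, N%:R] then expw pi s xi * cis (- (xi * x)) else 0) = expw pi s xi * cis (- (xi * x)).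
    case: ifPn => // xN; rewrite (suppin_le piN (@suppin_expw R pi s) xN) mul0r //.
  rewrite /hat /Cintegral; congr (_ +i* _);
    rewrite [LHS]Rintegral_mkcond; apply: eq_Rintegral => xi _;
    by rewrite -[in RHS]out patchE mem_setE; case: ifP.
have pib : 0 <= pi :> R by exact: pi_ge0.
apply: (@cvg_near_cst _ _ _ _ _).
exists (Num.bound (pi : R)) => // N /= hN.
have piN : pi <= N%:R :> R.
  by apply: le_trans (ltW (archi_boundP pib)) _; rewrite ler_nat.
have -> : (fun x => Cintegral `[- N%:R, N%:R] (fun xi => expo s xi * cis (- (xi * x))) - hat (expw pi s) x) = fun=> 0.
  by apply/funext => x; rewrite E// subrr.
rewrite L2normE; last exact: cL20.
by rewrite /dot; under eq_Rintegral do rewrite /= !mul0r addr0; rewrite Rintegral_cst// mul0r sqrtr0.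
Qed.

Lemma hat_normalized (g : R -> R[i]) x : cL2 g -> suppin pi g ->
  dot g (fun y => 'i * expw pi x y) = 0 ->
  hat (fun y => ((Num.sqrt (2 * pi))^-1)%:C * g y) x = (dot g (expw pi x))%:C.
Proof.
move=> cg g0 gi; have p0 := pi_gt0 R.
have s0 : Num.sqrt (2 * pi) != 0 :> R by rewrite gt_eqF// sqrtr_gt0 mulr_gt0.
rewrite (@hatM _ pi)// (hatE p0)// gi mulrA -rmorphM mulVf// mul1r.
by [].
Qed.

End Transforms.

Local Open Scope complex_scope.

Theorem theorem7p2 (R : realType) (t : int -> R)
    (t_neq0 : forall n : int, n != 0 -> t n != 0)
    (f_riesz : riesz_basis (@L2pi R) (@std_basis R) (fun n => expo (t n)))
    (L : (R -> R[i]) -> (R -> R[i]))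
    (L_bounded : bounded_operator (@L2pi R) L)
    (L_basis : forall n, eqL2 (L (std_basis n)) (expo (t n)))
    (L_near_id : (opnorm (@L2pi R) (fun f x => (f x - L f x)%R) < 1)%E) :
  let F := fun (n : int) (x : R) => (sinc (pi * (x - t n)))%:C in
  [/\ forall n, is_fourier (expo (t n))
                  (fun x => (Num.sqrt (2 * pi))%:C * F n x),
      forall x : R, cvgn (Hprod t x),
      forall n, derivable (Hfun t) (t n) 1 /\ derive1 (Hfun t) (t n) != 0,
      biorthogonal (@PW R) F (Gfun t)
    & forall G, biorthogonal (@PW R) F G -> forall n x, G n x = Gfun t n x].
Proof.
move=> F; have p0 := pi_gt0 R.
have [q [q0 q1 dual]] := near_identity_dual L_bounded L_basis L_near_id.
have der n : derivable (Hfun t) (t n) 1 /\ derive1 (Hfun t) (t n) != 0.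
  have [c [g [c0 [cg g0] _ gk HE]]] := Hfun_factor t_neq0 q0 q1 dual n.
  have G1 : dot lebesgue_measure g (expw pi (t n)) = 1 by rewrite gk eqxx.
  by have [dH ->] := derivable_factor (continuous_dot_expw cg g0) G1 HE.
have GE n : exists g, [/\ cL2 lebesgue_measure g, suppin pi g, forall x, Gfun t n x = hat g x &
    forall k, hat g (t k) = (k == n)%:R].
  have [c [g [c0 [cg g0] gi gk HE]]] := Hfun_factor t_neq0 q0 q1 dual n.
  have G1 : dot lebesgue_measure g (expw pi (t n)) = 1 by rewrite gk eqxx.
  have [_ dHc] := derivable_factor (continuous_dot_expw cg g0) G1 HE.
  exists (fun y => ((Num.sqrt (2 * pi))^-1)%:C * g y); split.
  - exact: cL2M.
  - exact: suppinM.
  - move=> x; rewrite hat_normalized// /Gfun dHc HE; congr (_%:C).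
    (* The value 1 of [Gfun] at [t n] agrees with the normalisation of the limit function there;
       elsewhere the factor [c], which is the derivative of [H] at [t n], cancels. *)
    case: eqP => [->|/eqP xt]; first by rewrite G1.
    by field; rewrite c0 subr_eq0 xt.
  - by move=> k; rewrite hat_normalized// gk; case: (k == n).
have cvgH x : cvgn (Hprod t x).
  have [g [_ _ _ h]] := Hprod_limit t_neq0 q0 q1 dual.
  by apply/cvg_ex; eexists; exact: h.
have biG : biorthogonal (@PW R) F (Gfun t).
  split=> [n|n m].
    have [g [cg g0 gE _]] := GE n.
    by rewrite (funext gE); exact: PW_hat.
  have [g [cg g0 gE gk]] := GE m.
  by rewrite (funext gE) inner_sinc// gk; case: (n == m); rewrite ?conjc1 ?conjc0.
split => //; first by move=> n; exact: is_fourier_expo.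
move=> G [GP Gbi] n x.
have [g [cg g0 gE gk]] := GE n.
have [u [cu u0 uE]] := PW_inv (GP n).
rewrite uE gE; apply/eqP; rewrite -subr_eq0; apply/eqP.
(* The reproducing property gives both transforms the same values at all nodes [t k], so that of the
   difference vanishes there and [hat_determined] applies. *)
pose h y := u y + (-1) * g y.
have ch : cL2 lebesgue_measure h by apply: cL2D => //; exact: cL2M.
have sm : suppin pi (fun y => (-1) * g y) by exact: suppinM.
have sh : suppin pi h by move=> y py; rewrite /h u0// g0// mulr0 addr0.
have hE y : hat h y = hat u y - hat g y.
  by rewrite (hatD p0)//; [rewrite (@hatM _ pi)// mulN1r|exact: cL2M].
rewrite -hE; apply: (hat_determined q0 q1 dual ch sh) => k.
have := Gbi k n; rewrite (funext uE) inner_sinc// => /(congr1 conjc).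
rewrite conjcK hE gk => ->.
by case: (k == n); rewrite ?conjc1 ?conjc0 subrr.
Qed.
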